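(* Let $\mathcal X$ be a Banach space and $A:\mathcal X\to\mathcal X$ a bounded linear operator of positive type that is one-to-one and has unbounded inverse. Let $(R_\alpha)_{\alpha>0}$ be a family of regularization operators for $A$ with saturation $p_0\in(0,\infty]$ (in the sense of the context). Let $f\in\mathcal R(A)$, let $u^\dagger\in\mathcal X$ satisfy $Au^\dagger=f$, let $\overline u\in\mathcal X$, and assume that $$\overline u-u^\dagger=A^p v\quad\text{for some } v\in\mathcal D((\log A)^\nu),$$ where $0\le p<p_0$ and $\nu\ge1$ is an integer. Fix $\lambda>\log\|A\|$, put $w=(\lambda I-\log A)^\nu v$ and $d_w=\max\{\|w\|,1\}$. Fix constants $0<\delta_0<1$ and $c_1>0$, and for $0<\delta\le\delta_0$ let $$\alpha_\delta=c_1\,\delta^{\frac1{p+1}}\bigl(\log\tfrac1\delta\bigr)^{\frac{\nu}{p+1}}.$$ Then there is a finite constant $c>0$, independent of $\delta$ and $w$, such that for every $0<\delta\le\delta_0$ and every $f^\delta\in\mathcal X$ with $\|f-f^\delta\|\le\delta$, the element $u_{\alpha_\delta}^\delta=\overline u-R_{\alpha_\delta}(A\overline u-f^\delta)$ satisfies $$\|u_{\alpha_\delta}^\delta-u^\dagger\|\le c\,d_w\,\delta^{\frac p{p+1}}\bigl(\log\tfrac1\delta\bigr)^{-\frac{\nu}{p+1}}.$$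
   Context: Positive type: a bounded linear operator $A:\mathcal X\to\mathcal X$ is of positive type if for every $\alpha>0$ the operator $A+\alpha I:\mathcal X\to\mathcal X$ is one-to-one and onto, and $\|(A+\alpha I)^{-1}\|\le\kappa_*/\alpha$ for all $\alpha>0$, with a finite constant $\kappa_*>0$. $\mathcal R(A)$ denotes the range of $A$, which need not be dense in $\mathcal X$. Fractional powers: for $0<p<1$, $A^p u=\frac{\sin\pi p}{\pi}\int_0^\infty s^{p-1}(A+sI)^{-1}Au\,ds$ for $u\in\mathcal X$ (improper Bochner integral); for arbitrary $p>0$, $A^p=A^{p-\lfloor p\rfloor}A^{\lfloor p\rfloor}$, with $A^0=I$. The operators $A^p$, $p\ge0$, form a $C_0$-semigroup on $\overline{\mathcal R(A)}$. Logarithm: $\log A$ is the infinitesimal generator of the $C_0$-semigroup $(A^p)_{p\ge0}$ on $\overline{\mathcal R(A)}$, i.e. $(\log A)u=\lim_{p\downarrow0}\frac1p(A^pu-u)$, with $\mathcal D(\log A)=\{u\in\mathcal X:\lim_{p\downarrow0}\frac1p(A^pu-u)\text{ exists}\}\subset\overline{\mathcal R(A)}$. $(\log A)^\nu$ is its $\nu$-fold composition with the natural domain $\mathcal D((\log A)^\nu)$. For real $x>0$, $\log x$ is the natural logarithm. Regularization operators with saturation $p_0\in(0,\infty]$: bounded linear operators $R_\alpha:\mathcal X\to\mathcal X$, $\alpha>0$, with $S_\alpha:=I-R_\alpha A$, such that for all $\alpha>0$: (i) $\|R_\alpha\|\le e_*/\alpha$; (ii) $\|S_\alpha A^p\|\le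 e_p\,\alpha^p$ for all $0\le p\le p_0$ (for all $0\le p<\infty$ if $p_0=\infty$); (iii) $R_\alpha A=AR_\alpha$. Here $e_*$ and $e_p$ are finite constants (independent of $\alpha$), and $p\mapsto e_p$ is bounded on bounded intervals. *)

(* Defs.v *)
From HB Require Import structures.
From mathcomp Require Import all_boot all_order all_algebra.
From mathcomp Require Import all_classical all_reals all_analysis.

Set Implicit Arguments.
Unset Strict Implicit.
Unset Printing Implicit Defensive.

Import Order.TTheory GRing.Theory Num.Theory.
Import numFieldNormedType.Exports.

Local Open Scope classical_set_scope.
Local Open Scope ring_scope.

Section BochnerIntegral.
Context d (T : measurableType d) (R : realType)
  (mu : {measure set T -> \bar R}) (X : normedModType R) (D : set T).

(* The condition on mu is not imposed at x = 0, which does not contribute to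
   the integral. *)
Definition vsimple (g : T -> X) : Prop :=
  [/\ finite_set (range g),
      forall x, measurable (g @^-1` [set x]) &
      forall x, x != 0 -> (mu (D `&` g @^-1` [set x]) < +oo)%E].

Definition vsimple_integral (g : T -> X) : X :=
  \sum_(x \in [set: X]) fine (mu (D `&` g @^-1` [set x])) *: x.

Definition is_bochner (f : T -> X) (I : X) : Prop :=
  exists g : nat -> T -> X,
    [/\ forall n, vsimple (g n),
        {ae mu, forall t, D t -> g n t @[n --> \oo] --> f t},
        (\int[mu]_(t in D) (`|f t - g n t|%R)%:E)%E @[n --> \oo] --> 0%E &
        vsimple_integral (g n) @[n --> \oo] --> I].

(* 0 if f is not Bochner integrable on D *)
Definition bochner (f : T -> X) : X := xget 0 [set I | is_bochner f I].

End BochnerIntegral.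

(* Real scalars only: a complex Banach space is a real one by restriction of
   scalars, and this changes none of the notions below. *)
Section Operators.
Context (R : realType) (X : completeNormedModType R).
Implicit Types (A T : X -> X) (s p : R).

(* Extended-real valued, so that a finite bound on it entails boundedness. *)
Definition opnorm T : \bar R :=
  ereal_sup [set `|T x|%:E | x in [set x | `|x| <= 1]].

Definition resolvent A s : X -> X :=
  fun y => xget 0 [set x | A x + s *: x = y].

Definition positive_type A : Prop :=
  exists2 kappa : R, 0 < kappa &
    forall s, 0 < s -> bijective (fun u => A u + s *: u) /\
                       (opnorm (resolvent A s) <= (kappa / s)%:E)%E.

Definition has_bounded_inverse A : Prop :=
  exists C : R, forall f u, A u = f -> `|u| <= C * `|f|.

(* Improper at both ends of ]0, +oo[. *)
Definition improper_bochner (f : R -> X) : X :=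
  lim (bochner (@lebesgue_measure R) `[ab.1, ab.2] f
         @[ab --> filter_prod (0 : R)^'+ (pinfty_nbhs R)]).

(* meant for 0 <= p < 1 *)
Definition fracpow A p : X -> X := fun u =>
  if p == 0 then u else
  (sin (pi * p) / pi) *:
    improper_bochner (fun s => s `^ (p - 1) *: resolvent A s (A u)).

(* meant for 0 <= p *)
Definition oppow A p : X -> X := fun u =>
  fracpow A (p - (Num.truncn p)%:R) (iter (Num.truncn p) A u).

Definition log_dom A : set X :=
  [set u | cvg (p^-1 *: (oppow A p u - u) @[p --> (0 : R)^'+])].

Definition oplog A : X -> X := fun u =>
  lim (p^-1 *: (oppow A p u - u) @[p --> (0 : R)^'+]).

(* Natural domain of the n-fold composition of a partial operator, given by its
   domain D and a total extension L. *)
Definition iter_dom (D : set X) (L : X -> X) (n : nat) : set X :=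
  [set u | forall k, (k < n)%N -> D (iter k L u)].

Definition residual A (B : X -> X) : X -> X := fun u => u - B (A u).

(* The exponents p range over the finite reals in [0, p0]; e is unconstrained
   outside this range. *)
Definition regularization A (p0 : \bar R) (Reg : R -> {linear X -> X}) : Prop :=
  exists (estar : R) (e : R -> R),
    (forall b : R, exists M : R, forall p,
       0 <= p <= b -> (p%:E <= p0)%E -> `|e p| <= M) /\
    forall a, 0 < a ->
      [/\ bounded_near (Reg a) (nbhs (0 : X)),
          (opnorm (Reg a) <= (estar / a)%:E)%E,
          forall p, 0 <= p -> (p%:E <= p0)%E ->
            (opnorm (residual A (Reg a) \o oppow A p) <= (e p * a `^ p)%:E)%E &
          forall u, Reg a (A u) = A (Reg a u)].

End Operators.

(* Main.v *)
(* Fractional powers. Let J_p(t) be Balakrishnan's integral, of exponent p, for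
   A + t. An integration by parts gives J_p'(t) = p (A + t)^-1 J_p(t). Hence, if
   a + b + c = 1, then (A + t)^-1 J_a(t) J_b(t) J_c(t) does not depend on t. Its limit
   as t tends to +oo is a product of integrals of s^(p-1) / (1 + s), which are equal
   to pi / sin(pi p): apply the same differential equation to the rotation of the
   plane by a right angle. So A^a A^b A^c = A, and the semigroup law follows because
   A is one-to-one.

   Logarithm. For v in the domain of log A, telescoping v - e^(-lambda T) A^T v over
   small steps gives, for every bounded operator S,
     |S v| <= e^(-lambda T) |S A^T v| + C / m
   whenever e^(-lambda q) |S A^q (lambda - log A) v| <= C e^(-m q) for q in [0, T].
   The operators S_alpha A^(p+q) decay like alpha^(p+q), so m is proportional to
   log(1/delta), and nu applications of this bound give
   |S_alpha A^p v| <= C alpha^p log(1/delta)^(-nu) |w|. The noise contributes at most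
   e_* delta / alpha, and the choice of alpha balances the two terms. *)

From HB Require Import structures.
Require Import Defs.
From mathcomp Require Import all_boot all_order all_algebra.
From mathcomp Require Import all_classical all_reals all_analysis.
From mathcomp Require Import measurable_realfun ring lra.
Import Order.TTheory GRing.Theory Num.Theory.
Import numFieldNormedType.Exports.
Local Open Scope classical_set_scope.
Local Open Scope ring_scope.

Set Implicit Arguments.
Unset Strict Implicit.
Unset Printing Implicit Defensive.

(** * Bochner integrals of Lipschitz functions *)

(** On compact subintervals of ]0, +oo[ the integrands that occur are Lipschitz, so their Bochner
    integrals are increments of primitives ([lipschitz_bochner]), and every later identity or bound
    for integrals is one for primitives. A product of several Balakrishnan integrals would be a
    multiple integral; following it along the shift t reduces it to a product rule and to its
    behaviour at both ends of ]0, +oo[.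

    Three factors are taken because two exponents of sum 1 only relate A^p to A^(1-p). With a third
    one, A^a A^b and A^(a+b) have the same image A under A^c, and A^c is injective because A^(1-c)
    A^c = A is.

    The final constant must not depend on delta or on v. Hence the decay estimates fix their
    constants before the operator S, alpha and v, and see S only through the bounds of S A^q for q
    up to p + r0, where r0 > 0 exists because p < p0. This margin r0 is cut into nu equal pieces,
    one for each power of log(1/delta) to be gained. *)

Section SimpleIntegral.
Context d (T : measurableType d) (R : realType)
  (mu : {measure set T -> \bar R}) (X : normedModType R) (D : set T).
Hypotheses (mD : measurable D) (muD : (mu D < +oo)%E).

Let fibre_fin (E : set T) : measurable E -> mu (D `&` E) \is a fin_num.
Proof.
move=> mE; rewrite ge0_fin_numE//; apply: le_lt_trans muD.
by apply: le_measure; rewrite ?inE//; exact: measurableI.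
Qed.

(** The integrand factors through a finite labelling [h], and [c] may repeat values: the fibre over
    a value is the disjoint union of the fibres of its labels. Such labellings give common
    refinements and Riemann sums. *)
Lemma vsimple_integral_fibres (J : choiceType) (s : seq J) (h : T -> J)
    (c : J -> X) : uniq s -> (forall t, h t \in s) ->
    (forall j, measurable (h @^-1` [set j])) ->
  vsimple_integral mu D (c \o h) =
    \sum_(j <- s) fine (mu (D `&` h @^-1` [set j])) *: c j.
Proof.
move=> us hs mh.
have fibreE x : fine (mu (D `&` (c \o h) @^-1` [set x])) =
    \sum_(j <- s | c j == x) fine (mu (D `&` h @^-1` [set j])).
  have -> : D `&` (c \o h) @^-1` [set x] =
      \bigcup_(j in [set` [seq j <- s | c j == x]]) (D `&` h @^-1` [set j]).
    apply/seteqP; split => [t [Dt /= cx]|t [j /=]].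
      by exists (h t) => //=; rewrite mem_filter hs andbT; apply/eqP.
    by rewrite mem_filter => /andP[/eqP cj _] [Dt /= ->].
  rewrite measure_fin_bigcup//; last 2 first.
  - by move=> i j _ _ [t [[_ /= <-] [_ /= <-]]].
  - by move=> j _; exact: measurableI.
  rewrite -fsbig_seq ?filter_uniq// big_filter sum_fine//.
  by move=> j _; exact: fibre_fin.
rewrite /vsimple_integral.
rewrite (fsbigE (undup (map c s))) ?undup_uniq//; last first.
  move=> x _; rewrite mem_undup => xs.
  have -> : (c \o h) @^-1` [set x] = set0.
    rewrite -subset0 => t /= cx; move: xs; rewrite -cx.
    by rewrite map_f.
  by rewrite setI0 measure0 scale0r.
rewrite (eq_bigl xpredT); last by move=> x; apply: mem_set.
under eq_bigr do rewrite fibreE scaler_suml.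
under eq_bigr do rewrite big_mkcond.
rewrite exchange_big/= [RHS]big_seq [LHS]big_seq.
apply: eq_bigr => j js.
rewrite (bigD1_seq (c j)) ?undup_uniq//=; last by rewrite mem_undup map_f.
rewrite eqxx big1 ?addr0// => x /negPf; rewrite eq_sym => ->//.
Qed.

Lemma vsimple_seq (g : T -> X) : vsimple mu D g ->
  exists s : seq X, uniq s /\ forall t, g t \in s.
Proof.
case=> /finite_fsetP[F rF] _ _; exists (finmap.enum_fset F); split.
  exact: finmap.fset_uniq.
move=> t; have : range g (g t) by exists t.
by rewrite rF.
Qed.

(** Labelled by the pair of their values, both functions are constant on the same cells, so the two
    integrals are sums with the same weights. *)
Lemma vsimple_integral_dist (g g' : T -> X) :
  vsimple mu D g -> vsimple mu D g' ->
  (`|vsimple_integral mu D g - vsimple_integral mu D g'|%:E <=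
     \int[mu]_(t in D) (`|g t - g' t|%R)%:E)%E.
Proof.
move=> sg sg'; have [s [us gs]] := vsimple_seq sg.
have [s' [us' gs']] := vsimple_seq sg'.
have [_ mg _] := sg; have [_ mg' _] := sg'.
pose h t := (g t, g' t).
pose w := [seq (x, y) | x <- s, y <- s'].
have uw : uniq w by apply: allpairs_uniq => // -[? ?] [? ?].
have hw t : h t \in w by apply: allpairs_f.
have mh j : measurable (h @^-1` [set j]).
  have -> : h @^-1` [set j] = g @^-1` [set j.1] `&` g' @^-1` [set j.2].
    by case: j => x y; apply/seteqP; split => t /=; case=> <- <-.
  exact: measurableI.
have -> : g = fst \o h by [].
have -> : g' = snd \o h by [].
rewrite !(@vsimple_integral_fibres _ w)// -sumrB.
under eq_bigr do rewrite -scalerBr.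
rewrite (eq_integral (fun t => \sum_(j <- w)
  (`|j.1 - j.2| * \1_(h @^-1` [set j]) t)%:E)%E); last first.
  move=> t _; rewrite (bigD1_seq (h t))//= big1_seq.
    by rewrite adde0 indicE mem_set// mulr1.
  move=> j /andP[jh _]; rewrite indicE memNset ?mulr0//= => jE.
  by rewrite jE eqxx in jh.
rewrite ge0_integral_sum//; last first.
  move=> j; apply/measurable_EFinP; exact: measurable_funM.
have -> : (\sum_(j <- w) \int[mu]_(t in D)
    (`|j.1 - j.2| * \1_(h @^-1` [set j]) t)%:E)%E =
    (\sum_(j <- w) fine (mu (D `&` h @^-1` [set j])) * `|j.1 - j.2|)%:E.
  rewrite -sumEFin; apply: eq_bigr => j _.
  under eq_integral do rewrite EFinM.
  rewrite ge0_integralZl//; last by apply/measurable_EFinP.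
  by rewrite integral_indic// EFinM fineK ?fibre_fin// muleC setIC.
rewrite lee_fin (le_trans (ler_norm_sum _ _ _))// ler_sum// => j _.
by rewrite normrZ ger0_norm// fine_ge0.
Qed.

(** Measurability of [f] is expressed through its distances to fixed points; on each of the finitely
    many fibres of [g], the distance to [g] is of this kind. *)
Lemma measurable_dist_vsimple (f g : T -> X) : vsimple mu D g ->
    (forall x, measurable_fun D (fun t => `|f t - x|)) ->
  measurable_fun D (fun t => `|f t - g t|).
Proof.
move=> sg mf; have [s [us gs]] := vsimple_seq sg; have [_ mg _] := sg.
move=> _ Y mY.
have -> : D `&` (fun t => `|f t - g t|) @^-1` Y =
    \bigcup_(x in [set` s]) (g @^-1` [set x] `&`
      (D `&` (fun t => `|f t - x|) @^-1` Y)).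
  apply/seteqP; split => [t [Dt /= Yt]|t [x /= _ [/= -> []]]//].
  by exists (g t) => //=.
apply: fin_bigcup_measurable => // x _; apply: measurableI => //.
exact: mf.
Qed.

(** [bochner] selects a value by choice; this determines it. The integrals of two approximating
    sequences differ by at most the sum of their distances to [f], which tends to 0. *)
Lemma is_bochner_unique (f : T -> X) (I I' : X) :
    (forall x, measurable_fun D (fun t => `|f t - x|)) ->
  is_bochner mu D f I -> is_bochner mu D f I' -> I = I'.
Proof.
move=> mf [g [sg _ fg gI]] [g' [sg' _ fg' gI']].
have mfg n := measurable_dist_vsimple (sg n) mf.
have mfg' n := measurable_dist_vsimple (sg' n) mf.
have mgg' n : measurable_fun D (fun t => `|g n t - g' n t|).
  apply: measurable_dist_vsimple => // x.
  under eq_fun do rewrite distrC.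
  exact: (measurable_dist_vsimple (sg n)).
apply/eqP; rewrite -subr_eq0 -normr_eq0 eq_le normr_ge0 andbT.
have dI : `|vsimple_integral mu D (g n) - vsimple_integral mu D (g' n)|%:E
    @[n --> \oo] --> `|I - I'|%:E.
  apply: cvg_EFin; first by near=> n.
  by apply: cvg_norm; apply: cvgB.
rewrite -lee_fin -[leRHS](adde0 0%E).
apply: (lee_cvg_to dI (cvgeD _ fg fg')) => //.
apply: nearW => n.
apply: le_trans (vsimple_integral_dist (sg n) (sg' n)) _.
rewrite -ge0_integralD//; last 2 first.
- by apply/measurable_EFinP.
- by apply/measurable_EFinP.
apply: ge0_le_integral => //.
- by apply/measurable_EFinP.
- by apply: emeasurable_funD; apply/measurable_EFinP.
- move=> t _; rewrite -EFinD lee_fin.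
  by rewrite (distrC (f t)) (le_trans _ (ler_normD _ _))// addrA subrK.
Unshelve. all: by end_near. Qed.

End SimpleIntegral.

(** * Chaining along an interval and the mean value inequality *)

Section Primitives.
Context (R : realType).

(** Continuous induction, in place of a compactness argument: the supremum of the points reached
    from [a] is reached, and it is [b]. Locally, only pairs containing the centre [x] are compared,
    which is what an expansion at [x] provides. *)
Lemma interval_chaining (Q : R -> R -> Prop) (a b : R) : a <= b ->
    (forall x y z, Q x y -> Q y z -> Q x z) ->
    (forall x, a <= x <= b -> exists2 e, 0 < e &
       forall y, a <= y <= b -> `|y - x| < e ->
         (y <= x -> Q y x) /\ (x <= y -> Q x y)) ->
  Q a b.
Proof.
move=> ab Qtr Qloc.
have aab : a <= a <= b by rewrite lexx.
pose S := [set x | a <= x <= b /\ Q a x].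
have Sa : S a.
  split=> //; have [e e0 /(_ a aab)] := Qloc a aab.
  by rewrite subrr normr0 => /(_ e0)[+ _]; apply.
have hS : has_sup S.
  by split; [exists a | exists b => x [/andP[]]].
pose s := sup S.
have sab : a <= s <= b.
  rewrite ub_le_sup//=; last by case: hS.
  by apply: ge_sup; [exists a | move=> x [/andP[]]].
have [e e0 Qs] := Qloc s sab.
have Qas : Q a s.
  have [x Sx xs] := sup_adherent e0 hS.
  have [xab Qax] := Sx.
  have xles : x <= s by apply: ub_le_sup Sx; case: hS.
  apply: Qtr Qax _; have [//|+ _] := Qs x xab; last exact.
  by rewrite distrC ger0_norm ?subr_ge0// ltrBlDr -ltrBlDl.
have [<-//|sb] := eqVneq s b.
have sltb : s < b by rewrite lt_neqAle sb; case/andP: sab.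
pose y := Num.min b (s + e / 2).
have sy : s < y by rewrite /y lt_min sltb ltrDl divr_gt0.
have yab : a <= y <= b.
  rewrite {2}/y ge_min lexx andbT; apply: le_trans (ltW sy).
  by case/andP: sab.
have Qay : Q a y.
  apply: Qtr Qas _; have [//|_] := Qs y yab; last by apply; exact: ltW.
  rewrite gtr0_norm ?subr_gt0// ltrBlDl.
  apply: (@le_lt_trans _ _ (s + e / 2)); first by rewrite /y ge_min lexx orbT.
  by rewrite ltrD2l ltr_pdivrMr// ltr_pMr// ltr1n.
have : y <= s by apply: ub_le_sup => //; case: hS.
by rewrite leNgt sy.
Qed.

Context (X : normedModType R).

Lemma is_deriveP (F : R -> X) (x : R) (l : X) : is_derive x 1 F l <->
  h^-1 *: (F (h + x) - F x) @[h --> 0^'] --> l.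
Proof.
have E : (fun h : R => h^-1 *: (F (h + x) - F x)) =
    (fun h => h^-1 *: ((F \o shift x) (h *: (1 : R)) - F x)).
  by apply/funext => h /=; rewrite /shift/= [h *: 1]mulr1.
split=> [[dF <-]|Fl]; first by rewrite E; exact: dF.
split; first by rewrite /derivable; apply/cvg_ex; exists l; rewrite -E.
by apply/cvg_lim => //; rewrite -E.
Qed.

Lemma is_derive_near (F : R -> X) (x : R) (l : X) (e : R) : is_derive x 1 F l -> 0 < e ->
  exists2 d, 0 < d & forall y, `|y - x| < d ->
    `|F y - F x - (y - x) *: l| <= e * `|y - x|.
Proof.
move=> /is_deriveP /cvgrPdist_le /(_ e) + e0 => /(_ e0).
rewrite near_withinE => -[d /= d0 H]; exists d => // y yx.
have [->|yNx] := eqVneq y x; first by rewrite !subrr scale0r subr0 !normr0 mulr0.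
have yx0 : y - x != 0 by rewrite subr_eq0.
have := H (y - x); rewrite /ball_/= sub0r normrN subrK => /(_ yx yx0) H1.
have -> : F y - F x - (y - x) *: l =
    - ((y - x) *: (l - (y - x)^-1 *: (F y - F x))).
  by rewrite scalerBr scalerA divff// scale1r opprB.
by rewrite normrN normrZ mulrC ler_wpM2r.
Qed.

End Primitives.

Section MeanValue.
Context (R : realType) (X : normedModType R).

(** The inequality is proved up to a slack proportional to the length of the interval. In this form
    it is additive and follows locally from the two expansions. *)
Lemma norm_mvt (F : R -> X) (G : R -> R) (f : R -> X) (g : R -> R) a b :
    a <= b ->
    (forall x : R, a <= x <= b -> is_derive x 1 F (f x)) ->
    (forall x : R, a <= x <= b -> is_derive x 1 G (g x)) ->
    (forall x, a <= x <= b -> `|f x| <= g x) ->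
  `|F b - F a| <= G b - G a.
Proof.
move=> ab dF dG fg.
suff H e : 0 < e -> `|F b - F a| <= G b - G a + e * (b - a).
  apply/ler_addgt0Pr => e e0.
  have [->|ba] := eqVneq a b; first by rewrite !subrr normr0 add0r ltW.
  have b_a : 0 < b - a by rewrite subr_gt0 lt_neqAle ba.
  by rewrite -[e in leRHS](@divfK _ (b - a)) ?gt_eqF// H// divr_gt0.
move=> e0.
pose Q x y := `|F y - F x| <= G y - G x + e * (y - x).
apply: (@interval_chaining _ Q) => // [x y z|x xab].
  rewrite /Q => Qxy Qyz.
  have -> : F z - F x = (F y - F x) + (F z - F y) by rewrite [RHS]addrC addrA subrK.
  apply: le_trans (ler_normD _ _) _; apply: le_trans (lerD Qxy Qyz) _.
  by rewrite le_eqVlt; apply/orP; left; apply/eqP; ring.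
(* Half of the slack goes to the expansion of [F], half to that of [G]. *)
have e20 : 0 < e / 2 by rewrite divr_gt0.
have [d1 d10 H1] := is_derive_near (dF _ xab) e20.
have [d2 d20 H2] := is_derive_near (dG _ xab) e20.
exists (Num.min d1 d2); first by rewrite lt_min d10.
move=> y yab; rewrite lt_min => /andP[/H1 {}H1 /H2 {}H2].
have H3 : `|F y - F x| <= `|y - x| * g x + e / 2 * `|y - x|.
  rewrite -[F y - F x](subrK ((y - x) *: f x)).
  apply: le_trans (ler_normD _ _) _; rewrite addrC lerD// normrZ.
  by rewrite ler_wpM2l// fg.
move: H2; rewrite [(y - x) *: _]/GRing.scale/= ler_norml => /andP[H2 H2'].
rewrite /Q; split=> yx.
  rewrite distrC; apply: le_trans H3 _.
  by move: H2 H2'; rewrite ler0_norm ?subr_le0//; lra.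
apply: le_trans H3 _.
by move: H2 H2'; rewrite ger0_norm ?subr_ge0//; lra.
Qed.

Lemma norm_mvt_sym (F : R -> X) (f : R -> X) a b C :
    (forall x : R, a <= x <= b -> is_derive x 1 F (f x)) ->
    (forall x, a <= x <= b -> `|f x| <= C) ->
  forall x y, a <= x <= b -> a <= y <= b -> `|F x - F y| <= C * `|x - y|.
Proof.
move=> dF fC.
suff H x y : x <= y -> a <= x <= b -> a <= y <= b ->
    `|F y - F x| <= C * `|y - x|.
  move=> x y xab yab; have [xy|/ltW yx] := leP x y; last exact: H.
  by rewrite distrC (distrC x); exact: H.
move=> xy /andP[ax xb] /andP[ay yb].
rewrite ger0_norm ?subr_ge0// mulrBr.
apply: (@norm_mvt F ( *%R C) f (fun=> C)) => // z /andP[xz zy].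
- by apply: dF; rewrite (le_trans ax)//= (le_trans zy).
- by rewrite -[X in is_derive _ _ _ X](mulr1 C); exact: is_deriveZ.
- by apply: fC; rewrite (le_trans ax)//= (le_trans zy).
Qed.

End MeanValue.

(** * Primitives and Riemann sums of Lipschitz functions *)

Section LipschitzBochner.
Context (R : realType) (X : completeNormedModType R).
Variables (f : R -> X) (a b K : R).
Hypotheses (ab : a < b)
  (f_lip : forall x y, a <= x <= b -> a <= y <= b -> `|f x - f y| <= K * `|x - y|).

Let mesh n : R := (b - a) / n.+1%:R.
Let node n k : R := a + k%:R * mesh n.
(** The length of the part of the k-th cell to the left of [x], so that [polygon n] is the integral
    from [a] of the step function with the values of [f] at the nodes. *)
Let step n k (x : R) : R := Num.min x (node n k.+1) - Num.min x (node n k).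
Let polygon n x : X := \sum_(k < n.+1) step n k x *: f (node n k).

Let mesh_gt0 n : 0 < mesh n.
Proof. by rewrite divr_gt0// subr_gt0. Qed.

Let node_last n : node n n.+1 = b.
Proof. by rewrite /node /mesh mulrC divfK ?pnatr_eq0// addrC subrK. Qed.

Let node_in n k : (k < n.+1)%N -> a <= node n k <= b.
Proof.
move=> kn; have m0 := ltW (mesh_gt0 n); rewrite {1}/node lerDl mulr_ge0//=.
by rewrite -[leRHS](node_last n) /node lerD2l ler_wpM2r// ler_nat ltnW.
Qed.

Let K_ge0 : 0 <= K.
Proof.
have aab : a <= a <= b by rewrite lexx ltW.
have bab : a <= b <= b by rewrite lexx ltW.
have := le_trans (normr_ge0 _) (f_lip aab bab).
by rewrite pmulr_lge0// normr_gt0 subr_eq0 lt_eqF.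
Qed.

Let step_le n k x y : x <= y -> step n k x <= step n k y.
Proof.
have : node n k <= node n k.+1.
  by rewrite /node lerD2l ler_wpM2r ?ler_nat// ltW.
move=> + xy; rewrite /step.
move: (node n k) (node n k.+1) => u v uv.
rewrite !minEle; case: ifP; case: ifP; case: ifP; case: ifP;
  move=> /= H1 H2 H3 H4; move: H1 H2 H3 H4; lra.
Qed.

Let sum_step n x : a <= x <= b -> \sum_(k < n.+1) step n k x = x - a.
Proof.
move=> /andP[ax xb].
rewrite -(big_mkord xpredT (step n ^~ x)) telescope_sumr//.
by rewrite node_last min_l// /node mul0r addr0 min_r.
Qed.

(** Only the cells meeting [[x, y]] have a nonzero weight in the difference, and their nodes are
    within [y - x + mesh n] of [x]. *)
Let polygon_local n x y : a <= x <= b -> a <= y <= b -> x <= y ->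
  `|polygon n y - polygon n x - (y - x) *: f x| <=
    (y - x) * (K * (y - x + mesh n)).
Proof.
move=> xab yab xy.
have -> : y - x = \sum_(k < n.+1) (step n k y - step n k x).
  rewrite sumrB !sum_step//; ring.
rewrite /polygon -sumrB scaler_suml -sumrB.
under eq_bigr do rewrite -scalerBl -scalerBr.
rewrite (le_trans (ler_norm_sum _ _ _))//.
rewrite mulr_suml ler_sum// => k _.
rewrite normrZ ger0_norm ?subr_ge0 ?step_le//.
have [->|st] := eqVneq (step n k y) (step n k x); first by rewrite subrr !mul0r.
rewrite ler_wpM2l ?subr_ge0 ?step_le//.
rewrite (le_trans (f_lip (node_in (ltn_ord k)) xab))// ler_wpM2l//.
rewrite sumrB !sum_step// opprB addrA subrK.
have nE : node n k.+1 = node n k + mesh n.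
  by rewrite /node -natr1 mulrDl mul1r addrA.
move: st (mesh_gt0 n); rewrite /step nE => + m0.
move: (node n k) (mesh n) m0 => u m m0.
rewrite !minEle ler_norml; case: ifP; case: ifP; case: ifP; case: ifP;
  move=> /= H1 H2 H3 H4; move: H1 H2 H3 H4 => H1 H2 H3 H4 /eqP st;
  apply/andP; split; try lra; exfalso; apply: st; lra.
Qed.

(** Both polygons follow [(v - u) *: f u] up to [2 * K * e] times [v - u] when [v - u < e]; chaining
    adds up the differences. *)
Let polygon_dist n m e x : mesh n <= e -> mesh m <= e -> a <= x <= b ->
  `|polygon n x - polygon m x| <= 4 * K * e * (b - a).
Proof.
move=> ne me xab; have e0 : 0 < e := lt_le_trans (mesh_gt0 n) ne.
pose D x := polygon n x - polygon m x.
have DaE : D a = 0.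
  have pa k : polygon k a = 0.
    apply: big1 => j _; rewrite /step /node !min_l ?subrr ?scale0r//.
      by rewrite lerDl mulr_ge0// ltW.
    by rewrite lerDl mulr_ge0// ltW.
  by rewrite /D !pa subrr.
have xa : a <= x by case/andP: xab.
have : a <= x -> `|D x - D a| <= 4 * K * e * (x - a).
  move=> _; apply: (@interval_chaining _
      (fun x y => `|D y - D x| <= 4 * K * e * (y - x))) => //.
    move=> u v w uv vw; have -> : D w - D u = (D v - D u) + (D w - D v).
      by rewrite [RHS]addrC addrA subrK.
    apply: le_trans (ler_normD _ _) _; apply: le_trans (lerD uv vw) _.
    by rewrite -mulrDr addrC addrA subrK.
  have loc u v : a <= u <= x -> a <= v <= x -> u <= v -> v - u < e ->
      `|D v - D u| <= 4 * K * e * (v - u).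
    move=> /andP[au ux] /andP[av vx] uv vue.
    have xb : x <= b by case/andP: xab.
    have uab : a <= u <= b by rewrite au (le_trans ux).
    have vab : a <= v <= b by rewrite av (le_trans vx).
    have -> : D v - D u = (polygon n v - polygon n u - (v - u) *: f u)
        - (polygon m v - polygon m u - (v - u) *: f u).
      by rewrite [in RHS]opprB subrKA /D !opprD !opprK addrACA.
    apply: le_trans (ler_normB _ _) _.
    apply: le_trans (lerD (polygon_local n uab vab uv) (polygon_local m uab vab uv)) _.
    rewrite -mulrDr -mulrDr mulrC ler_wpM2r ?subr_ge0//.
    rewrite [4 * K]mulrC -mulrA ler_wpM2l//; lra.
  move=> u uab; exists e => // v vab vue; split=> vu.
    by apply: loc => //; rewrite distrC ger0_norm ?subr_ge0// in vue.
  by apply: loc => //; rewrite ger0_norm ?subr_ge0// in vue.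
rewrite DaE subr0 => /(_ xa) H; apply: le_trans H _.
have e_ge0 := ltW e0; rewrite ler_wpM2l ?mulr_ge0//.
by rewrite lerD2r; case/andP: xab.
Qed.

Let mesh_cvg : mesh n @[n --> \oo] --> (0 : R).
Proof.
rewrite -(mulr0 (b - a)); apply: cvgMr => //.
have := @cvg_harmonic R; exact.
Qed.

(** The primitive is the limit of the polygons. The first part makes it differentiable inside the
    interval; the second expresses its increment by Riemann sums, which are also the integrals of
    simple functions. *)
Lemma lipschitz_primitive : exists F : R -> X,
  (forall x y, a <= x <= b -> a <= y <= b ->
     `|F y - F x - (y - x) *: f x| <= 2 * K * `|y - x| ^+ 2) /\
  (\sum_(k < n.+1) (b - a) / n.+1%:R *: f (a + k%:R * ((b - a) / n.+1%:R)))
     @[n --> \oo] --> F b - F a.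
Proof.
have pcvg x : a <= x <= b -> cvgn (polygon ^~ x).
  move=> xab; apply/cauchy_cvgP/cauchyP => e e0.
  pose e' := e / (4 * K * (b - a) + 1) / 2.
  have C0 : 0 < 4 * K * (b - a) + 1.
    by rewrite ltr_wpDl// mulr_ge0 ?mulr_ge0// subr_ge0 ltW.
  have e'0 : 0 < e' by rewrite !divr_gt0.
  have [N _ HN] : \forall n \near \oo, mesh n <= e'.
    have /cvgrPdist_le/(_ _ e'0) := mesh_cvg; apply: filterS => n.
    by rewrite sub0r normrN ger0_norm// ltW.
  exists (polygon N x); exists N => // n /= /HN ne.
  rewrite -ball_normE/=.
  apply: le_lt_trans (polygon_dist (HN N (leqnn N)) ne xab) _.
  have e'E : e' * (4 * K * (b - a) + 1) = e / 2.
    by rewrite /e' mulrAC divfK// gt_eqF.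
  by lra.
pose F x := lim (polygon n x @[n --> \oo]).
have Fcvg x : a <= x <= b -> polygon n x @[n --> \oo] --> F x by exact: pcvg.
have Floc x y : a <= x <= b -> a <= y <= b -> x <= y ->
    `|F y - F x - (y - x) *: f x| <= K * (y - x) ^+ 2.
  move=> xab yab xy.
  have H1 : `|polygon n y - polygon n x - (y - x) *: f x| @[n --> \oo] -->
      `|F y - F x - (y - x) *: f x|.
    apply: cvg_norm; apply: cvgB; last exact: cvg_cst.
    by apply: cvgB; exact: Fcvg.
  have H2 : (y - x) * (K * (y - x + mesh n)) @[n --> \oo] -->
      (y - x) * (K * (y - x + 0)).
    apply: cvgMr; apply: cvgMr; apply: cvgD => //; exact: cvg_cst.
  have -> : K * (y - x) ^+ 2 = (y - x) * (K * (y - x + 0)) by ring.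
  apply: (ler_cvg_to H1 H2); apply: nearW => n; exact: polygon_local.
exists F; split=> [x y xab yab|].
  have K0 := K_ge0.
  have [xy|/ltW yx] := leP x y.
    apply: le_trans (Floc _ _ xab yab xy) _.
    by rewrite real_normK ?num_real// ler_wpM2r ?sqr_ge0// ler_peMl// ler1n.
  (* For y below x the expansion is taken at [y]; moving the base point back to [x] costs as much
     again, hence the factor 2. *)
  have -> : F y - F x - (y - x) *: f x =
      - (F x - F y - (x - y) *: f y) - (x - y) *: (f y - f x).
    rewrite scalerBr [in RHS]opprB [RHS]addrAC subKr -scaleNr opprB.
    by rewrite [in RHS]opprB addrC.
  apply: le_trans (ler_normB _ _) _; rewrite normrN normrZ.
  apply: le_trans (lerD (Floc _ _ yab xab yx) (ler_wpM2l (normr_ge0 _) (f_lip yab xab))) _.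
  rewrite -(opprB x y) !normrN real_normK ?num_real// ger0_norm ?subr_ge0//.
  by rewrite le_eqVlt; apply/orP; left; apply/eqP; ring.
have aab : a <= a <= b by rewrite lexx ltW.
have bab : a <= b <= b by rewrite lexx ltW.
have : polygon n b - polygon n a @[n --> \oo] --> F b - F a.
  by apply: cvgB; exact: Fcvg.
apply: cvg_trans; apply: near_eq_cvg; apply: nearW => n.
rewrite /polygon -sumrB; apply: eq_bigr => k _; rewrite -scalerBl; congr (_ *: _).
have nb : node n k.+1 <= b.
  by rewrite -[leRHS](node_last n) lerD2l ler_wpM2r ?ler_nat// ltW.
have kab := node_in (ltn_ord k).
have an : a <= node n k.+1 by rewrite lerDl mulr_ge0// ltW.
rewrite /step (min_r nb) (min_l an) (min_l (proj1 (andP kab))) (min_r (proj2 (andP kab))).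
by rewrite subrr subr0 /node -natr1 -/(mesh n); ring.
Qed.

Local Notation mu := (@lebesgue_measure R).
Local Notation D := (`[a, b]%classic : set R).

(** The label of the cell of [t]. The minimum puts [b] in the last cell, and [truncn] is 0 on
    negative numbers, so that every real has a label at most [n]. *)
Let idx n (t : R) : nat := minn n (Num.truncn ((t - a) / mesh n)).
(** For 0 < k <= n this is a half-line, and each fibre of [idx n] is the difference of two
    consecutive cells. *)
Let cell n k : set R := [set t | (k <= idx n t)%N].

Let cellS n k : (k < n)%N -> cell n k.+1 = `[node n k.+1, +oo[%classic.
Proof.
move=> kn; apply/seteqP; split=> t; rewrite /cell/= in_itv/= andbT leq_min kn/=;
  by rewrite truncn_gt_nat ler_pdivlMr// lerBrDl.
Qed.

Let cell0 n : cell n 0 = setT.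
Proof. by apply/seteqP; split. Qed.

Let cell_last n : cell n n.+1 = set0.
Proof. by apply/seteqP; split=> // t; rewrite /cell/= leq_min ltnn. Qed.

Let measurable_cell n k : (k <= n.+1)%N -> measurable (cell n k).
Proof.
case: k => [|k]; first by rewrite cell0.
rewrite ltnS leq_eqVlt => /orP[/eqP ->|kn]; first by rewrite cell_last.
by rewrite cellS.
Qed.

Let fibreE n k : idx n @^-1` [set k] = cell n k `\` cell n k.+1.
Proof.
apply/seteqP; split=> t; rewrite /cell/=.
  by move=> <-; split => //; rewrite ltnn.
by move=> [kt /negP]; rewrite -leqNgt => tk; apply/eqP; rewrite eqn_leq kt tk.
Qed.

Let idx_le n t : (idx n t <= n)%N.
Proof. exact: geq_minl. Qed.

Let measurable_fibre n k : measurable (idx n @^-1` [set k]).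
Proof.
have [kn|nk] := leqP k n.
  by rewrite fibreE; apply: measurableD; apply: measurable_cell => //; exact: leqW.
have -> : idx n @^-1` [set k] = set0 => //.
by rewrite -subset0 => t /= tk; have := idx_le n t; rewrite tk leqNgt nk.
Qed.

Let measure_cell n k : (k <= n.+1)%N -> mu (D `&` cell n k) = (b - node n k)%:E.
Proof.
case: k => [_|k].
  rewrite cell0 setIT lebesgue_measure_itv/= lte_fin ab.
  by rewrite /node mul0r addr0 EFinB.
rewrite ltnS leq_eqVlt => /orP[/eqP ->|kn].
  by rewrite cell_last setI0 measure0 node_last subrr.
have -> : D `&` cell n k.+1 = `[node n k.+1, b]%classic.
  rewrite cellS//; apply/seteqP; split=> t /=; rewrite !in_itv/= ?andbT.
    by move=> [/andP[_ ->] ->].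
  move=> /andP[nt tb]; split => //; rewrite tb andbT (le_trans _ nt)//.
  by rewrite lerDl mulr_ge0// ltW.
have nb : node n k.+1 < b.
  by rewrite -[ltRHS](node_last n) ltrD2l ltr_pM2r// ltr_nat.
by rewrite lebesgue_measure_itv/= lte_fin nb EFinB.
Qed.

Let muD : (mu D < +oo)%E.
Proof. by rewrite lebesgue_measure_itv/= lte_fin ab -EFinB ltry. Qed.

Let measure_fibre n k : (k < n.+1)%N ->
  mu (D `&` idx n @^-1` [set k]) = (mesh n)%:E.
Proof.
move=> kn; have mA : measurable (D `&` cell n k).
  by apply: measurableI => //; apply: measurable_cell; exact: leqW.
have mB : measurable (cell n k.+1) by exact: measurable_cell.
have Afin : (mu (D `&` cell n k) < +oo)%E.
  by rewrite measure_cell ?ltry//; exact: leqW.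
have cellI : cell n k `&` cell n k.+1 = cell n k.+1.
  by apply/setIidPr => t; apply: leq_trans.
transitivity (mu (D `&` cell n k) - mu (D `&` cell n k.+1))%E.
  by rewrite fibreE setIDA measureD// -setIA cellI.
rewrite !measure_cell//; last exact: leqW.
by rewrite -EFinB /node -natr1; congr EFin; ring.
Qed.

Let approx n t : X := f (node n (idx n t)).

Let measurable_dist x : measurable_fun D (fun t => `|f t - x|).
Proof.
apply: subspace_continuous_measurable_fun => //.
apply/subspace_continuousP => t Dt.
apply/cvgrPdist_le => e e0; rewrite near_withinE.
have K0 : 0 < `|K| + 1 by rewrite ltr_wpDl.
exists (e / (`|K| + 1)) => /=; first exact: divr_gt0.
move=> s /= ts Ds; apply: le_trans (ler_dist_dist _ _) _.
rewrite opprB addrA subrK; apply: le_trans (f_lip Dt Ds) _.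
move: ts; rewrite /= ltr_pdivlMr// => /ltW ts.
apply: le_trans ts; rewrite mulrC ler_wpM2l// (le_trans (ler_norm _))//.
by rewrite lerDl.
Qed.

Let approx_dist n t : D t -> `|f t - approx n t| <= K * mesh n.
Proof.
rewrite /= in_itv/= => tab; have /andP[at_ tb] := tab.
pose k := idx n t; have kn : (k <= n)%N := idx_le n t.
have kt : node n k <= t.
  have [k0|k0] := posnP k; first by rewrite k0 /node mul0r addr0.
  have kE : k = k.-1.+1 by rewrite prednK.
  have : cell n k.-1.+1 t by rewrite -kE /cell/=.
  by rewrite cellS -?kE//= in_itv/= andbT.
have tk : t <= node n k.+1.
  move: kn; rewrite leq_eqVlt => /orP[/eqP kn|kn]; first by rewrite kn node_last.
  have : ~ cell n k.+1 t by rewrite /cell/= -/k ltnn.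
  by rewrite cellS//= in_itv/= andbT => /negP; rewrite -ltNge => /ltW.
have kab : a <= node n k <= b.
  by rewrite (le_trans kt tb) andbT lerDl mulr_ge0// ltW.
apply: le_trans (f_lip tab kab) _; rewrite ler_wpM2l//.
rewrite ger0_norm ?subr_ge0// lerBlDr (le_trans tk)//.
by rewrite /node -natr1 mulrDl mul1r addrA [leRHS]addrC.
Qed.

(** The step functions with the values of [f] at the nodes converge uniformly on [[a, b]], and their
    integrals are exactly the Riemann sums. *)
Lemma lipschitz_is_bochner (I : X) :
  (\sum_(k < n.+1) (b - a) / n.+1%:R *: f (a + k%:R * ((b - a) / n.+1%:R)))
     @[n --> \oo] --> I -> is_bochner mu D f I.
Proof.
move=> SI.
have simple n : vsimple mu D (approx n).
  have fib x : approx n @^-1` [set x] =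
      \bigcup_(k in [set k | (k < n.+1)%N /\ f (node n k) = x]) (idx n @^-1` [set k]).
    apply/seteqP; split=> [t /= tx|t [k /= [_ <-] <-]//].
    by exists (idx n t) => //=; split=> //; rewrite ltnS idx_le.
  have mfib x : measurable (approx n @^-1` [set x]).
    rewrite fib; apply: fin_bigcup_measurable => //.
    by apply: (@sub_finite_set _ _ `I_n.+1); [move=> k [] | exact: finite_II].
  split => //.
  - apply: (@sub_finite_set _ _ ((f \o node n) @` `I_n.+1)).
      by move=> _ [t _ <-]; exists (idx n t) => //=; rewrite ltnS idx_le.
    exact/finite_image/finite_II.
  - move=> x _; apply: le_lt_trans muD; apply: le_measure.
    + apply/mem_set; apply: measurableI; first exact: measurable_itv.
      exact: mfib.
    + by apply/mem_set; exact: measurable_itv.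
    + exact: subIsetl.
have DK n t : D t -> (`|f t - approx n t|%:E <= (K * mesh n)%:E)%E.
  by move=> Dt; rewrite lee_fin approx_dist.
exists approx; split => //.
- apply: aeW => t Dt; apply/cvgrPdist_le => e e0.
  have : K * mesh n @[n --> \oo] --> (0 : R).
    by rewrite -(mulr0 K); apply: cvgMr.
  move=> /cvgrPdist_le/(_ _ e0); apply: filterS => n.
  rewrite sub0r normrN => ne; apply: le_trans (approx_dist n Dt) _.
  exact: le_trans (ler_norm _) ne.
- apply: (@squeeze_cvge _ _ _ _ (fun=> 0%E) _ (fun n => (K * mesh n * (b - a))%:E)).
  + apply: nearW => n; rewrite integral_ge0//=.
    apply: (@le_trans _ _ (\int[mu]_(t in D) (K * mesh n)%:E)%E).
      apply: ge0_le_integral => //.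
        by apply/measurable_EFinP; exact: measurable_dist_vsimple (simple n) _.
      by move=> t Dt; exact: DK.
    by rewrite integral_cst//= lebesgue_measure_itv/= lte_fin ab -EFinB -EFinM.
  + exact: cvg_cst.
  + apply: cvg_EFin; first by near=> n.
    rewrite -(mul0r (b - a)) -(mulr0 K).
    by apply: cvgMl => //; apply: cvgMr.
- apply: cvg_trans SI; apply: near_eq_cvg; apply: nearW => n.
  have idx_in t : idx n t \in iota 0 n.+1.
    by rewrite mem_iota/= add0n ltnS idx_le.
  (* The labels are the cells and not the values, since [f] may take the same value at several
     nodes. *)
  have E := @vsimple_integral_fibres _ _ _ mu X D (measurable_itv _) muD _
    (iota 0 n.+1) (idx n) (f \o node n) (iota_uniq _ _) idx_in (@measurable_fibre n).
  rewrite [RHS]E -[iota 0 n.+1]/(index_iota 0 n.+1) big_mkord.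
  apply: eq_bigr => k _; congr (_ *: _).
  exact/esym/(congr1 fine (measure_fibre (ltn_ord k))).
Unshelve. all: by end_near. Qed.

Lemma lipschitz_bochner (F : R -> X) :
    (forall x : R, a <= x <= b -> is_derive x 1 F (f x)) ->
  bochner mu D f = F b - F a.
Proof.
move=> dF; have [G [dG SG]] := lipschitz_primitive.
have Gf := lipschitz_is_bochner SG.
have -> : bochner mu D f = G b - G a.
  rewrite /bochner; case: xgetP => [I _ fI|/(_ (G b - G a))//].
  by apply: (is_bochner_unique _ muD measurable_dist fI Gf).
apply/eqP; rewrite eq_sym -subr_eq0 -normr_eq0 eq_le normr_ge0 andbT.
have b_a : 0 < b - a by rewrite subr_gt0.
apply/ler_addgt0Pr => e e0; rewrite add0r.
pose H x := F x - G x.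
have -> : F b - F a - (G b - G a) = H b - H a.
  by rewrite /H !opprD !opprK addrACA.
pose c := e / (b - a); have c0 : 0 < c by exact: divr_gt0.
have -> : e = c * (b - a) by rewrite /c divfK// gt_eqF.
(* At [a] and [b] the expansion of [G] is only one-sided, so the chaining is applied to [F - G]
   directly rather than through [norm_mvt]. *)
apply: (@interval_chaining _ (fun x y => `|H y - H x| <= c * (y - x))).
- exact: ltW.
- move=> x y z xy yz; have -> : H z - H x = (H y - H x) + (H z - H y).
    by rewrite [RHS]addrC addrA subrK.
  apply: le_trans (ler_normD _ _) _; apply: le_trans (lerD xy yz) _.
  by rewrite -mulrDr addrC addrA subrK.
- move=> x xab; have c20 : 0 < c / 2 by exact: divr_gt0.
  have [d d0 Hd] := is_derive_near (dF _ xab) c20.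
  have K1 : 0 < 2 * K + 1 by rewrite ltr_wpDl// mulr_ge0.
  exists (Num.min d (c / 2 / (2 * K + 1))); first by rewrite lt_min d0 divr_gt0.
  move=> y yab; rewrite lt_min => /andP[/Hd Fy yK].
  suff Hyx : `|H y - H x| <= c * `|y - x|.
    split=> yx; first by rewrite distrC -(opprB y) -(ler0_norm (_ : y - x <= 0)) ?subr_le0.
    by rewrite -(ger0_norm (_ : 0 <= y - x)) ?subr_ge0.
  have -> : H y - H x = (F y - F x - (y - x) *: f x) - (G y - G x - (y - x) *: f x).
    by rewrite /H [in RHS]opprB subrKA !opprD !opprK addrACA.
  apply: le_trans (ler_normB _ _) _.
  apply: le_trans (lerD Fy (dG _ _ xab yab)) _.
  rewrite expr2 !mulrA -mulrDl ler_wpM2r//.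
  move: yK; rewrite ltr_pdivlMr// mulrDr mulr1 mulrC => yK.
  have := normr_ge0 (y - x); lra.
Qed.

End LipschitzBochner.

(** * Improper integrals *)

Section ImproperIntegral.
Context (R : realType).
Implicit Types (p q s c : R).

Lemma powR_cvgy0 q : q < 0 -> s `^ q @[s --> +oo] --> (0 : R).
Proof.
move=> q0; apply/cvgrPdist_le => e e0.
pose M := e `^ q^-1; have M0 : 0 < M by exact: powR_gt0.
near=> s.
have Ms : M <= s by near: s; apply: nbhs_pinfty_ge; exact: num_real.
have s0 : 0 < s by exact: lt_le_trans Ms.
rewrite sub0r normrN ger0_norm ?powR_ge0//.
rewrite -[q]opprK powRN -[leRHS]invrK lef_pV2 ?posrE ?powR_gt0 ?invr_gt0//.
apply: (@le_trans _ _ (M `^ (- q))).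
  by rewrite /M -powRrM mulrN mulVf ?lt_eqF// powR_inv1// ltW.
have q_ge0 : 0 <= - q by rewrite oppr_ge0 ltW.
by apply: ge0_ler_powR; rewrite ?nnegrE ?(ltW M0) ?(ltW s0).
Unshelve. all: by end_near. Qed.

(* Improper integral over ]0, +oo[ in the sense of primitives. All integrals are
   computed in this sense; [improper_bochnerE] gives the link with Bochner's. *)
Definition impint (X : normedModType R) (f : R -> X) (I : X) : Prop :=
  exists F : R -> X, (forall s : R, 0 < s -> is_derive s 1 F (f s)) /\
    exists l0 l1 : X,
      [/\ F s @[s --> 0^'+] --> l0, F s @[s --> +oo] --> l1 & I = l1 - l0].

Section Theory.
Context (X : normedModType R).
Implicit Types (f g : R -> X) (I J : X).

Lemma impint_ext f g I : (forall s, 0 < s -> f s = g s) ->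
  impint f I -> impint g I.
Proof.
move=> fg [F [dF lF]]; exists F; split=> // s s0.
by rewrite -fg//; exact: dF.
Qed.

Lemma impintD f g I J : impint f I -> impint g J ->
  impint (fun s => f s + g s) (I + J).
Proof.
move=> [F [dF [l0 [l1 [Fl0 Fl1 ->]]]]] [G [dG [m0 [m1 [Gm0 Gm1 ->]]]]].
exists (F + G); split=> [s s0|].
  by apply: is_deriveD; [exact: dF | exact: dG].
exists (l0 + m0), (l1 + m1); split; [exact: cvgD | exact: cvgD |].
by rewrite opprD addrACA.
Qed.

Lemma impintZ f I (k : R) : impint f I -> impint (fun s => k *: f s) (k *: I).
Proof.
move=> [F [dF [l0 [l1 [Fl0 Fl1 ->]]]]].
exists (k *: F); split=> [s s0|].
  by apply: is_deriveZ; exact: dF.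
exists (k *: l0), (k *: l1); split; [exact: cvgZr | exact: cvgZr |].
by rewrite scalerBr.
Qed.

Lemma impintB f g I J : impint f I -> impint g J ->
  impint (fun s => f s - g s) (I - J).
Proof.
move=> fI gJ; rewrite -scaleN1r.
apply: impint_ext (impintD fI (impintZ (-1) gJ)) => s _.
by rewrite scaleN1r.
Qed.

(** The point [c] separates the singularity at 0 from the behaviour at +oo; each side is compared
    with a scalar primitive of bounded increment. *)
Lemma impint_bound f I (g1 g2 G1 G2 : R -> R) c M1 M2 : 0 < c ->
    (forall s : R, 0 < s <= c -> is_derive s 1 G1 (g1 s)) ->
    (forall s : R, c <= s -> is_derive s 1 G2 (g2 s)) ->
    (forall s, 0 < s <= c -> `|f s| <= g1 s) ->
    (forall s, c <= s -> `|f s| <= g2 s) ->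
    (forall s, 0 < s <= c -> G1 c - G1 s <= M1) ->
    (forall s, c <= s -> G2 s - G2 c <= M2) ->
  impint f I -> `|I| <= M1 + M2.
Proof.
move=> c0 dG1 dG2 fg1 fg2 GM1 GM2 [F [dF [l0 [l1 [Fl0 Fl1 ->]]]]].
have H0 : `|F c - l0| <= M1.
  have FF : `|F c - F s| @[s --> 0^'+] --> `|F c - l0|.
    by apply: cvg_norm; apply: cvgB => //; exact: cvg_cst.
  apply: (cvgr_to_le FF); near=> s.
  have s0 : 0 < s by near: s; exact: nbhs_right_gt.
  have sc : s <= c by near: s; exact: nbhs_right_le.
  apply: le_trans (GM1 s _); last by rewrite s0.
  apply: (norm_mvt sc (f := f) (g := g1)) => x /andP[sx xc];
    have x0 := lt_le_trans s0 sx.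
  - exact: dF.
  - by apply: dG1; rewrite x0.
  - by apply: fg1; rewrite x0.
have H1 : `|l1 - F c| <= M2.
  have FF : `|F s - F c| @[s --> +oo] --> `|l1 - F c|.
    by apply: cvg_norm; apply: cvgB => //; exact: cvg_cst.
  apply: (cvgr_to_le FF); near=> s.
  have cs : c <= s by near: s; apply: nbhs_pinfty_ge; exact: num_real.
  apply: le_trans (GM2 s cs).
  apply: (norm_mvt cs (f := f) (g := g2)) => x /andP[cx xs].
  - by apply: dF; exact: lt_le_trans cx.
  - exact: dG2.
  - exact: fg2.
have -> : l1 - l0 = (F c - l0) + (l1 - F c).
  by rewrite [RHS]addrC addrA subrK.
by apply: le_trans (ler_normD _ _) _; exact: lerD.
Unshelve. all: by end_near. Qed.

Lemma is_derive_powR_primitive p C s : 0 < s -> p != 0 ->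
  is_derive s 1 (fun s => C / p * s `^ p) (C * s `^ (p - 1)).
Proof.
move=> s0 p0; have := is_deriveZ (C / p) (is_derive1_powR p s0).
by rewrite /GRing.scale/= mulrA divfK.
Qed.

(** Balakrishnan integrands are of order s^(q-1) at 0 and s^(q-2) at +oo. The cut [c] is kept free:
    taking it equal to the shift t later yields powers of t. *)
Lemma impint_power_bound f I q c C1 C2 : 0 < q < 1 -> 0 < c ->
    (forall s, 0 < s <= c -> `|f s| <= C1 * s `^ (q - 1)) ->
    (forall s, c <= s -> `|f s| <= C2 * s `^ (q - 2)) ->
  impint f I ->
  `|I| <= C1 * c `^ q / q + C2 * c `^ (q - 1) / (1 - q).
Proof.
move=> /andP[q0 q1] c0 f1 f2.
have C10 : 0 <= C1.
  have := le_trans (normr_ge0 _) (f1 c _); rewrite c0 lexx => /(_ isT).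
  by rewrite pmulr_lge0// powR_gt0.
have C20 : 0 <= C2.
  have := le_trans (normr_ge0 _) (f2 c (lexx _)).
  by rewrite pmulr_lge0// powR_gt0.
apply: (impint_bound (g1 := fun s => C1 * s `^ (q - 1))
    (g2 := fun s => C2 * s `^ (q - 2))
    (G1 := fun s => C1 / q * s `^ q)
    (G2 := fun s => C2 / (q - 1) * s `^ (q - 1)) c0) => //.
- by move=> s /andP[s0 _]; apply: is_derive_powR_primitive => //; rewrite gt_eqF.
- move=> s cs; have -> : q - 2 = q - 1 - 1 by ring.
  apply: is_derive_powR_primitive; first exact: lt_le_trans cs.
  by rewrite subr_eq0 lt_eqF.
- move=> s /andP[s0 _].
  rewrite mulrAC lerBlDr lerDl mulr_ge0 ?powR_ge0// divr_ge0// ltW//.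
- move=> s cs.
  have -> : C2 * c `^ (q - 1) / (1 - q) = - (C2 / (q - 1) * c `^ (q - 1)).
    by rewrite -(opprB q 1) invrN mulrN mulrAC.
  rewrite gerDr; rewrite -(opprB 1 q) invrN mulrN mulNr oppr_le0.
  by rewrite mulr_ge0 ?powR_ge0// divr_ge0// subr_ge0 ltW.
Qed.

Lemma impint_eq0 I f : (forall s, 0 < s -> f s = 0) -> impint f I -> I = 0.
Proof.
move=> f0 fI; apply/eqP; rewrite -normr_le0.
have q01 : 0 < (2^-1 : R) < 1 by rewrite invr_gt0 ltr0n invf_lt1 ?ltr1n.
apply: le_trans (impint_power_bound (C1 := 0) (C2 := 0) q01 ltr01 _ _ fI) _.
- by move=> s /andP[s0 _]; rewrite f0// normr0 mul0r.
- by move=> s s1; rewrite f0 ?normr0 ?mul0r// (lt_le_trans ltr01).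
- by rewrite !mul0r addr0.
Qed.

Lemma impint_unique f I J : impint f I -> impint f J -> I = J.
Proof.
move=> fI fJ; apply/eqP; rewrite -subr_eq0; apply/eqP.
by apply: impint_eq0 (impintB fI fJ) => s _; rewrite subrr.
Qed.

Lemma impint_scale f I c : 0 < c -> impint f I ->
  impint (fun s => f (s / c)) (c *: I).
Proof.
move=> c0 [F [dF [l0 [l1 [Fl0 Fl1 ->]]]]].
exists (fun s => c *: F (s / c)); split=> [s s0|].
  have /is_deriveP dFs : is_derive (s / c) 1 F (f (s / c)) by apply: dF; exact: divr_gt0.
  apply/is_deriveP.
  have -> : (fun h : R => h^-1 *: (c *: F ((h + s) / c) - c *: F (s / c))) =
     (fun h => h^-1 *: (F (h + s / c) - F (s / c))) \o (fun h => h / c).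
    apply/funext => h /=; rewrite mulrDl -scalerBr scalerA invf_div [h^-1 * c]mulrC//.
  apply: cvg_comp dFs => A [d /= d0 HA]; exists (d * c) => /=.
    exact: mulr_gt0.
  move=> h /=; rewrite sub0r normrN => hd h0; apply: HA.
    by rewrite /= sub0r normrN normrM normfV (gtr0_norm c0) ltr_pdivrMr.
  by rewrite mulf_neq0// invr_neq0// gt_eqF.
exists (c *: l0), (c *: l1); split; last by rewrite scalerBr.
- apply: cvgZr; apply: cvg_comp Fl0 => A [d /= d0 HA]; exists (d * c) => /=.
    exact: mulr_gt0.
  move=> h /=; rewrite sub0r normrN => hd h0; apply: HA; last exact: divr_gt0.
  by rewrite /= sub0r normrN normrM normfV (gtr0_norm c0) ltr_pdivrMr.
- apply: cvgZr; apply: cvg_comp Fl1 => A [M [Mr HM]].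
  exists (M * c); split; first exact: num_real.
  by move=> h hM; apply: HM; rewrite ltr_pdivlMr.
Qed.

End Theory.

Lemma linear_funB (X Y : lmodType R) (T : X -> Y) : linear T ->
  forall x y, T (x - y) = T x - T y.
Proof.
by move=> TL x y; have := TL (-1) y x; rewrite !scaleN1r => TE; rewrite addrC TE addrC.
Qed.

Lemma linear_fun0 (X Y : lmodType R) (T : X -> Y) : linear T -> T 0 = 0.
Proof. by move=> TL; have := linear_funB TL 0 0; rewrite !subrr. Qed.

Lemma linear_funZ (X Y : lmodType R) (T : X -> Y) : linear T ->
  forall k x, T (k *: x) = k *: T x.
Proof. by move=> TL k x; have := TL k x 0; rewrite (linear_fun0 TL) !addr0. Qed.

Lemma linear_funD (X Y : lmodType R) (T : X -> Y) : linear T ->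
  forall x y, T (x + y) = T x + T y.
Proof. by move=> TL x y; have := TL 1 x y; rewrite !scale1r. Qed.

Lemma linear_fun_cvg (X Y : normedModType R) (T : X -> Y) C
    (I : Type) (F : set_system I) {FF : Filter F} (f : I -> X) l :
    linear T -> (forall x, `|T x| <= C * `|x|) ->
  f x @[x --> F] --> l -> T (f x) @[x --> F] --> T l.
Proof.
move=> TL TC /cvgrPdist_le fl; apply/cvgrPdist_le => e e0.
have C1 : 0 < `|C| + 1 by rewrite ltr_wpDl.
have e'0 : 0 < e / (`|C| + 1) by exact: divr_gt0.
apply: filterS (fl _ e'0) => x; rewrite ler_pdivlMr// => H.
rewrite -linear_funB//; apply: le_trans (TC _) _; apply: le_trans H.
rewrite mulrC ler_wpM2l// (le_trans (ler_norm _))//.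
by rewrite lerDl.
Qed.

Lemma impint_linear (X Y : normedModType R) (T : X -> Y) C f I :
    linear T -> (forall x, `|T x| <= C * `|x|) ->
  impint f I -> impint (T \o f) (T I).
Proof.
move=> TL TC [F [dF [l0 [l1 [Fl0 Fl1 ->]]]]].
exists (T \o F); split=> [s s0|].
  apply/is_deriveP.
  have -> : (fun h : R => h^-1 *: ((T \o F) (h + s) - (T \o F) s)) =
      T \o (fun h => h^-1 *: (F (h + s) - F s)).
    by apply/funext => h /=; rewrite (linear_funZ TL) (linear_funB TL).
  by apply: (linear_fun_cvg TL TC); apply/is_deriveP; exact: dF.
exists (T l0), (T l1); split; last by rewrite (linear_funB TL).
- exact: (linear_fun_cvg TL TC).
- exact: (linear_fun_cvg TL TC).
Qed.

End ImproperIntegral.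

(** * Improper integrals of locally Lipschitz functions *)

Section LocallyLipschitz.
Context (R : realType).

(** The constant may blow up at both ends of ]0, +oo[, as it does at 0 for s^(p-1) with p < 1. *)
Definition loclip (X : normedModType R) (f : R -> X) : Prop :=
  forall a b : R, 0 < a -> a < b -> exists K, forall x y,
    a <= x <= b -> a <= y <= b -> `|f x - f y| <= K * `|x - y|.

Lemma loclipZ (X : normedModType R) (k : R -> R) (f : R -> X) :
  loclip k -> loclip f -> loclip (fun s => k s *: f s).
Proof.
move=> lk lf a b a0 ab; have [K kK] := lk a b a0 ab; have [L fL] := lf a b a0 ab.
have aab : a <= a <= b by rewrite lexx ltW.
have xa z : a <= z <= b -> `|z - a| <= b - a.
  by move=> /andP[az zb]; rewrite ger0_norm ?subr_ge0// lerD2r.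
have bound (Y : normedModType R) (g : R -> Y) M : (forall x y, a <= x <= b ->
      a <= y <= b -> `|g x - g y| <= M * `|x - y|) ->
    forall x, a <= x <= b -> `|g x| <= `|g a| + `|M| * (b - a).
  move=> gM x xab; rewrite -[g x](subrK (g a)) addrC.
  apply: le_trans (ler_normD _ _) _; rewrite lerD2l.
  apply: le_trans (gM _ _ xab aab) _; apply: le_trans (ler_norm _) _.
  by rewrite normrM normr_id ler_wpM2l// xa.
exists ((`|k a| + `|K| * (b - a)) * L + (`|f a| + `|L| * (b - a)) * K).
move=> x y xab yab.
have -> : k x *: f x - k y *: f y = k x *: (f x - f y) + (k x - k y) *: f y.
  by rewrite scalerBr scalerBl addrA subrK.
apply: le_trans (ler_normD _ _) _; rewrite !normrZ mulrDl -!mulrA.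
apply: lerD; first by apply: ler_pM => //; [exact: (bound _ k) | exact: fL].
by rewrite mulrC; apply: ler_pM => //; [exact: (bound _ f) | exact: kK].
Qed.

Lemma loclip_powR p : loclip (fun s : R => s `^ p).
Proof.
move=> a b a0 ab; pose M := Num.max (a `^ (p - 1)) (b `^ (p - 1)).
exists (`|p| * M) => x y xab yab.
apply: (@norm_mvt_sym _ _ (fun s : R => s `^ p) (fun s => p * s `^ (p - 1)) a b)
  => // {x y xab yab} s /andP[as_ sb]; have s0 := lt_le_trans a0 as_.
  exact: is_derive1_powR.
rewrite normrM ler_wpM2l// ger0_norm ?powR_ge0// /M le_max.
have b0 := lt_trans a0 ab.
have [p1|p1] := leP 0 (p - 1).
  by apply/orP; right; apply: ge0_ler_powR => //; rewrite nnegrE ltW.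
have E z : z `^ (p - 1) = (z `^ (1 - p))^-1 by rewrite -powRN opprB.
have p1' : 0 <= 1 - p by lra.
apply/orP; left; rewrite !E lef_pV2 ?posrE ?powR_gt0//.
by apply: ge0_ler_powR => //; rewrite nnegrE ltW.
Qed.

Lemma quadratic_is_derive (X : normedModType R) (F : R -> X) (a b C x : R) l :
    a < x < b ->
    (forall y, a <= y <= b -> `|F y - F x - (y - x) *: l| <= C * `|y - x| ^+ 2) ->
  is_derive x 1 F l.
Proof.
move=> /andP[ax xb] FC; apply/is_deriveP/cvgrPdist_le => e e0.
rewrite near_withinE.
have C1 : 0 < `|C| + 1 by rewrite ltr_wpDl.
pose d := Num.min (Num.min (x - a) (b - x)) (e / (`|C| + 1)).
have d0 : 0 < d by rewrite !lt_min !subr_gt0 ax xb divr_gt0.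
exists d => // h /=; rewrite sub0r normrN => hd h0.
have /andP[/andP[ha hb] he] : (`|h| < x - a) && (`|h| < b - x) && (`|h| < e / (`|C| + 1)).
  by move: hd; rewrite /d !lt_min.
have {}ha : a <= h + x by move: ha; rewrite ltr_norml => /andP[+ _]; lra.
have {}hb : h + x <= b by move: hb; rewrite ltr_norml => /andP[_ +]; lra.
have hxab : a <= h + x <= b by rewrite ha.
have := FC _ hxab; rewrite addrK => H.
have -> : l - h^-1 *: (F (h + x) - F x) = - (h^-1 *: (F (h + x) - F x - h *: l)).
  by rewrite [in RHS]scalerBr scalerA mulVf// scale1r opprB.
rewrite normrN normrZ normfV ler_pdivrMl ?normr_gt0//.
apply: le_trans H _; rewrite expr2 mulrA mulrC ler_wpM2l//.
move: (ltW he); rewrite ler_pdivlMr// => {}he; apply: le_trans he.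
rewrite mulrC ler_wpM2l// (le_trans (ler_norm _))//.
by rewrite lerDl.
Qed.

(** The intervals ]1/(n+2), n+2[ exhaust ]0, +oo[ and all contain 1, so primitives normalised to
    vanish at 1 agree where they overlap. *)
Lemma loclip_primitive (X : completeNormedModType R) (f : R -> X) : loclip f ->
  exists F : R -> X, forall s : R, 0 < s -> is_derive s 1 F (f s).
Proof.
move=> lf; pose a n : R := n.+2%:R^-1; pose b n : R := n.+2%:R.
have a0 n : 0 < a n by rewrite invr_gt0.
have a1 n : a n < 1 by rewrite invf_lt1 ?ltr1n.
have b1 n : 1 < b n by rewrite ltr1n.
have /choice[G dG] n : exists G : R -> X, forall s : R, a n < s < b n ->
    is_derive s 1 G (f s).
  have ab := lt_trans (a1 n) (b1 n).
  have [K fK] := lf _ _ (a0 n) ab; have [G [dG _]] := lipschitz_primitive ab fK.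
  exists G => s sab; apply: (quadratic_is_derive (C := 2 * K) sab) => y yab.
  by apply: dG => //; case/andP: sab => /ltW -> /ltW ->.
(* As x + 1/x < N x + 1, both x and 1/x are below N x + 2. *)
pose N (x : R) := Num.truncn (x + x^-1).
have HN x : 0 < x -> a (N x) < x < b (N x).
  move=> x0; have NE : x + x^-1 < (N x).+1%:R by rewrite -truncn_le_nat.
  have N2 : (N x).+1%:R < (N x).+2%:R :> R by rewrite ltr_nat.
  have xV : 0 < x^-1 by rewrite invr_gt0.
  apply/andP; split; last by rewrite /b; lra.
  by rewrite /a -[ltRHS]invrK ltf_pV2 ?posrE//; lra.
pose F x := G (N x) x - G (N x) 1.
have FE n x : a n < x < b n -> F x = G n x - G n 1.
  move=> xn; have x0 : 0 < x by case/andP: xn => /(lt_trans (a0 n)).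
  have xN := HN _ x0.
  pose lo := Num.min x 1; pose hi := Num.max x 1.
  have in_lohi m s : a m < x < b m -> lo <= s <= hi -> a m < s < b m.
    move=> /andP[ax xb] /andP[ls sh]; apply/andP; split.
      by apply: lt_le_trans ls; rewrite lt_min ax a1.
    by apply: le_lt_trans sh _; rewrite gt_max xb b1.
  have := @norm_mvt_sym _ _ (G (N x) - G n) (fun s => f s - f s) lo hi 0 _ _ x 1.
  move=> /(_ _ _ _ _)/wrap[].
    by move=> s sl; apply: is_deriveB; apply: dG; exact: in_lohi sl.
    by move=> s sl; rewrite subrr normr0.
    by rewrite /lo /hi ge_min le_max !lexx.
    by rewrite /lo /hi ge_min le_max !lexx !orbT.
  rewrite mul0r normr_le0 subr_eq0 => /eqP H.
  have {}H : G (N x) x - G n x = G (N x) 1 - G n 1 by exact: H.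
  rewrite /F -[G (N x) x](subrK (G n x)) H addrAC [_ - _ - G (N x) 1]addrAC.
  by rewrite subrr add0r addrC.
exists F => s s0; have sN := HN _ s0.
apply: near_eq_is_derive (_ : is_derive s 1 (fun x => G (N s) x - G (N s) 1) (f s)).
  have sI : s \in `]a (N s), b (N s)[ by rewrite in_itv.
  apply: filterS (near_in_itvoo sI) => x; rewrite in_itv/= => xN.
  by rewrite (FE (N s)).
rewrite -[f s]subr0; apply: is_deriveB; exact: dG.
Qed.

(** At each end, the increments of a primitive are dominated by a multiple of a power that tends to
    0 there, so completeness gives the limit. *)
Lemma power_bound_impint (X : completeNormedModType R) (f : R -> X) q c C1 C2 :
    loclip f -> 0 < q < 1 -> 0 < c ->
    (forall s, 0 < s <= c -> `|f s| <= C1 * s `^ (q - 1)) ->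
    (forall s, c <= s -> `|f s| <= C2 * s `^ (q - 2)) ->
  exists I, impint f I.
Proof.
move=> lf /andP[q0 q1] c0 f1 f2; have [F dF] := loclip_primitive lf.
have qN : q - 1 != 0 by rewrite subr_eq0 lt_eqF.
have C10 : 0 <= C1.
  have := le_trans (normr_ge0 _) (f1 c _); rewrite c0 lexx => /(_ isT).
  by rewrite pmulr_lge0// powR_gt0.
have C20 : 0 <= C2.
  have := le_trans (normr_ge0 _) (f2 c (lexx _)).
  by rewrite pmulr_lge0// powR_gt0.
have F0 : cvg (F s @[s --> 0^'+]).
  apply/cauchy_cvgP/cauchyP => e e0.
  have : C1 / q * s `^ q @[s --> 0^'+] --> (0 : R).
    by rewrite -[X in _ --> X](mulr0 (C1 / q)); apply: cvgMr; exact: powR_cvg0.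
  move=> /cvgrPdist_lt/(_ _ e0) H.
  near (0 : R)^'+ => d.
  have d0 : 0 < d by near: d; exact: nbhs_right_gt.
  have dc : d <= c by near: d; exact: nbhs_right_le.
  have de : C1 / q * d `^ q < e.
    have : `|0 - C1 / q * d `^ q| < e by near: d.
    rewrite sub0r normrN ger0_norm// mulr_ge0 ?powR_ge0// divr_ge0//; exact: ltW.
  exists (F d).
  suff : \forall s \near (0 : R)^'+, ball (F d) e (F s) by [].
  near=> s; rewrite -ball_normE /=.
  have s0 : 0 < s by near: s; exact: nbhs_right_gt.
  have sd : s <= d by near: s; exact: nbhs_right_le.
  apply: le_lt_trans de.
  apply: (@le_trans _ _ (C1 / q * d `^ q - C1 / q * s `^ q)).
    apply: (norm_mvt sd (f := f) (g := fun s => C1 * s `^ (q - 1))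
      (G := fun s => C1 / q * s `^ q)) => x /andP[sx xd];
      have x0 := lt_le_trans s0 sx.
    + exact: dF.
    + by apply: is_derive_powR_primitive => //; rewrite gt_eqF.
    + by apply: f1; rewrite x0 (le_trans xd).
  rewrite gerBl mulr_ge0 ?powR_ge0// divr_ge0//; exact: ltW.
have F1 : cvg (F s @[s --> +oo]).
  apply/cauchy_cvgP/cauchyP => e e0.
  have : C2 / (1 - q) * s `^ (q - 1) @[s --> +oo] --> (0 : R).
    rewrite -[X in _ --> X](mulr0 (C2 / (1 - q))); apply: cvgMr; apply: powR_cvgy0.
    by rewrite subr_lt0.
  move=> /cvgrPdist_lt/(_ _ e0) H.
  near (pinfty_nbhs R) => d.
  have cd : c <= d by near: d; apply: nbhs_pinfty_ge; exact: num_real.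
  have d0 := lt_le_trans c0 cd.
  have q1' : 0 <= 1 - q by rewrite subr_ge0 ltW.
  have de : C2 / (1 - q) * d `^ (q - 1) < e.
    have : `|0 - C2 / (1 - q) * d `^ (q - 1)| < e by near: d.
    by rewrite sub0r normrN ger0_norm// mulr_ge0 ?powR_ge0// divr_ge0.
  exists (F d).
  suff : \forall s \near +oo, ball (F d) e (F s) by [].
  near=> s; rewrite -ball_normE /= distrC.
  have ds : d <= s by near: s; apply: nbhs_pinfty_ge; exact: num_real.
  apply: le_lt_trans de.
  apply: (@le_trans _ _ (C2 / (q - 1) * s `^ (q - 1) - C2 / (q - 1) * d `^ (q - 1))).
    apply: (norm_mvt ds (f := f) (g := fun s => C2 * s `^ (q - 2))
      (G := fun s => C2 / (q - 1) * s `^ (q - 1))) => x /andP[dx xs];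
      have x0 := lt_le_trans d0 dx.
    + exact: dF.
    + have -> : q - 2 = q - 1 - 1 by ring.
      exact: is_derive_powR_primitive.
    + by apply: f2; exact: le_trans dx.
  rewrite -(opprB 1 q) invrN mulrN !mulNr opprK gerDr oppr_le0.
  by rewrite mulr_ge0 ?powR_ge0// divr_ge0.
exists (lim (F s @[s --> +oo]) - lim (F s @[s --> 0^'+])); exists F; split=> //.
by exists (lim (F s @[s --> 0^'+])), (lim (F s @[s --> +oo])).
Unshelve. all: by end_near. Qed.

Lemma improper_bochnerE (X : completeNormedModType R) (f : R -> X) I :
  loclip f -> impint f I -> improper_bochner f = I.
Proof.
move=> lf [F [dF [l0 [l1 [Fl0 Fl1 ->]]]]].
apply/cvg_lim => //.
have H : F ab.2 - F ab.1 @[ab --> filter_prod (0 : R)^'+ (pinfty_nbhs R)] --> l1 - l0.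
  apply: cvgB.
    by apply: cvg_comp Fl1; exact: cvg_snd.
  by apply: cvg_comp Fl0; exact: cvg_fst.
apply: cvg_trans H; apply: near_eq_cvg.
(* The filter eventually satisfies 0 < a < 1 < b, so that [[a, b]] is a proper interval inside ]0,
   +oo[. *)
exists ([set a : R | 0 < a < 1], [set b : R | 1 < b]) => /=.
  split; last by apply: nbhs_pinfty_gt; exact: num_real.
  by near=> a; apply/andP; split; near: a; [exact: nbhs_right_gt | exact: nbhs_right_lt].
move=> [a b] /= [/andP[a0 a1] b1]; have ab : a < b by exact: lt_trans b1.
have [K fK] := lf a b a0 ab.
have dFab (x : R) : a <= x <= b -> is_derive x 1 F (f x).
  by move=> /andP[ax _]; apply: dF; exact: lt_le_trans ax.
by rewrite (lipschitz_bochner ab fK dFab).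
Unshelve. all: by end_near. Qed.

End LocallyLipschitz.

Lemma derive_continuous (R : realType) (X : normedModType R) (y : R -> X) (t : R) (l : X) :
  is_derive t 1 y l -> y x @[x --> t] --> y t.
Proof.
move=> dy; apply: (differentiable_continuous (f := y)).
by apply/derivable1_diffP; exact: ex_derive.
Qed.

Section ProductRule.
Context (R : realType) (X Y : normedModType R).

(** Resolvents and fractional powers are differentiated vector by vector. The quotient of [y] is
    carried by [P s] with [s] moving: the local uniform bound lets it be replaced by [y'], and
    convergence is then asked at that single vector. *)
Lemma is_derive_apply (P : R -> X -> Y) (y : R -> X) (t d M : R) (l : Y) (y' : X) :
    0 < d ->
    (forall s, `|s - t| < d -> linear (P s)) ->
    (forall s, `|s - t| < d -> forall x, `|P s x| <= M * `|x|) ->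
    is_derive t 1 (P ^~ (y t)) l ->
    P s y' @[s --> t] --> P t y' ->
    is_derive t 1 y y' ->
  is_derive t 1 (fun s => P s (y s)) (l + P t y').
Proof.
move=> d0 PL PM /is_deriveP dP Py' /is_deriveP dy; apply/is_deriveP.
have near_d : \forall h \near (0 : R)^', `|h| < d.
  by rewrite near_withinE; exists d => //= h /=; rewrite sub0r normrN.
have to_t : h + t @[h --> (0 : R)^'] --> t.
  suff : h + t @[h --> (0 : R)^'] --> 0 + t by rewrite add0r.
  by apply: cvg_within_filter; apply: cvgD => //; exact: cvg_cst.
have Q1 : P (h + t) (h^-1 *: (y (h + t) - y t) - y') @[h --> (0 : R)^'] --> (0 : Y).
  have M1 : 0 < `|M| + 1 by rewrite ltr_wpDl.
  apply/cvgrPdist_le => e e0; have e'0 : 0 < e / (`|M| + 1) by exact: divr_gt0.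
  move/cvgrPdist_le : dy => /(_ _ e'0); apply: filterS2 near_d => h hd H1.
  rewrite sub0r normrN; apply: le_trans (PM _ _ _) _; first by rewrite addrK.
  rewrite distrC; move: H1; rewrite ler_pdivlMr// => H1; apply: le_trans H1.
  by rewrite mulrC ler_wpM2l// (le_trans (ler_norm _))// lerDl.
have Q2 : P (h + t) y' @[h --> (0 : R)^'] --> P t y' by exact: cvg_comp to_t Py'.
have H : P (h + t) (h^-1 *: (y (h + t) - y t) - y') + P (h + t) y' +
    h^-1 *: (P (h + t) (y t) - P t (y t)) @[h --> (0 : R)^'] --> l + P t y'.
  by rewrite [l + _]addrC -[P t y']add0r; apply: cvgD => //; exact: cvgD.
apply: cvg_trans H; apply: near_eq_cvg.
apply: filterS near_d => h hd.
have hdt : `|h + t - t| < d by rewrite addrK.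
have L := PL _ hdt.
rewrite (linear_funB L) subrK (linear_funZ L) (linear_funB L) -scalerDr.
by rewrite addrA subrK.
Qed.

Lemma is_derive_scale (k : R -> R) (y : R -> X) (t k' : R) (y' : X) :
  is_derive t 1 k k' -> is_derive t 1 y y' ->
  is_derive t 1 (fun s => k s *: y s) (k' *: y t + k t *: y').
Proof.
move=> /is_deriveP dk /is_deriveP dy; apply/is_deriveP.
have to_t : h + t @[h --> (0 : R)^'] --> t.
  suff : h + t @[h --> (0 : R)^'] --> 0 + t by rewrite add0r.
  by apply: cvg_within_filter; apply: cvgD => //; exact: cvg_cst.
have kt : k (h + t) @[h --> (0 : R)^'] --> k t.
  by apply: cvg_comp to_t _; apply: derive_continuous; apply/is_deriveP; exact: dk.
have H : (h^-1 * (k (h + t) - k t)) *: y t + k (h + t) *: (h^-1 *: (y (h + t) - y t))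
    @[h --> (0 : R)^'] --> k' *: y t + k t *: y'.
  by apply: cvgD; apply: cvgZ => //; exact: cvg_cst.
apply: cvg_trans H; apply: near_eq_cvg; apply: nearW => h.
rewrite scalerA [k (h + t) * _]mulrC -!scalerA -scalerDr; congr (_ *: _).
by rewrite scalerBl scalerBr addrC addrA subrK.
Qed.

End ProductRule.

(** * Balakrishnan integrals *)

(* [Q s] is the inverse of [A + s]. A bound [lo < 0] occurs for the rotation of
   the plane by a right angle, where every real [lo] is possible. *)
Definition resolvent_family (R : realType) (X : normedModType R)
    (A : X -> X) (a : R) (Q : R -> X -> X) (lo K : R) : Prop :=
  [/\ linear A, forall x, `|A x| <= a * `|x|,
      forall s x, lo < s -> A (Q s x) + s *: Q s x = x,
      forall s x, lo < s -> Q s (A x + s *: x) = x &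
      forall s x, lo < s -> `|Q s x| <= K / (s - lo) * `|x|].

Section ResolventFamily.
Context (R : realType) (X : normedModType R).
Variables (A : X -> X) (a : R) (Q : R -> X -> X) (lo K : R).
Hypotheses (K_ge0 : 0 <= K) (rf : resolvent_family A a Q lo K).

Lemma resolvent_linear s : lo < s -> linear (Q s).
Proof.
move=> ls; have [AL _ AQ QA _] := rf => k x y.
have -> : k *: x + y = A (k *: Q s x + Q s y) + s *: (k *: Q s x + Q s y).
  rewrite AL scalerDr addrACA scalerA [s * k]mulrC -scalerA -scalerDr.
  by rewrite !AQ.
by rewrite QA.
Qed.

Lemma resolvent_identity s t x : lo < s -> lo < t ->
  Q s x - Q t x = (t - s) *: Q s (Q t x).
Proof.
move=> ls lt_; have [AL _ AQ QA _] := rf; have QL := resolvent_linear ls.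
rewrite -[in X in X - _](AQ t x lt_) -[X in _ - X](QA s (Q t x) ls).
by rewrite -(linear_funB QL) opprD addrACA subrr add0r -scalerBl (linear_funZ QL).
Qed.

(** The resolvent identity and its version with s and t exchanged give the two orders of the
    product, with the same nonzero factor t - s. *)
Lemma resolvent_comm s t x : lo < s -> lo < t -> Q s (Q t x) = Q t (Q s x).
Proof.
move=> ls lt_; have [->//|st] := eqVneq s t.
have ts0 : t - s != 0 by rewrite subr_eq0 eq_sym.
have H := resolvent_identity x ls lt_.
have := resolvent_identity x lt_ ls.
rewrite -opprB H -scaleNr opprB -(opprB t s) => /(congr1 (fun z => (t - s)^-1 *: - z)).
by rewrite scaleNr opprK scaleNr opprK !scalerA mulVf// !scale1r.
Qed.

Lemma resolvent_commA s x : lo < s -> A (Q s x) = Q s (A x).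
Proof.
move=> ls; have [AL _ AQ QA _] := rf; have QL := resolvent_linear ls.
apply: (addIr (s *: Q s x)); rewrite AQ// -(linear_funZ QL).
by rewrite -(linear_funD QL) QA.
Qed.

Lemma resolvent_continuous s x : lo < s -> Q t x @[t --> s] --> Q s x.
Proof.
move=> ls; have [_ _ _ _ QK] := rf; apply/cvgrPdist_le => e e0.
have s0 : 0 < s - lo by rewrite subr_gt0.
pose d := (s - lo) / 2; have d0 : 0 < d by exact: divr_gt0.
pose M := K / d * (K / (s - lo) * `|x|).
have M0 : 0 <= M by rewrite !mulr_ge0// ?invr_ge0 ltW.
have M1 : 0 < M + 1 by rewrite ltr_wpDl.
exists (Num.min d (e / (M + 1))) => /=; first by rewrite lt_min d0 divr_gt0.
move=> t /=; rewrite lt_min distrC => /andP[td te].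
have dt : d < t - lo by move: td; rewrite ltr_norml /d => /andP[+ _]; lra.
have lt_ : lo < t by rewrite -subr_gt0 (lt_trans d0).
rewrite distrC (resolvent_identity _ lt_ ls) normrZ.
have H : `|Q t (Q s x)| <= M.
  apply: le_trans (QK _ _ lt_) _; apply: ler_pM => //.
  - by rewrite mulr_ge0// invr_ge0 ltW// (lt_trans d0).
  - by rewrite ler_wpM2l// lef_pV2 ?posrE// ?(lt_trans d0)// ltW.
  - exact: QK.
rewrite distrC; apply: (@le_trans _ _ (e / (M + 1) * M)).
  by apply: ler_pM => //; rewrite ltW.
by rewrite -mulrA ler_piMr// ?ltW// ltr_pdivrMl// mulr1 ltrDl.
Qed.

Lemma is_derive_resolvent s x : lo < s -> is_derive s 1 (Q ^~ x) (- Q s (Q s x)).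
Proof.
move=> ls; apply/is_deriveP.
have to_s : h + s @[h --> (0 : R)^'] --> s.
  suff : h + s @[h --> (0 : R)^'] --> 0 + s by rewrite add0r.
  by apply: cvg_within_filter; apply: cvgD => //; exact: cvg_cst.
have H : - Q (h + s) (Q s x) @[h --> (0 : R)^'] --> - Q s (Q s x).
  by apply: cvgN; exact: cvg_comp to_s (@resolvent_continuous s (Q s x) ls).
apply: cvg_trans H; apply: near_eq_cvg.
rewrite near_withinE; exists (s - lo) => /=; first by rewrite subr_gt0.
move=> h /=; rewrite sub0r normrN ltr_norml => /andP[hl _] h0.
have lh : lo < h + s by lra.
rewrite (resolvent_identity _ lh ls) scalerA opprD addrCA subrr addr0 mulrN.
by rewrite mulVf// scaleN1r.
Qed.

Lemma resolvent_loclip t x : lo <= t -> loclip (fun s : R => Q (s + t) x).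
Proof.
move=> lt_ b c b0 bc; have [_ _ _ _ QK] := rf.
exists (K / b * (K / b * `|x|)) => y z /andP[by_ _] /andP[bz _].
have ly : b <= y + t - lo by lra.
have lz : b <= z + t - lo by lra.
have ly0 : lo < y + t by rewrite -subr_gt0 (lt_le_trans b0).
have lz0 : lo < z + t by rewrite -subr_gt0 (lt_le_trans b0).
have bound w u : lo < w -> b <= w - lo -> `|Q w u| <= K / b * `|u|.
  move=> lw bw; apply: le_trans (QK _ _ lw) _; rewrite ler_wpM2r//.
  by rewrite ler_wpM2l// lef_pV2 ?posrE// subr_gt0.
rewrite (resolvent_identity _ ly0 lz0) normrZ opprD addrACA subrr addr0 distrC.
rewrite mulrC ler_wpM2r//; apply: le_trans (bound _ _ ly0 ly) _.
by rewrite ler_wpM2l ?divr_ge0 ?bound// ltW.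
Qed.

(** Balakrishnan's integrand for [A + t], whose resolvent at [s] is [Q (s + t)]; at t = 0 it is the
    integrand of [fracpow]. *)
Definition fracpow_integrand p t u : R -> X :=
  fun s => s `^ (p - 1) *: Q (s + t) (A u + t *: u).

Definition fracpow_integral p t u : X :=
  xget 0 [set I | impint (fracpow_integrand p t u) I].

(** From A + t = (A + s + t) - s. This form is of order s^(p-1) and gives integrability at 0; the
    definition itself has the decay s^(p-2) at +oo. *)
Lemma fracpow_integrandE p t u s : lo <= t -> 0 < s ->
  fracpow_integrand p t u s = s `^ (p - 1) *: (u - s *: Q (s + t) u).
Proof.
move=> lt_ s0; have [_ _ _ QA _] := rf; rewrite /fracpow_integrand.
have ls : lo < s + t by lra.
have QL := resolvent_linear ls.
have -> : A u + t *: u = A u + (s + t) *: u - s *: u.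
  by rewrite scalerDl addrA addrAC addrK.
by rewrite (linear_funB QL) QA// (linear_funZ QL).
Qed.

Lemma fracpow_integrand_loclip p t u : lo <= t -> loclip (fracpow_integrand p t u).
Proof.
by move=> lt_; apply: loclipZ; [exact: loclip_powR | exact: resolvent_loclip].
Qed.

Lemma fracpow_integrand_near0 p t u s : lo <= t -> 0 < s ->
  `|fracpow_integrand p t u s| <= (1 + K) * `|u| * s `^ (p - 1).
Proof.
move=> lt_ s0; have [_ _ _ _ QK] := rf; have ls : lo < s + t by lra.
rewrite fracpow_integrandE// normrZ ger0_norm ?powR_ge0// mulrC.
rewrite ler_wpM2r ?powR_ge0//; apply: le_trans (ler_normB _ _) _.
rewrite mulrDl mul1r lerD2l normrZ gtr0_norm//.
apply: le_trans (ler_wpM2l (ltW s0) (QK _ _ ls)) _.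
rewrite mulrA ler_wpM2r// mulrCA ler_piMr// ler_pdivrMr ?mul1r; lra.
Qed.

Lemma fracpow_integrand_neary p t u s : lo <= t -> 0 < s ->
  `|fracpow_integrand p t u s| <= K * (a + `|t|) * `|u| * s `^ (p - 2).
Proof.
move=> lt_ s0; have [_ Aa _ _ QK] := rf; have ls : lo < s + t by lra.
rewrite normrZ ger0_norm ?powR_ge0//.
have -> : s `^ (p - 2) = s `^ (p - 1) / s.
  have -> : p - 2 = p - 1 + -1 by ring.
  rewrite powRD; last by rewrite (gt_eqF s0) implybT.
  by rewrite powR_inv1// ltW.
rewrite [leRHS]mulrCA ler_wpM2l ?powR_ge0//.
apply: le_trans (QK _ _ ls) _.
have H : `|A u + t *: u| <= (a + `|t|) * `|u|.
  by apply: le_trans (ler_normD _ _) _; rewrite normrZ mulrDl lerD2r.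
have -> : K * (a + `|t|) * `|u| / s = K / s * ((a + `|t|) * `|u|) by ring.
apply: ler_pM => //.
  by rewrite divr_ge0// subr_ge0 ltW.
by rewrite ler_wpM2l// lef_pV2 ?posrE; lra.
Qed.

End ResolventFamily.

Lemma powR_pred (R : realType) (p s : R) : 0 < s -> s `^ (p - 1) = s `^ p / s.
Proof.
move=> s0; rewrite powRD; last by rewrite (gt_eqF s0) implybT.
by rewrite powR_inv1// ltW.
Qed.

Definition beta_integral (R : realType) (p : R) : R :=
  xget 0 [set I | impint (fun s : R => s `^ (p - 1) / (1 + s)) I].

Lemma beta_integralP (R : realType) (p : R) : 0 < p < 1 ->
  impint (fun s : R => s `^ (p - 1) / (1 + s)) (beta_integral p).
Proof.
move=> p01; have [I HI] : exists I, impint (fun s : R => s `^ (p - 1) / (1 + s)) I.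
  apply: (power_bound_impint (C1 := 1) (C2 := 1) _ p01 ltr01).
  - apply: (@loclipZ R R); first exact: loclip_powR.
    move=> b c b0 bc; exists 1 => x y /andP[bx _] /andP[by_ _].
    have x0 : 0 < 1 + x by lra.
    have y0 : 0 < 1 + y by lra.
    have -> : (1 + x)^-1 - (1 + y)^-1 = (y - x) / ((1 + x) * (1 + y)).
      by field; rewrite !gt_eqF.
    rewrite normrM mul1r distrC ler_piMr// normfV invf_le1; last first.
      by rewrite normr_gt0 mulf_neq0// gt_eqF.
    rewrite ger0_norm; last by rewrite mulr_ge0// ltW.
    by rewrite -[X in X <= _]mulr1; apply: ler_pM => //; lra.
  - move=> s /andP[s0 _]; rewrite normrM ger0_norm ?powR_ge0// mul1r.
    rewrite ler_piMr ?powR_ge0// normfV gtr0_norm; last by lra.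
    by rewrite invf_le1; lra.
  - move=> s s1; have s0 : 0 < s by exact: lt_le_trans s1.
    rewrite normrM ger0_norm ?powR_ge0// mul1r.
    have -> : p - 2 = p - 1 - 1 by ring.
    rewrite (powR_pred (p - 1))// ler_wpM2l ?powR_ge0//.
    by rewrite normfV gtr0_norm ?lef_pV2 ?posrE; lra.
by rewrite /beta_integral; case: xgetP => [y _ //|/(_ I)].
Qed.

(** * The Balakrishnan integral as a function of the shift *)

Section FractionalIntegral.
Context (R : realType) (X : completeNormedModType R).
Variables (A : X -> X) (a : R) (Q : R -> X -> X) (lo K : R).
Hypotheses (K_ge0 : 0 <= K) (rf : resolvent_family A a Q lo K).
Variable p : R.
Hypothesis p01 : 0 < p < 1.

Let p0 : 0 < p. Proof. by case/andP: p01. Qed.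
Let p1 : p < 1. Proof. by case/andP: p01. Qed.

Local Notation J := (fracpow_integral A Q p).

Lemma fracpow_integralP t u : lo <= t ->
  impint (fracpow_integrand A Q p t u) (J t u).
Proof.
move=> lt_; have [I HI] : exists I, impint (fracpow_integrand A Q p t u) I.
  apply: (power_bound_impint (C1 := (1 + K) * `|u|) (C2 := K * (a + `|t|) * `|u|) _ p01 ltr01).
  - exact: fracpow_integrand_loclip rf _ _ _ _.
  - move=> s /andP[s0 _]; exact: (fracpow_integrand_near0 K_ge0 rf).
  - move=> s s1; apply: (fracpow_integrand_neary K_ge0 rf) => //.
    exact: lt_le_trans s1.
by rewrite /fracpow_integral; case: xgetP => [y _ //|/(_ I)].
Qed.

Lemma fracpow_integral_unique t u I : lo <= t ->
  impint (fracpow_integrand A Q p t u) I -> J t u = I.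
Proof. by move=> lt_; apply: impint_unique; exact: fracpow_integralP. Qed.

Lemma fracpow_integral_bound t u : lo <= t ->
  `|J t u| <= ((1 + K) / p + K * (a + `|t|) / (1 - p)) * `|u|.
Proof.
move=> lt_; have := impint_power_bound p01 ltr01 _ _ (fracpow_integralP u lt_).
move=> /(_ ((1 + K) * `|u|) (K * (a + `|t|) * `|u|)).
rewrite !powR1 !mulr1.
have -> : (1 + K) * `|u| / p + K * (a + `|t|) * `|u| / (1 - p) =
    ((1 + K) / p + K * (a + `|t|) / (1 - p)) * `|u| by ring.
apply.
- move=> s /andP[s0 _]; exact: (fracpow_integrand_near0 K_ge0 rf).
- move=> s s1; apply: (fracpow_integrand_neary K_ge0 rf) => //.
  exact: lt_le_trans s1.
Qed.

Lemma fracpow_integral_linear t : lo <= t -> linear (J t).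
Proof.
move=> lt_ k x y; apply: fracpow_integral_unique => //.
apply: impint_ext (impintD (impintZ k (fracpow_integralP x lt_)) (fracpow_integralP y lt_)).
move=> s s0; have ls : lo < s + t by lra.
have QL := resolvent_linear rf ls; have [AL _ _ _ _] := rf.
rewrite /fracpow_integrand AL (scalerDr t) addrACA (scalerA t) [t * k]mulrC -(scalerA k) -(scalerDr k).
by rewrite QL [RHS]scalerDr !scalerA [k * _]mulrC.
Qed.

Lemma fracpow_integral_commute (T : X -> X) C t u : lo <= t -> linear T ->
    (forall x, `|T x| <= C * `|x|) -> (forall x, T (A x) = A (T x)) ->
    (forall s x, lo < s -> T (Q s x) = Q s (T x)) ->
  T (J t u) = J t (T u).
Proof.
move=> lt_ TL TC TA TQ; apply/esym/fracpow_integral_unique => //.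
apply: impint_ext (impint_linear TL TC (fracpow_integralP u lt_)) => s s0.
have ls : lo < s + t by lra.
rewrite /fracpow_integrand/= (linear_funZ TL) TQ// (linear_funD TL) TA.
by rewrite (linear_funZ TL).
Qed.

(** The t-derivative of the integrand is s^p Q(s+t)^2 u. Integration by parts in s turns it into p
    s^(p-1) Q(s+t) u, which by the resolvent identity is p Q(t) applied to the integrand. The
    remainder for a finite increment is written as a single integral and bounded by a multiple of
    the square of the increment, so that no limit is taken under the integral. *)
Lemma fracpow_integral_derive t u : lo < t ->
  is_derive t 1 (J ^~ u) (p *: Q t (J t u)).
Proof.
move=> lt_; have [AL Aa AQ QA QK] := rf.
pose e := (t - lo) / 2; have e0 : 0 < e by rewrite divr_gt0// subr_gt0.
(* [M1] bounds a product of three resolvents by K / e each; in [M2] two factors are K / s instead,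
   which gives the exponent p - 2 at +oo. *)
pose M1 := K / e * (K / e * (K / e * `|u|)).
pose M2 := K * (K * (K / e * `|u|)).
suff H y : t - e <= y <= t + e ->
    `|J y u - J t u - (y - t) *: (p *: Q t (J t u))| <=
      (M1 / p + M2 / (1 - p)) * `|y - t| ^+ 2.
  apply: quadratic_is_derive H; apply/andP; split; lra.
move=> /andP[ey ye]; set h := y - t.
have eE : 2 * e = t - lo by rewrite /e mulrC divfK.
have yE : y = t + h by rewrite /h addrC subrK.
have ly : lo < y by rewrite /e in ey; lra.
have ly' := ltW ly; have lt' := ltW lt_.
have bound w x : e <= w - lo -> `|Q w x| <= K / e * `|x|.
  move=> ew; have lw : lo < w by lra.
  apply: le_trans (QK _ _ lw) _; rewrite ler_wpM2r// ler_wpM2l// lef_pV2 ?posrE//.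
  by rewrite subr_gt0.
(* The derivative of [s `^ p *: Q (s + t) u]. Adding [h] times this function,
   whose integral is 0, makes the integrand of the remainder of order [h ^+ 2]. *)
pose byparts s := s `^ p *: - Q (s + t) (Q (s + t) u) + (p * s `^ (p - 1)) *: Q (s + t) u.
have byparts0 : impint byparts 0.
  exists (fun s => s `^ p *: Q (s + t) u); split=> [s s0|].
    have ls : lo < s + t by lra.
    rewrite /byparts addrC; apply: is_derive_scale; first exact: is_derive1_powR.
    have /is_deriveP H := is_derive_resolvent K_ge0 rf u ls.
    by apply/is_deriveP; under eq_fun do rewrite -addrA.
  exists 0, 0; split; last by rewrite subrr.
  - apply/cvgrPdist_le => d d0.
    have : (K / e * `|u|) * s `^ p @[s --> (0 : R)^'+] --> (K / e * `|u|) * 0.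
      by apply: cvgMr; exact: powR_cvg0.
    rewrite mulr0 => /cvgrPdist_le/(_ _ d0) H; near=> s.
    have s0 : 0 < s by near: s; exact: nbhs_right_gt.
    have sd : `|0 - (K / e * `|u|) * s `^ p| <= d by near: s.
    rewrite sub0r normrN normrZ ger0_norm ?powR_ge0//.
    apply: le_trans sd; rewrite sub0r normrN; apply: le_trans (ler_norm _).
    by rewrite mulrC ler_wpM2r ?powR_ge0// bound// /e; lra.
  - apply/cvgrPdist_le => d d0.
    have : (K * `|u|) * s `^ (p - 1) @[s --> +oo] --> (K * `|u|) * 0.
      by apply: cvgMr; apply: powR_cvgy0; rewrite subr_lt0.
    rewrite mulr0 => /cvgrPdist_le/(_ _ d0) H; near=> s.
    have s0 : 0 < s by near: s; apply: nbhs_pinfty_gt; exact: num_real.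
    have sd : `|0 - (K * `|u|) * s `^ (p - 1)| <= d by near: s.
    rewrite sub0r normrN normrZ ger0_norm ?powR_ge0//.
    apply: le_trans sd; rewrite sub0r normrN; apply: le_trans (ler_norm _).
    have ls : lo < s + t by lra.
    apply: le_trans (ler_wpM2l (powR_ge0 _ _) (QK _ _ ls)) _.
    rewrite powR_pred//.
    have -> : K * `|u| * (s `^ p * s^-1) = s `^ p * (K / s * `|u|) by ring.
    rewrite ler_wpM2l ?powR_ge0//.
    by rewrite ler_wpM2r// ler_wpM2l// lef_pV2 ?posrE; lra.
have Qlin : linear (Q t) by exact: resolvent_linear rf _ lt_.
(* After the integration by parts, two uses of the resolvent identity leave exactly the second-order
   term. *)
have HI : impint (fun s => - (h ^+ 2 * s `^ p) *: Q (s + y) (Q (s + t) (Q (s + t) u)))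
    (J y u - J t u - h *: (p *: Q t (J t u))).
  have H1 := impintB (fracpow_integralP u ly') (fracpow_integralP u lt').
  have QtK x : `|Q t x| <= K / (t - lo) * `|x| by exact: QK.
  have H2 := impintZ h (impintZ p (impint_linear Qlin QtK (fracpow_integralP u lt'))).
  have H3 := impintD (impintB H1 H2) (impintZ h byparts0).
  rewrite scaler0 addr0 in H3; apply: impint_ext H3 => s s0 /=.
  have ls : lo < s + t by lra.
  have lsy : lo < s + y by lra.
  have L1 := resolvent_linear rf lsy.
  have D : Q (s + t) u - Q (s + y) u = h *: Q (s + y) (Q (s + t) u).
    rewrite (resolvent_identity rf u ls lsy) (resolvent_comm rf u ls lsy).
    by congr (_ *: _); rewrite yE; ring.
  pose q := Q (s + t) u; rewrite -/q in D; rewrite /byparts -/q.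
  have sp : s `^ (p - 1) * s = s `^ p.
    by rewrite powR_pred// divfK// gt_eqF.
  have E1 : Q t (fracpow_integrand A Q p t u s) = s `^ (p - 1) *: q.
    rewrite (fracpow_integrandE rf)// (linear_funZ Qlin) (linear_funB Qlin).
    rewrite (linear_funZ Qlin) -/q; congr (_ *: _).
    have := resolvent_identity rf u lt_ ls; rewrite addrK -/q => <-.
    by rewrite opprB addrC subrK.
  rewrite E1 !(fracpow_integrandE rf)// -/q -scalerBr opprB [u - _ + _]addrC.
  rewrite subrKA addrC -scalerBr.
  have D' := resolvent_identity rf q ls lsy.
  rewrite (resolvent_comm rf q ls lsy) (_ : s + y - (s + t) = h) in D'; last first.
    by rewrite yE; ring.
  rewrite D (scalerDr h) !scalerA scalerN scaleNr.
  have -> : h * p * s `^ (p - 1) = h * (p * s `^ (p - 1)) by ring.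
  rewrite addrACA subrr addr0 sp [h * s `^ p]mulrC.
  have -> : h ^+ 2 * s `^ p = s `^ p * h * h by ring.
  by rewrite -(scalerA (s `^ p * h) h) -D' scalerBr opprB addrC.
have := impint_power_bound p01 ltr01 _ _ HI.
move=> /(_ (h ^+ 2 * M1) (h ^+ 2 * M2)); rewrite !powR1 !mulr1.
rewrite real_normK ?num_real//.
have -> : h ^+ 2 * M1 / p + h ^+ 2 * M2 / (1 - p) =
    (M1 / p + M2 / (1 - p)) * h ^+ 2 by ring.
have normE s : `|- (h ^+ 2 * s `^ p) *: Q (s + y) (Q (s + t) (Q (s + t) u))| =
    h ^+ 2 * (s `^ p * `|Q (s + y) (Q (s + t) (Q (s + t) u))|).
  by rewrite normrZ normrN (ger0_norm (mulr_ge0 (sqr_ge0 _) (powR_ge0 _ _))) mulrA.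
have Ke : 0 <= K / e by rewrite divr_ge0// ltW.
apply.
- move=> s /andP[s0 s1]; rewrite normE -[leRHS]mulrA ler_wpM2l ?sqr_ge0//.
  rewrite [leRHS]mulrC; apply: ler_pM; rewrite ?powR_ge0//.
    by rewrite powR_pred// ler_pdivlMr// ler_piMr ?powR_ge0.
  apply: le_trans (bound _ _ _) _; first by lra.
  rewrite ler_wpM2l//; apply: le_trans (bound _ _ _) _; first by lra.
  by rewrite ler_wpM2l//; apply: bound; lra.
- move=> s s1; have s0 : 0 < s by exact: lt_le_trans s1.
  rewrite normE -[leRHS]mulrA ler_wpM2l ?sqr_ge0//.
  have spp : s `^ (p - 2) = s `^ p / s / s.
    by have -> : p - 2 = p - 1 - 1 by [ring]; rewrite !powR_pred.
  rewrite spp.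
  have -> : M2 * (s `^ p / s / s) = s `^ p * (K / s * (K / s * (K / e * `|u|))).
    rewrite /M2; ring.
  rewrite ler_wpM2l ?powR_ge0//.
  have big w x : s < w - lo -> `|Q w x| <= K / s * `|x|.
    move=> sw; have lw : lo < w by lra.
    apply: le_trans (QK _ _ lw) _; rewrite ler_wpM2r// ler_wpM2l// lef_pV2 ?posrE//; lra.
  have Ks : 0 <= K / s by rewrite divr_ge0// ltW.
  apply: le_trans (big _ _ _) _; first by lra.
  rewrite ler_wpM2l//; apply: le_trans (big _ _ _) _; first by lra.
  by rewrite ler_wpM2l//; apply: bound; lra.
Unshelve. all: by end_near. Qed.

Local Notation C := (p^-1 + (1 - p)^-1).

(** The comparison term is the integral for A = 0, namely that of s^(p-1) t / (s + t), a rescaled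
    beta integral. The difference of the integrands carries a factor A Q(s+t), of size a K / (s +
    t), which gains one power of t. *)
Lemma fracpow_integral_asymptotics t u : 0 <= a -> lo <= 0 -> 0 < t ->
  `|J t u - (t `^ p * beta_integral p) *: u| <= a * K * C * t `^ (p - 1) * `|u|.
Proof.
move=> a0 lo0 t0; have [AL Aa AQ QA QK] := rf; have lt_ : lo <= t by lra.
have HB : impint (fun s => (t `^ (p - 1) * ((s / t) `^ (p - 1) / (1 + s / t))) *: u)
    ((t `^ p * beta_integral p) *: u).
  have -> : t `^ p * beta_integral p = t `^ (p - 1) *: (t *: beta_integral p).
    by rewrite powR_pred// /GRing.scale/= mulrA divfK// gt_eqF.
  apply: (impint_linear (T := fun k : R => k *: u) (C := `|u|)).
  - by move=> k x y; rewrite scalerDl scalerA.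
  - by move=> x; rewrite normrZ mulrC.
  - by apply: impintZ; apply: (impint_scale t0 (beta_integralP p01)).
have HI := impintB (fracpow_integralP u lt_) HB.
have bound s : 0 < s ->
    `|fracpow_integrand A Q p t u s -
      (t `^ (p - 1) * ((s / t) `^ (p - 1) / (1 + s / t))) *: u| <=
    s `^ (p - 1) * (a * (s / (s + t) * (K / (s + t) * `|u|))).
  move=> s0; have ls : lo < s + t by lra.
  have -> : t `^ (p - 1) * ((s / t) `^ (p - 1) / (1 + s / t)) =
      s `^ (p - 1) * (t / (s + t)).
    have E0 : t `^ (p - 1) * (s / t) `^ (p - 1) = s `^ (p - 1).
      have st0 : 0 <= s / t by rewrite divr_ge0 ?ltW.
      by rewrite -(powRM _ (ltW t0) st0) mulrC divfK ?gt_eqF.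
    rewrite mulrA E0; congr (_ * _); field.
    by rewrite !gt_eqF// addr_gt0.
  rewrite (fracpow_integrandE rf)// -scalerA -scalerBr normrZ ger0_norm ?powR_ge0//.
  rewrite ler_wpM2l ?powR_ge0//; set q := Q (s + t) u.
  have st0 : s + t != 0 by rewrite gt_eqF// addr_gt0.
  have -> : u - s *: q - (t / (s + t)) *: u = (s / (s + t)) *: A q.
    have -> : A q = u - (s + t) *: q by rewrite -[X in X - _](AQ _ u ls) addrK.
    rewrite scalerBr scalerA divfK// addrAC; congr (_ - _).
    by rewrite -[X in X - _]scale1r -scalerBl; congr (_ *: _); field.
  have sst : 0 <= s / (s + t) by rewrite divr_ge0//; lra.
  rewrite normrZ ger0_norm// [leRHS]mulrCA ler_wpM2l//.
  apply: le_trans (Aa _) _; rewrite ler_wpM2l//; apply: le_trans (QK _ _ ls) _.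
  by rewrite ler_wpM2r// ler_wpM2l// lef_pV2 ?posrE; lra.
have frac_le s : 0 < s -> s / (s + t) / (s + t) <= (s + t)^-1.
  move=> s0; apply: ler_piMl; first by rewrite invr_ge0; lra.
  by rewrite ler_pdivrMr; lra.
have E s : a * (s / (s + t) * (K / (s + t) * `|u|)) =
    a * K * `|u| * (s / (s + t) / (s + t)) by ring.
have W0 : 0 <= a * K * `|u| by rewrite !mulr_ge0.
have -> : a * K * C * t `^ (p - 1) * `|u| =
  (a * K * `|u| / t) * t `^ p / p + (a * K * `|u|) * t `^ (p - 1) / (1 - p).
  by rewrite powR_pred//; ring.
apply: (impint_power_bound p01 t0 _ _ HI).
- move=> s /andP[s0 st]; apply: le_trans (bound s s0) _.
  rewrite mulrC ler_wpM2r ?powR_ge0// E ler_wpM2l//.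
  by apply: le_trans (frac_le s s0) _; rewrite lef_pV2 ?posrE; lra.
- move=> s ts; have s0 : 0 < s by lra.
  apply: le_trans (bound s s0) _.
  have -> : p - 2 = p - 1 - 1 by ring.
  rewrite (powR_pred (p - 1))// [leRHS]mulrCA ler_wpM2l ?powR_ge0// E ler_wpM2l//.
  by apply: le_trans (frac_le s s0) _; rewrite lef_pV2 ?posrE; lra.
Qed.

(** By the resolvent identity the difference of the integrands is t s^p Q(s) Q(s+t) u; cutting at s
    = t gives the power t^p. *)
Lemma fracpow_integral_at0 t u : lo = 0 -> 0 < t ->
  `|J t u - J 0 u| <= K ^+ 2 * C * t `^ p * `|u|.
Proof.
move=> lo0 t0; have [AL Aa AQ QA QK] := rf.
have lt_ : lo <= t by rewrite lo0 ltW.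
have l0 : lo <= 0 by rewrite lo0.
have HI := impintB (fracpow_integralP u lt_) (fracpow_integralP u l0).
have bound s : 0 < s ->
    `|fracpow_integrand A Q p t u s - fracpow_integrand A Q p 0 u s| <=
    s `^ (p - 1) * (t * (K / (s + t) * (K * `|u|))).
  move=> s0; have ls : lo < s by rewrite lo0.
  have lst : lo < s + t by rewrite lo0 addr_gt0.
  rewrite !(fracpow_integrandE rf)// addr0 -scalerBr normrZ ger0_norm ?powR_ge0//.
  rewrite ler_wpM2l ?powR_ge0// opprB [_ - _ + _]addrC addrA subrK -scalerBr.
  rewrite (resolvent_identity rf u ls lst) addrAC subrr add0r scalerA normrZ.
  rewrite ger0_norm; last by apply: mulr_ge0; exact: ltW.
  have -> : t * (K / (s + t) * (K * `|u|)) = s * t * (K / s * (K / (s + t) * `|u|)).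
    by field; rewrite !gt_eqF// addr_gt0.
  rewrite ler_wpM2l//; first by apply: mulr_ge0; exact: ltW.
  apply: le_trans (QK _ _ ls) _; rewrite lo0 subr0 ler_wpM2l//.
    by rewrite divr_ge0// ltW.
  apply: le_trans (QK _ _ lst) _.
  by rewrite lo0 subr0.
have -> : K ^+ 2 * C * t `^ p * `|u| =
  (K ^+ 2 * `|u|) * t `^ p / p + (K ^+ 2 * `|u| * t) * t `^ (p - 1) / (1 - p).
  rewrite powR_pred//; set P := t `^ p.
  have -> : K ^+ 2 * `|u| * t * (P / t) = K ^+ 2 * `|u| * P.
    by field; rewrite gt_eqF.
  by ring.
have E s : t * (K / (s + t) * (K * `|u|)) = K ^+ 2 * `|u| * (t / (s + t)) by ring.
have W0 : 0 <= K ^+ 2 * `|u| by rewrite mulr_ge0// sqr_ge0.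
apply: (impint_power_bound p01 t0 _ _ HI).
- move=> s /andP[s0 st]; apply: le_trans (bound s s0) _.
  rewrite mulrC ler_wpM2r ?powR_ge0// E ler_piMr// ler_pdivrMr; lra.
- move=> s ts; have s0 : 0 < s by lra.
  apply: le_trans (bound s s0) _.
  have -> : p - 2 = p - 1 - 1 by ring.
  rewrite (powR_pred (p - 1))// [leRHS]mulrCA ler_wpM2l ?powR_ge0// E -[leRHS]mulrA.
  by rewrite ler_wpM2l// ler_wpM2l ?(ltW t0)// lef_pV2 ?posrE; lra.
Qed.

End FractionalIntegral.

HB.saturate prod.

Section ProductComplete.
Context (R : realType) (U V : completeNormedModType R).

(** This makes the plane [R^o * R^o] a Banach space, so that Balakrishnan integrals of the rotation
    can be formed in it. *)
Lemma prod_complete (F : set_system (U * V)) :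
  ProperFilter F -> cauchy F -> cvg F.
Proof.
move=> FF /cauchyP cF.
have c1 : cvg (fst @ F).
  apply/cauchy_cvgP/cauchyP => e /cF[x xe]; exists x.1.
  suff : F (fun y => ball x.1 e y.1) by [].
  by apply: filterS xe => y [].
have c2 : cvg (snd @ F).
  apply/cauchy_cvgP/cauchyP => e /cF[x xe]; exists x.2.
  suff : F (fun y => ball x.2 e y.2) by [].
  by apply: filterS xe => y [].
apply/cvg_ex; exists (lim (fst @ F), lim (snd @ F)).
have H : (x.1, x.2) @[x --> F] --> (lim (fst @ F), lim (snd @ F)).
  exact: cvg_pair.
suff -> : F = (fun x => (x.1, x.2)) @ F by exact: H.
by apply/funext => P /=; congr F; apply/funext; case.
Qed.

HB.instance Definition _ := Uniform_isComplete.Build (U * V)%type prod_complete.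

End ProductComplete.

(** * The integral of s^(p-1) / (1 + s) *)

Section Rotation.
Context (R : realType).
Local Notation C := (R^o * R^o)%type.

(* Under the identification of [C] with the complex numbers, [rot] is the
   multiplication by i, its resolvent is the division by s + i, and
   [(rho t, p * arg t)] are the polar coordinates of (t + i)^-p up to the sign of
   the angle. As the derivative of [Z] is p Z / (t + i), the product
   Z (t + i)^-p is constant; its limits at +oo and -oo determine
   [beta_integral p]. *)
Definition rot (z : C) : C := (- z.2, z.1).

Definition rot_resolvent (s : R) (z : C) : C :=
  ((s * z.1 + z.2) / (s ^+ 2 + 1), (s * z.2 - z.1) / (s ^+ 2 + 1)).

Let sqr1_gt0 (s : R) : 0 < s ^+ 2 + 1.
Proof. by rewrite ltr_wpDl ?sqr_ge0. Qed.

Lemma rot_resolvent_family lo : lo <= 0 ->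
  resolvent_family rot 1 rot_resolvent lo (2 * (1 - lo)).
Proof.
move=> lo0; split.
- move=> k [x y] [x' y']; rewrite /rot/=; congr (_, _).
  by rewrite -[RHS]/(k * - y - y') -[LHS]/(- (k * y + y')) opprD mulrN.
- move=> [x y]; rewrite mul1r !prod_normE/= normrN.
  by rewrite maxC.
- move=> s [x y] _; rewrite /rot/rot_resolvent/=; have := sqr1_gt0 s.
  move=> /lt0r_neq0 s0; congr (_, _).
    by rewrite -[LHS]/(- ((s * y - x) / (s ^+ 2 + 1)) +
      s * ((s * x + y) / (s ^+ 2 + 1))); field.
  by rewrite -[LHS]/((s * x + y) / (s ^+ 2 + 1) +
    s * ((s * y - x) / (s ^+ 2 + 1))); field.
- move=> s [x y] _; rewrite /rot/rot_resolvent/=; have := sqr1_gt0 s.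
  move=> /lt0r_neq0 s0; congr (_, _).
    by rewrite -[LHS]/((s * (- y + s * x) + (x + s * y)) / (s ^+ 2 + 1)); field.
  by rewrite -[LHS]/((s * (x + s * y) - (- y + s * x)) / (s ^+ 2 + 1)); field.
- move=> s z ls; have s0 : 0 < s - lo by rewrite subr_gt0.
  have bound (x y : R) : `|x| <= `|z| -> `|y| <= `|z| ->
      `|(s * x + y) / (s ^+ 2 + 1)| <= 2 * (1 - lo) / (s - lo) * `|z|.
    move=> xz yz; rewrite normrM normfV (gtr0_norm (sqr1_gt0 s)).
    have H : `|s * x + y| <= (`|s| + 1) * `|z|.
      apply: le_trans (ler_normD _ _) _; rewrite normrM mulrDl mul1r.
      by apply: lerD => //; rewrite ler_wpM2l.
    rewrite ler_pdivrMr//; apply: le_trans H _.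
    rewrite mulrAC ler_wpM2r// mulrAC ler_pdivlMr//.
    (* From (|s| + 1)^2 <= 2 (s^2 + 1) and s - lo <= (1 - lo) (|s| + 1). *)
    have := ler_norm s; have := sqr_ge0 (`|s| - 1).
    have -> : s ^+ 2 = `|s| ^+ 2 by rewrite real_normK ?num_real.
    have := normr_ge0 s; move: (`|s|) => n; nra.
  rewrite prod_normE ge_max; apply/andP; split => /=.
    by apply: bound; rewrite prod_normE le_max lexx ?orbT.
  by apply: bound; rewrite ?normrN prod_normE le_max lexx ?orbT.
Qed.

Variable p : R.
Hypothesis p01 : 0 < p < 1.

Let p0 : 0 < p. Proof. by case/andP: p01. Qed.
Let p1 : p < 1. Proof. by case/andP: p01. Qed.

Let Z t : C := fracpow_integral rot rot_resolvent p t (1, 0).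
Let x t : R := (Z t).1.
Let y t : R := (Z t).2.

Let Z_derive (t : R) : is_derive t 1 Z (p *: rot_resolvent t (Z t)).
Proof.
pose lo := - (`|t| + 1).
have lo0 : lo <= 0 by rewrite oppr_le0 addr_ge0.
have lot : lo < t by rewrite /lo; have := ler_norm (- t); rewrite normrN; lra.
apply: (fracpow_integral_derive _ (rot_resolvent_family lo0)) => //.
by rewrite mulr_ge0// subr_ge0 (le_trans lo0).
Qed.

Let is_derive_fst (f : R -> C) (t : R) (f' : C) :
  is_derive t 1 f f' -> is_derive t 1 (fun s => (f s).1 : R) f'.1.
Proof.
move=> /is_deriveP df; apply/is_deriveP.
by apply: (linear_fun_cvg (T := fst : C -> R^o) (C := 1) _ _ df) => // z;
  rewrite mul1r prod_normE le_max lexx.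
Qed.

Let is_derive_snd (f : R -> C) (t : R) (f' : C) :
  is_derive t 1 f f' -> is_derive t 1 (fun s => (f s).2 : R) f'.2.
Proof.
move=> /is_deriveP df; apply/is_deriveP.
by apply: (linear_fun_cvg (T := snd : C -> R^o) (C := 1) _ _ df) => // z;
  rewrite mul1r prod_normE le_max lexx orbT.
Qed.

Let x_derive (t : R) : is_derive t 1 x (p * ((t * x t + y t) / (t ^+ 2 + 1))).
Proof. exact: is_derive_fst (Z_derive t). Qed.

Let y_derive (t : R) : is_derive t 1 y (p * ((t * y t - x t) / (t ^+ 2 + 1))).
Proof. exact: is_derive_snd (Z_derive t). Qed.

Let arg (t : R) : R := pi / 2 - atan t.
Let rho (t : R) : R := (t ^+ 2 + 1) `^ (- p / 2).
Let c t := cos (p * arg t).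
Let s t := sin (p * arg t).

Let parg_derive (t : R) : is_derive t 1 (fun t => p * arg t) (- p / (t ^+ 2 + 1)).
Proof.
have H := is_deriveZ p (is_deriveB (is_derive_cst (pi / 2 : R) t 1) (is_derive1_atan t)).
apply: (is_derive_eq H); rewrite /GRing.scale/= sub0r addrC; ring.
Qed.

Let c_derive (t : R) : is_derive t 1 c (p * s t / (t ^+ 2 + 1)).
Proof.
have H := @is_derive1_comp R cos (fun t => p * arg t) t _ _ (is_derive_cos _) (parg_derive t).
apply: (is_derive_eq H).
rewrite -/(s t); ring.
Qed.

Let s_derive (t : R) : is_derive t 1 s (- (p * c t / (t ^+ 2 + 1))).
Proof.
have H := @is_derive1_comp R sin (fun t => p * arg t) t _ _ (is_derive_sin _) (parg_derive t).
apply: (is_derive_eq H).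
rewrite -/(c t); ring.
Qed.

Let rho_derive (t : R) : is_derive t 1 rho (- (p * t / (t ^+ 2 + 1)) * rho t).
Proof.
have D : is_derive t 1 (fun t : R => t ^+ 2 + 1) (2 * t).
  have H := is_deriveD (is_deriveM (is_derive_id t 1) (is_derive_id t 1)) (is_derive_cst (1 : R) t 1).
  apply: (is_derive_eq H); rewrite /GRing.scale/= /id; ring.
have H := @is_derive1_comp R (fun u => u `^ (- p / 2)) (fun t => t ^+ 2 + 1) t _ _
  (is_derive1_powR (- p / 2) (sqr1_gt0 t)) D.
apply: (is_derive_eq H).
rewrite powR_pred ?sqr1_gt0// /rho; field.
by rewrite gt_eqF.
Qed.

Let const_of_derive (f : R -> R) : (forall t : R, is_derive t 1 f 0) ->
  forall t u, f t = f u.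
Proof. by move=> df t u; exact: is_derive_0_is_cst. Qed.

(** As t + i = (t^2 + 1)^(1/2) e^(i arg t), this is the real part of Z (t + i)^-p; [Y_const] is its
    imaginary part. *)
Let X_const t u : rho t * (x t * c t + y t * s t) = rho u * (x u * c u + y u * s u).
Proof.
pose f v := rho v * (x v * c v + y v * s v); rewrite -/(f t) -/(f u).
apply: const_of_derive => v.
have H := is_deriveM (rho_derive v) (is_deriveD (is_deriveM (x_derive v) (c_derive v))
  (is_deriveM (y_derive v) (s_derive v))).
apply: (is_derive_eq H); rewrite /GRing.scale/= !fctE; field.
by rewrite gt_eqF.
Qed.

Let Y_const t u : rho t * (y t * c t - x t * s t) = rho u * (y u * c u - x u * s u).
Proof.
pose f v := rho v * (y v * c v - x v * s v); rewrite -/(f t) -/(f u).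
apply: const_of_derive => v.
have H := is_deriveM (rho_derive v) (is_deriveB (is_deriveM (y_derive v) (c_derive v))
  (is_deriveM (x_derive v) (s_derive v))).
apply: (is_derive_eq H); rewrite /GRing.scale/= !fctE; field.
by rewrite gt_eqF.
Qed.

Local Notation m := (beta_integral p).
(** The constant of [fracpow_integral_asymptotics] for a = 1 and K = 2, the value of 2 (1 - lo) at
    lo = 0. *)
Let D : R := 2 * (p^-1 + (1 - p)^-1).
Let w (T : R) : R := T ^+ 2 / (T ^+ 2 + 1).
Let r (T : R) : R := rho T * T `^ p.

Let rE T : 0 < T -> r T = w T `^ (p / 2).
Proof.
move=> T0; have T20 : 0 <= T ^+ 2 by exact: sqr_ge0.
rewrite /r /w powRM// ?invr_ge0 ?(ltW (sqr1_gt0 T))// mulrC; congr (_ * _).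
  by rewrite -powR_mulrn ?(ltW T0)// -powRrM mulrC divfK.
rewrite -(powR_inv1 (ltW (sqr1_gt0 T))) -powRrM /rho; congr (_ `^ _).
by rewrite mulN1r mulNr.
Qed.

Let w01 T : 0 < T -> 0 < w T <= 1.
Proof.
move=> T0; rewrite /w divr_gt0 ?exprn_gt0//= ler_pdivrMr// mul1r.
by rewrite lerDl.
Qed.

(** As 0 < w <= 1 and p / 2 < 1, the power w^(p/2) lies between w and 1; the limit of [r] follows by
    squeezing. *)
Let w_le_r T : 0 < T -> w T <= r T <= 1.
Proof.
move=> T0; have [q0 q1] := (p0, p1); have w01T := w01 T0; rewrite rE// ger1_powR//; last by lra.
have /andP[_ w1] := w01T.
by have := ger_powR w01T (_ : 0 <= p / 2); rewrite powRr0; apply; lra.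
Qed.

Let w_cvg : w T @[T --> +oo] --> (1 : R).
Proof.
apply/cvgrPdist_le => e e0; near=> T.
have T1 : 1 <= T by near: T; apply: nbhs_pinfty_ge; exact: num_real.
have Te : e^-1 <= T by near: T; apply: nbhs_pinfty_ge; exact: num_real.
have T0 : 0 < T by lra.
have -> : 1 - w T = (T ^+ 2 + 1)^-1 by rewrite /w; field; rewrite gt_eqF.
rewrite gtr0_norm ?invr_gt0// -[leRHS]invrK lef_pV2 ?posrE ?invr_gt0//.
by apply: le_trans Te _; nra.
Unshelve. all: by end_near. Qed.

Let r_cvg : r T @[T --> +oo] --> (1 : R).
Proof.
apply: (@squeeze_cvgr _ _ _ _ w (fun=> 1)) => //; last exact: cvg_cst.
near=> T; apply: w_le_r; near: T; apply: nbhs_pinfty_gt; exact: num_real.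
Unshelve. all: by end_near. Qed.

Let arg_cvg : p * arg T @[T --> +oo] --> (0 : R).
Proof.
rewrite -[X in _ --> X](mulr0 p); apply: cvgMr.
rewrite -[X in _ --> X](subrr (pi / 2 : R)).
by apply: cvgB; [exact: cvg_cst | exact: cvgy_atan].
Qed.

Let c_cvg : c T @[T --> +oo] --> (1 : R).
Proof.
rewrite -[X in _ --> X]cos0.
by apply: continuous_cvg => //; exact: continuous_cos.
Qed.

Let s_cvg : s T @[T --> +oo] --> (0 : R).
Proof.
rewrite -[X in _ --> X]sin0.
by apply: continuous_cvg => //; exact: continuous_sin.
Qed.

Let Z_asymptotics T : 0 < T ->
  `|x T - T `^ p * m| <= D * T `^ (p - 1) /\ `|y T| <= D * T `^ (p - 1).
Proof.
move=> T0; have K0 : 0 <= 2 * (1 - 0) :> R by rewrite subr0 mulr1.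
have := fracpow_integral_asymptotics K0 (rot_resolvent_family (lexx 0)) p01
  (1, 0) ler01 (lexx 0) T0.
rewrite subr0 mul1r mulr1 prod_normE/= => H.
have n1 : `|(1, 0) : C| = 1 by rewrite prod_normE/= normr1 normr0 max_l.
rewrite n1 mulr1 in H.
split; apply: le_trans H; rewrite le_max; apply/orP; [left|right].
  by rewrite -[X in _ - X]mulr1.
by rewrite -[X in `|X|]subr0 -[X in _ - X](mulr0 (T `^ p * m)).
Qed.

Let inv_cvg (k : R) : k / T @[T --> +oo] --> (0 : R).
Proof.
rewrite -[X in _ --> X](mulr0 k); apply: cvgMr; apply/gtr0_cvgV0 => //.
by apply: nbhs_pinfty_gt; exact: num_real.
Qed.

Let rho_ge0 t : 0 <= rho t. Proof. exact: powR_ge0. Qed.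

Let rho_small T z k : 0 < T -> `|z| <= D * T `^ (p - 1) -> `|k| <= 1 ->
  `|rho T * (z * k)| <= D / T.
Proof.
move=> T0 zD k1; have /andP[_ r1] := w_le_r T0.
have D0 : 0 <= D by rewrite mulr_ge0// addr_ge0 ?invr_ge0// ?subr_ge0 ltW.
rewrite normrM ger0_norm//.
apply: (@le_trans _ _ (rho T * (D * T `^ (p - 1)))).
  rewrite ler_wpM2l// normrM -[leRHS]mulr1.
  by apply: ler_pM.
have -> : rho T * (D * T `^ (p - 1)) = D / T * r T.
  by rewrite powR_pred// /r; ring.
by rewrite ler_piMr// divr_ge0// ltW.
Qed.

(** At +oo, Z is asymptotic to m t^p and [arg] tends to 0, which gives the value of the constant.
    Together with [Y_eq] this says Z(t) = m (t + i)^p. *)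
Let X_eq t : rho t * (x t * c t + y t * s t) = m.
Proof.
set k := LHS.
have H : k - m * (r T * c T) @[T --> +oo] --> k - m * (1 * 1).
  apply: cvgB; first exact: cvg_cst.
  by apply: cvgMr; exact: cvgM.
have H0 : k - m * (r T * c T) @[T --> +oo] --> (0 : R).
  apply/cvgrPdist_le => e e0.
  have /cvgrPdist_le/(_ _ e0) HD := inv_cvg (2 * D).
  near=> T; have T0 : 0 < T by near: T; apply: nbhs_pinfty_gt; exact: num_real.
  have TD : `|0 - 2 * D / T| <= e by near: T.
  rewrite sub0r normrN in TD; rewrite sub0r normrN.
  apply: le_trans (le_trans (ler_norm _) TD).
  rewrite /k (X_const t T).
  have -> : rho T * (x T * c T + y T * s T) - m * (r T * c T) =
      rho T * ((x T - T `^ p * m) * c T) + rho T * (y T * s T) by rewrite /r; ring.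
  have [Hx Hy] := Z_asymptotics T0.
  apply: le_trans (ler_normD _ _) _.
  have -> : 2 * D / T = D / T + D / T by ring.
  by apply: lerD; apply: rho_small => //; rewrite ler_norml ?cos_geN1 ?cos_le1 ?sin_geN1 ?sin_le1.
have : k - m * (1 * 1) = 0 by exact: norm_cvg_unique H H0.
by move=> /eqP; rewrite !mulr1 subr_eq0 => /eqP.
Unshelve. all: by end_near. Qed.

Let Y_eq t : rho t * (y t * c t - x t * s t) = 0.
Proof.
set k := LHS.
have H : k + m * (r T * s T) @[T --> +oo] --> k + m * (1 * 0).
  apply: cvgD; first exact: cvg_cst.
  by apply: cvgMr; exact: cvgM.
have H0 : k + m * (r T * s T) @[T --> +oo] --> (0 : R).
  apply/cvgrPdist_le => e e0.
  have /cvgrPdist_le/(_ _ e0) HD := inv_cvg (2 * D).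
  near=> T; have T0 : 0 < T by near: T; apply: nbhs_pinfty_gt; exact: num_real.
  have TD : `|0 - 2 * D / T| <= e by near: T.
  rewrite sub0r normrN in TD; rewrite sub0r normrN.
  apply: le_trans (le_trans (ler_norm _) TD).
  rewrite /k (Y_const t T).
  have -> : rho T * (y T * c T - x T * s T) + m * (r T * s T) =
      rho T * (y T * c T) - rho T * ((x T - T `^ p * m) * s T) by rewrite /r; ring.
  have [Hx Hy] := Z_asymptotics T0.
  apply: le_trans (ler_normB _ _) _.
  have -> : 2 * D / T = D / T + D / T by ring.
  by apply: lerD; apply: rho_small => //; rewrite ler_norml ?cos_geN1 ?cos_le1 ?sin_geN1 ?sin_le1.
have : k + m * (1 * 0) = 0 by exact: norm_cvg_unique H H0.
by rewrite !mulr0 addr0.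
Unshelve. all: by end_near. Qed.

Let y_eq t : rho t * y t = m * s t.
Proof.
have cs := cos2Dsin2 (p * arg t); rewrite -/(c t) -/(s t) in cs.
rewrite -[LHS]mulr1 -cs -(X_eq t).
transitivity (rho t * (x t * c t + y t * s t) * s t +
  rho t * (y t * c t - x t * s t) * c t); first by ring.
by rewrite Y_eq mul0r addr0.
Qed.

(** At t = -T the imaginary part of the integrand is u^p times this kernel, whose mass tends to pi
    and concentrates at u = T; hence T^-p y(-T) tends to pi. A second expression of this limit comes
    from [y_eq], as arg(-T) tends to pi. *)
Let kernel (T : R) : R -> R := fun u => (1 + (u - T) ^+ 2)^-1.

Let kernel_gt0 T u : 0 < kernel T u.
Proof. by rewrite invr_gt0 ltr_pwDl ?sqr_ge0. Qed.

Let atan_shift_derive T (u : R) : is_derive u 1 (fun v => atan (v - T)) (kernel T u).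
Proof.
have dB := is_deriveB (is_derive_id u 1) (is_derive_cst T u 1).
have H := @is_derive1_comp R atan (fun v => v - T) u _ _ (is_derive1_atan _) dB.
by apply: (is_derive_eq H); rewrite subr0 mulr1.
Qed.

Let kernel_integral T : impint (kernel T) (pi / 2 + atan T).
Proof.
exists (fun v => atan (v - T)); split=> [u _|]; first exact: atan_shift_derive.
exists (- atan T), (pi / 2); split; last by rewrite opprK.
- have : atan (v - T) @[v --> (0 : R)] --> atan (0 - T).
    apply: continuous_cvg; first exact: continuous_atan.
    by apply: cvgB => //; exact: cvg_cst.
  by rewrite sub0r atanN => H; apply: cvg_at_right_filter.
- have H : v - T @[v --> +oo] --> +oo.
    apply/cvgryPge => M; near=> v.
    rewrite lerBrDr; near: v; apply: nbhs_pinfty_ge; exact: num_real.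
  exact: cvg_comp H (@cvgy_atan R).
Unshelve. all: by end_near. Qed.

Let y_integral T : 0 < T -> impint (fun u => u `^ p * kernel T u) (y (- T)).
Proof.
move=> T0; have lo0 : - T <= 0 by rewrite oppr_le0 ltW.
have K0 : 0 <= 2 * (1 - - T) by rewrite mulr_ge0// subr_ge0 (le_trans lo0).
have H := fracpow_integralP K0 (rot_resolvent_family lo0) p01 (1, 0) (lexx _).
have sL : linear (snd : C -> R^o) by [].
have sB (z : C) : `|z.2| <= 1 * `|z| by rewrite mul1r prod_normE le_max lexx orbT.
apply: impint_ext (impint_linear sL sB H) => u u0.
rewrite -[LHS]/(u `^ (p - 1) * (((u - T) * (1 + - T * 0) - (- 0 + - T * 1)) /
  ((u - T) ^+ 2 + 1))).
by rewrite powR_pred// /kernel; field; rewrite !gt_eqF// addrC// sqr1_gt0.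
Qed.

(** The power v^p lies between 1 and v. *)
Let powR_dist1 v : 0 <= v -> `|v `^ p - 1| <= `|v - 1|.
Proof.
move=> v0; have [q0 q1] := (p0, p1).
have [v1|v1] := leP 1 v.
  have H1 : v `^ p <= v by apply: ler1_powR => //; exact: ltW.
  have H2 : 1 <= v `^ p.
    by have := ler_powR v1 (ltW q0); rewrite powRr0.
  rewrite !ger0_norm; lra.
have [->|vN0] := eqVneq v 0; first by rewrite powR0// gt_eqF.
have v0' : 0 < v <= 1 by rewrite lt_neqAle eq_sym vN0 v0 ltW.
have H1 : v <= v `^ p by apply: ger1_powR => //; exact: ltW.
have H2 : v `^ p <= 1 by have := ger_powR v0' (ltW q0); rewrite powRr0.
rewrite !ler0_norm; lra.
Qed.

(** Up to 2T, the product of |u / T - 1| and the kernel is split, with a parameter e, into e times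
    the kernel, whose mass is at most pi, and a constant. Beyond 2T the kernel is at most 4 / u^2.
    For fixed e and large T only e pi remains. *)
Let y_bound T e : 0 < T -> 0 < e ->
  `|(T `^ p)^-1 * y (- T) - (pi / 2 + atan T)| <=
    (e * pi + (2 * e * T)^-1) + 4 / (T * (1 - p)).
Proof.
move=> T0 e0; have [q0 q1] := (p0, p1).
have Tp0 : 0 < T `^ p by exact: powR_gt0.
have H := impintB (impintZ (T `^ p)^-1 (y_integral T0)) (kernel_integral T).
have HE u : 0 < u -> (T `^ p)^-1 * (u `^ p * kernel T u) - kernel T u =
    ((u / T) `^ p - 1) * kernel T u.
  move=> u0; rewrite powRM ?invr_ge0 ?(ltW u0) ?(ltW T0)//.
  have -> : T^-1 `^ p = (T `^ p)^-1.
    by rewrite -(powR_inv1 (ltW T0)) -powRrM mulN1r powRN.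
  by ring.
have T2 : 0 < 2 * T by rewrite mulr_gt0.
have e4 : 0 < 4 * e * T ^+ 2 by rewrite !mulr_gt0// exprn_gt0.
apply: (impint_bound (c := 2 * T)
  (g1 := fun u => e * kernel T u + (4 * e * T ^+ 2)^-1)
  (G1 := fun u => e * atan (u - T) + (4 * e * T ^+ 2)^-1 * u)
  (g2 := fun u => 4 / T `^ p * u `^ (p - 1 - 1))
  (G2 := fun u => 4 / T `^ p / (p - 1) * u `^ (p - 1)) T2 _ _ _ _ _ _ H) => u.
- move=> _; have H1 := is_deriveZ e (atan_shift_derive T u).
  have H2 := is_deriveZ (4 * e * T ^+ 2)^-1 (is_derive_id u 1).
  by apply: (is_derive_eq (is_deriveD H1 H2)); rewrite /GRing.scale/= mulr1.
- move=> Tu; apply: is_derive_powR_primitive; first by lra.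
  by rewrite subr_eq0 lt_eqF.
- move=> /andP[u0 uT]; rewrite [X in `|X|]HE// normrM (gtr0_norm (kernel_gt0 _ _)).
  have uT0 : 0 <= u / T by rewrite divr_ge0 ?ltW.
  apply: le_trans (ler_wpM2r (ltW (kernel_gt0 _ _)) (powR_dist1 uT0)) _.
  have -> : u / T - 1 = (u - T) / T by field; rewrite gt_eqF.
  rewrite normrM normfV (gtr0_norm T0).
  (* AM-GM *)
  have AM : `|u - T| / T <= e + (u - T) ^+ 2 / (4 * e * T ^+ 2).
    rewrite -subr_ge0 -(real_normK (num_real (u - T))).
    have -> : e + `|u - T| ^+ 2 / (4 * e * T ^+ 2) - `|u - T| / T =
        (2 * e * T - `|u - T|) ^+ 2 / (4 * e * T ^+ 2).
      by field; rewrite !gt_eqF.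
    by rewrite divr_ge0 ?sqr_ge0// ltW.
  apply: le_trans (ler_wpM2r (ltW (kernel_gt0 _ _)) AM) _.
  rewrite mulrDl lerD2l mulrAC; apply: ler_piMl; first by rewrite invr_ge0 ltW.
  by rewrite /kernel ler_pdivrMr ?mul1r ?lerDr// ltr_pwDl ?sqr_ge0.
- move=> Tu; have u0 : 0 < u by lra.
  rewrite [X in `|X|]HE// normrM (gtr0_norm (kernel_gt0 _ _)).
  have uT1 : 1 <= u / T by rewrite ler_pdivlMr ?mul1r; lra.
  have H1 : 1 <= (u / T) `^ p.
    by have := ler_powR uT1 (ltW q0); rewrite powRr0.
  have H2 : `|(u / T) `^ p - 1| <= u `^ p / T `^ p.
    rewrite ger0_norm ?subr_ge0//.
    have -> : u `^ p / T `^ p = (u / T) `^ p.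
      rewrite powRM ?invr_ge0 ?(ltW u0) ?(ltW T0)//; congr (_ * _).
      by rewrite -(powR_inv1 (ltW T0)) -powRrM mulN1r powRN.
    lra.
  (* As u >= 2T, u - T is at least u / 2. *)
  have H3 : kernel T u <= 4 / u ^+ 2.
    rewrite /kernel -[leRHS]invf_div lef_pV2 ?posrE; last 2 first.
    + by rewrite ltr_pwDl ?sqr_ge0.
    + by rewrite divr_gt0 ?exprn_gt0.
    rewrite ler_pdivrMr//; nra.
  apply: le_trans (ler_pM (normr_ge0 _) (ltW (kernel_gt0 _ _)) H2 H3) _.
  rewrite !powR_pred//; rewrite le_eqVlt; apply/orP; left; apply/eqP.
  by field; rewrite !gt_eqF.
- move=> /andP[u0 uT].
  have -> : e * atan (2 * T - T) + (4 * e * T ^+ 2)^-1 * (2 * T) -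
      (e * atan (u - T) + (4 * e * T ^+ 2)^-1 * u) =
    e * (atan (2 * T - T) - atan (u - T)) + (4 * e * T ^+ 2)^-1 * (2 * T - u) by ring.
  apply: lerD.
    rewrite ler_wpM2l ?(ltW e0)//.
    have := atan_ltpi2 (2 * T - T); have := atan_gtNpi2 (u - T); lra.
  have -> : (2 * e * T)^-1 = (4 * e * T ^+ 2)^-1 * (2 * T).
    by field; rewrite !gt_eqF.
  by rewrite ler_wpM2l ?invr_ge0 ?(ltW e4)// lerBlDr lerDl ltW.
- move=> Tu; have u0 : 0 < u by lra.
  have pN : p - 1 = - (1 - p) by ring.
  have -> : 4 / T `^ p / (p - 1) * u `^ (p - 1) - 4 / T `^ p / (p - 1) * (2 * T) `^ (p - 1)
     = 4 / T `^ p / (1 - p) * ((2 * T) `^ (p - 1) - u `^ (p - 1)).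
    by rewrite {1 3}pN invrN; ring.
  apply: (@le_trans _ _ (4 / T `^ p / (1 - p) * T `^ (p - 1))).
    rewrite ler_wpM2l//; first by rewrite !divr_ge0// ?powR_ge0// subr_ge0 ltW.
    rewrite lerBlDr (@le_trans _ _ (T `^ (p - 1)))//; last by rewrite lerDl powR_ge0.
    rewrite pN !powRN lef_pV2 ?posrE ?powR_gt0//.
    apply: ge0_ler_powR; rewrite ?nnegrE ?(ltW T0) ?(ltW T2)//; lra.
  rewrite powR_pred//; rewrite le_eqVlt; apply/orP; left; apply/eqP.
  by field; rewrite !gt_eqF// subr_gt0.
Qed.

Lemma beta_integralE : beta_integral p = pi / sin (pi * p).
Proof.
have [q0 q1] := (p0, p1); have pi0 : (pi : R) != 0 by rewrite gt_eqF// pi_gt0.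
have ycvg : (T `^ p)^-1 * y (- T) @[T --> +oo] --> (pi : R).
  apply/cvgrPdist_le => e e0.
  (* A quarter of [e] for each of the three terms of [y_bound], and one for the convergence of
     [atan]. *)
  pose h := e / (4 * pi); have h0 : 0 < h by rewrite divr_gt0// mulr_gt0// pi_gt0.
  have e40 : 0 < e / 4 by rewrite divr_gt0.
  have /cvgrPdist_le/(_ _ e40) A1 := inv_cvg (2 * h)^-1.
  have /cvgrPdist_le/(_ _ e40) A2 := inv_cvg (4 / (1 - p)).
  have A3 : pi / 2 + atan T @[T --> +oo] --> (pi / 2 + pi / 2 : R).
    by apply: cvgD; [exact: cvg_cst | exact: cvgy_atan].
  move: A3 => /cvgrPdist_le/(_ _ e40) A3.
  near=> T; have T0 : 0 < T by near: T; apply: nbhs_pinfty_gt; exact: num_real.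
  have B1 : `|0 - (2 * h)^-1 / T| <= e / 4 by near: T.
  have B2 : `|0 - 4 / (1 - p) / T| <= e / 4 by near: T.
  have B3 : `|pi / 2 + pi / 2 - (pi / 2 + atan T)| <= e / 4 by near: T.
  rewrite sub0r normrN in B1; rewrite sub0r normrN in B2.
  have := y_bound T0 h0.
  have -> : h * pi = e / 4.
    by rewrite /h; move: pi0; move: (pi : R) => P P0; field.
  have -> : (2 * h * T)^-1 = (2 * h)^-1 / T by rewrite invfM.
  have -> : 4 / (T * (1 - p)) = 4 / (1 - p) / T by rewrite invfM; ring.
  move: (le_trans (ler_norm _) B1) (le_trans (ler_norm _) B2) B3.
  rewrite !ler_norml => B4 B5 /andP[B6 B7] /andP[B8 B9]; apply/andP; split; lra.
have L : r T * ((T `^ p)^-1 * y (- T)) @[T --> +oo] --> 1 * pi by exact: cvgM.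
have R0 : m * s (- T) @[T --> +oo] --> m * sin (p * pi).
  apply: cvgMr; apply: continuous_cvg; first exact: continuous_sin.
  apply: cvgMr.
  have -> : (fun T => arg (- T)) = (fun T => pi / 2 + atan T).
    by apply/funext => T; rewrite /arg atanN opprK.
  rewrite [X in _ --> X](splitr pi).
  by apply: cvgD; [exact: cvg_cst | exact: cvgy_atan].
(* Both are the limit of rho(T) y(-T), since [rho] is even. *)
have E : m * sin (p * pi) = 1 * pi.
  apply: norm_cvg_unique R0 _; apply: cvg_trans L; apply: near_eq_cvg; near=> T.
  have T0 : 0 < T by near: T; apply: nbhs_pinfty_gt; exact: num_real.
  rewrite -(y_eq (- T)) /r /rho sqrrN; field.
  by rewrite gt_eqF// powR_gt0.
have sin0' : sin (p * pi) != 0.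
  by apply/eqP => sin0'; move: E; rewrite sin0' mulr0 mul1r => /esym/eqP; rewrite gt_eqF// pi_gt0.
by rewrite [pi * p]mulrC -[LHS](mulfK sin0') E mul1r.
Unshelve. all: by end_near. Qed.

End Rotation.

(** * Fractional powers *)

Section ShiftedPowers.
Context (R : realType) (X : completeNormedModType R).
Variables (A : X -> X) (a : R) (Q : R -> X -> X) (K : R).
Hypotheses (K_ge0 : 0 <= K) (a_ge0 : 0 <= a) (rf : resolvent_family A a Q 0 K).
Implicit Types (p t : R) (u : X).

(** The power (A + t)^p for 0 <= p < 1; at t = 0 it is [fracpow]. *)
Definition shifted_fracpow p t u : X :=
  if p == 0 then u else (sin (pi * p) / pi) *: fracpow_integral A Q p t u.

Local Notation P := shifted_fracpow.

Let sin_ratio_ge0 p : 0 <= p < 1 -> 0 <= sin (pi * p) / pi :> R.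
Proof.
move=> /andP[p0 p1]; rewrite divr_ge0 ?pi_ge0// sin_ge0_pi// mulr_ge0 ?pi_ge0//=.
by rewrite ler_piMr ?pi_ge0// ltW.
Qed.

Let frac01 p : 0 <= p < 1 -> p != 0 -> 0 < p < 1.
Proof. by move=> /andP[p0 ->] pN; rewrite lt_neqAle eq_sym pN p0. Qed.

Lemma shifted_fracpow_linear p t : 0 <= p < 1 -> 0 <= t -> linear (P p t).
Proof.
move=> p01 t0 k x y; rewrite /P; case: ifPn => [//|pN].
rewrite (fracpow_integral_linear K_ge0 rf (frac01 p01 pN))// scalerDr.
by rewrite !scalerA [k * _]mulrC.
Qed.

Lemma shifted_fracpow_commute (T : X -> X) C p t u : 0 <= p < 1 -> 0 <= t ->
    linear T -> (forall x, `|T x| <= C * `|x|) -> (forall x, T (A x) = A (T x)) ->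
    (forall s x, 0 < s -> T (Q s x) = Q s (T x)) ->
  T (P p t u) = P p t (T u).
Proof.
move=> p01 t0 TL TC TA TQ; rewrite /P; case: ifPn => [//|pN].
rewrite (linear_funZ TL) (fracpow_integral_commute K_ge0 rf (frac01 p01 pN) _ t0 TL TC)//.
Qed.

Lemma shifted_fracpow_bound p b : 0 <= p < 1 -> exists M, forall t u, 0 <= t <= b ->
  `|P p t u| <= M * `|u|.
Proof.
move=> p01; have [p0|pN] := eqVneq p 0.
  by exists 1 => t u _; rewrite /P p0 eqxx mul1r.
have p01' := frac01 p01 pN; have /andP[p0 p1] := p01'.
exists (sin (pi * p) / pi * ((1 + K) / p + K * (a + `|b|) / (1 - p))) => t u /andP[t0 tb].
rewrite /P (negPf pN) normrZ ger0_norm ?sin_ratio_ge0// -[leRHS]mulrA.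
rewrite ler_wpM2l ?sin_ratio_ge0//.
apply: le_trans (fracpow_integral_bound K_ge0 rf p01' _ t0) _.
rewrite ler_wpM2r// lerD2l ler_wpM2r ?invr_ge0 ?subr_ge0 ?(ltW p1)//.
rewrite ler_wpM2l// lerD2l !ger0_norm//; exact: le_trans tb.
Qed.

Lemma shifted_fracpow_derive p t u : 0 <= p < 1 -> 0 < t ->
  is_derive t 1 (P p ^~ u) (p *: Q t (P p t u)).
Proof.
move=> p01 t0; rewrite /P; case: eqVneq => [->|pN].
  by rewrite scale0r; exact: is_derive_cst.
have H := is_deriveZ (sin (pi * p) / pi)
  (fracpow_integral_derive K_ge0 rf (frac01 p01 pN) u t0).
apply: (is_derive_eq H).
by rewrite (linear_funZ (resolvent_linear rf t0)) !scalerA [p * _]mulrC.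
Qed.

(** The coefficient of t^p must be exactly 1 for the limit of the triple product at +oo to be the
    identity. It is sin(pi p) / pi times the beta integral. *)
Lemma shifted_fracpow_asymptotics p : 0 <= p < 1 -> exists2 C, 0 <= C &
  forall t u, 0 < t -> `|P p t u - t `^ p *: u| <= C * t `^ (p - 1) * `|u|.
Proof.
move=> p01; have [p0|pN] := eqVneq p 0.
  exists 0 => // t u _; rewrite /P p0 eqxx powRr0 scale1r subrr normr0 !mul0r//.
have p01' := frac01 p01 pN; have /andP[p0 p1] := p01'.
pose k := sin (pi * p) / pi : R.
have s0 : 0 < sin (pi * p).
  by rewrite sin_gt0_pi// mulr_gt0 ?pi_gt0//= gtr_pMr ?pi_gt0.
exists (k * (a * K * (p^-1 + (1 - p)^-1))).
  rewrite mulr_ge0 ?sin_ratio_ge0// !mulr_ge0// addr_ge0 ?invr_ge0 ?subr_ge0// ltW//.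
move=> t u t0; rewrite /P (negPf pN) -/k.
have -> : t `^ p *: u = k *: ((t `^ p * beta_integral p) *: u).
  rewrite beta_integralE// scalerA /k; congr (_ *: _).
  have := pi_gt0 R; move: (pi : R) s0 => q s0 q0; field.
  by rewrite !gt_eqF.
rewrite -scalerBr normrZ (ger0_norm (sin_ratio_ge0 p01)) -/k.
rewrite -[leRHS]mulrA -[leRHS]mulrA ler_wpM2l ?sin_ratio_ge0// [leRHS]mulrA.
exact: (fracpow_integral_asymptotics K_ge0 rf p01').
Qed.

Lemma shifted_fracpow_cvg0 p u : 0 <= p < 1 -> P p t u @[t --> 0^'+] --> P p 0 u.
Proof.
move=> p01; rewrite /P; case: eqVneq => [_|pN]; first exact: cvg_cst.
apply: cvgZr; have p01' := frac01 p01 pN; have /andP[p0 _] := p01'.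
apply/cvgrPdist_le => e e0.
pose C := K ^+ 2 * (p^-1 + (1 - p)^-1) * `|u|.
have : C * t `^ p @[t --> (0 : R)^'+] --> C * 0.
  by apply: cvgMr; exact: powR_cvg0.
rewrite mulr0 => /cvgrPdist_le/(_ _ e0) H; near=> t.
have t0 : 0 < t by near: t; exact: nbhs_right_gt.
have te : `|0 - C * t `^ p| <= e by near: t.
rewrite sub0r normrN in te; rewrite distrC; apply: le_trans te.
apply: le_trans (fracpow_integral_at0 K_ge0 rf p01' u erefl t0) _.
by rewrite mulrAC ler_norm.
Unshelve. all: by end_near. Qed.

Let QP p s t u : 0 <= p < 1 -> 0 < s -> 0 <= t -> Q s (P p t u) = P p t (Q s u).
Proof.
move=> p01 s0 t0; have [_ _ _ _ QK] := rf.
apply: (shifted_fracpow_commute (C := K / (s - 0))) => //.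
- exact: resolvent_linear rf _ s0.
- by move=> x; exact: QK.
- by move=> x; rewrite (resolvent_commA rf).
- by move=> s' x s'0; rewrite (resolvent_comm rf).
Qed.

(** Solutions of y' = k Q(t) y behave like (A + t)^k; as Q(t) commutes with (A + t)^p, composition
    adds the exponents. *)
Lemma shifted_fracpow_derive_comp p k (y : R -> X) t : 0 <= p < 1 -> 0 < t ->
  is_derive t 1 y (k *: Q t (y t)) ->
  is_derive t 1 (fun s => P p s (y s)) ((p + k) *: Q t (P p t (y t))).
Proof.
move=> p01 t0 dy; have [M PM] := shifted_fracpow_bound (2 * t) p01.
have near_t s : `|s - t| < t -> 0 <= s <= 2 * t.
  by rewrite ltr_norml => /andP[? ?]; apply/andP; split; lra.
have PL := shifted_fracpow_linear p01 (ltW t0).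
apply: (is_derive_eq (is_derive_apply (P := P p) (d := t) (M := M) (t := t)
  t0 _ _ (shifted_fracpow_derive (y t) p01 t0) _ dy)).
- by move=> s /near_t/andP[s0 _]; exact: shifted_fracpow_linear.
- by move=> s /near_t s0 x; exact: PM.
- exact: derive_continuous (shifted_fracpow_derive _ p01 t0).
- by rewrite (linear_funZ PL) -QP ?(ltW t0)// -scalerDl.
Qed.

(** The relative error 1 / t survives composition because (A + t)^p has norm at most (1 + D) t^p for
    t >= 1. *)
Lemma shifted_fracpow_asymptotics_comp p k (y : R -> X) u : 0 <= p < 1 ->
  (exists2 C, 0 <= C & forall t, 1 <= t -> `|y t - t `^ k *: u| <= C * t `^ (k - 1)) ->
  exists2 C, 0 <= C & forall t, 1 <= t ->
    `|P p t (y t) - t `^ (p + k) *: u| <= C * t `^ (p + k - 1).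
Proof.
move=> p01 [C C0 yC]; have [D D0 PD] := shifted_fracpow_asymptotics p01.
exists ((1 + D) * C + D * `|u|).
  by rewrite addr_ge0// !mulr_ge0// addr_ge0.
move=> t t1; have t0 : 0 < t by lra.
have PL := shifted_fracpow_linear p01 (ltW t0).
have tp_le : t `^ (p - 1) <= t `^ p by apply: ler_powR => //; lra.
have PB x : `|P p t x| <= (1 + D) * t `^ p * `|x|.
  rewrite -[P p t x](subrK (t `^ p *: x)); apply: le_trans (ler_normD _ _) _.
  rewrite normrZ ger0_norm ?powR_ge0// !mulrDl mul1r addrC lerD2l.
  by apply: le_trans (PD _ _ t0) _; rewrite ler_wpM2r// ler_wpM2l.
have -> : P p t (y t) - t `^ (p + k) *: u =
    P p t (y t - t `^ k *: u) + t `^ k *: (P p t u - t `^ p *: u).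
  rewrite (linear_funB PL) (linear_funZ PL) scalerBr addrA subrK scalerA.
  by rewrite -powRD ?(gt_eqF t0) ?implybT// [k + p]addrC.
apply: le_trans (ler_normD _ _) _; rewrite mulrDl normrZ ger0_norm ?powR_ge0//.
have Epk : t `^ (p + k - 1) = t `^ p * t `^ (k - 1).
  by rewrite -powRD ?(gt_eqF t0) ?implybT// addrA.
have Ekp : t `^ (p + k - 1) = t `^ k * t `^ (p - 1).
  by rewrite -powRD ?(gt_eqF t0) ?implybT//; congr (_ `^ _); ring.
apply: lerD.
  apply: le_trans (PB _) _; rewrite Epk.
  have -> : (1 + D) * C * (t `^ p * t `^ (k - 1)) =
    (1 + D) * t `^ p * (C * t `^ (k - 1)) by ring.
  by rewrite ler_wpM2l ?mulr_ge0 ?powR_ge0 ?addr_ge0// yC.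
apply: le_trans (ler_wpM2l (powR_ge0 _ _) (PD _ u t0)) _.
by rewrite Ekp le_eqVlt; apply/orP; left; apply/eqP; ring.
Qed.

(* The exponents adding up to 1, [W' = Q W] below, so that [V = Q W] has derivative
   [- Q (Q W) + Q (Q W) = 0]. *)
Lemma shifted_fracpow_triple p q r u : 0 <= p < 1 -> 0 <= q < 1 -> 0 <= r < 1 ->
  p + q + r = 1 -> P p 0 (P q 0 (P r 0 u)) = A u.
Proof.
move=> p01 q01 r01 pqr; have [AL Aa AQ QA QK] := rf.
pose W t := P p t (P q t (P r t u)).
have W_derive t : 0 < t -> is_derive t 1 W (Q t (W t)).
  move=> t0; have H := shifted_fracpow_derive_comp p01 t0
    (shifted_fracpow_derive_comp q01 t0 (shifted_fracpow_derive u r01 t0)).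
  by apply: (is_derive_eq H); rewrite addrA pqr scale1r.
pose V t := Q t (W t).
have V_derive (t : R) : 0 < t -> is_derive t 1 V 0.
  move=> t0; have [t20 QL] : 0 < t / 2 /\ linear (Q t).
    by split; [exact: divr_gt0 | exact: resolvent_linear rf _ t0].
  have near_t s : `|s - t| < t / 2 -> t / 2 <= s.
    by rewrite ltr_norml => /andP[? _]; lra.
  apply: (is_derive_eq (is_derive_apply (P := Q) (d := t / 2) (M := K / (t / 2)) (t := t)
    t20 _ _ (is_derive_resolvent K_ge0 rf (W t) t0) _ (W_derive t t0))).
  - by move=> s /near_t ts; apply: resolvent_linear rf _ _; exact: lt_le_trans ts.
  - move=> s /near_t ts x; have s0 := lt_le_trans t20 ts.
    apply: le_trans (QK _ _ s0) _; rewrite subr0 ler_wpM2r// ler_wpM2l//.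
    by rewrite lef_pV2 ?posrE.
  - by apply: resolvent_continuous K_ge0 rf _ _ _.
  - by rewrite addNr.
have V_const s t : 0 < s -> 0 < t -> V s = V t.
  move=> s0 t0; apply/eqP; rewrite -subr_eq0 -normr_le0.
  have := @norm_mvt_sym _ _ V (fun=> 0) (Num.min s t) (Num.max s t) 0 _ _ s t.
  rewrite mul0r; apply.
  - move=> z /andP[mz _]; apply: V_derive; apply: lt_le_trans mz.
    by rewrite lt_min s0.
  - by move=> z _; rewrite normr0.
  - by rewrite ge_min le_max !lexx.
  - by rewrite ge_min le_max !lexx !orbT.
have [C C0 WC] : exists2 C, 0 <= C & forall t, 1 <= t ->
    `|W t - t `^ (p + (q + r)) *: u| <= C * t `^ (p + (q + r) - 1).
  apply: shifted_fracpow_asymptotics_comp => //.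
  apply: shifted_fracpow_asymptotics_comp => //.
  have [C C0 H] := shifted_fracpow_asymptotics r01.
  exists (C * `|u|); first exact: mulr_ge0.
  by move=> t t1; rewrite mulrAC; apply: H; exact: lt_le_trans t1.
rewrite addrA pqr subrr in WC.
(* Here t Q(t) u = u - Q(t) A u, and the error of [W] stays bounded while Q(t) is of order 1 / t. *)
have V_bound t : 1 <= t -> `|V t - u| <= (K * (C + a * `|u|)) / t.
  move=> t1; have t0 : 0 < t by lra.
  have QL := resolvent_linear rf t0.
  have -> : V t - u = Q t (W t - t *: u) - Q t (A u).
    rewrite (linear_funB QL) -addrA -opprD -(linear_funD QL).
    by rewrite [t *: u + _]addrC QA.
  apply: le_trans (ler_normB _ _) _.
  have -> : K * (C + a * `|u|) / t = K / t * C + K / t * (a * `|u|) by ring.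
  have Kt : 0 <= K / t by rewrite divr_ge0// ltW.
  apply: lerD; apply: le_trans (QK _ _ t0) _; rewrite subr0 ler_wpM2l//.
  by have := WC t t1; rewrite powRr0 mulr1 powRr1 ?(ltW t0).
have V_eq t : 0 < t -> V t = u.
  move=> t0; apply/eqP; rewrite -subr_eq0 -normr_le0.
  apply/ler_addgt0Pr => e e0; rewrite add0r.
  pose k := K * (C + a * `|u|); have k0 : 0 <= k by rewrite mulr_ge0// addr_ge0// mulr_ge0.
  have s1 : 1 <= Num.max 1 (k / e) by rewrite le_max lexx.
  rewrite (V_const t (Num.max 1 (k / e)))//; last by lra.
  apply: le_trans (V_bound _ s1) _; rewrite ler_pdivrMr; last by lra.
  by rewrite -/k [leRHS]mulrC -ler_pdivrMr// le_max lexx orbT.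
(* Applying A + t to V = u gives the exact value of the triple product; it remains to let t tend to
   0. *)
have W_eq t : 0 < t -> W t = A u + t *: u.
  by move=> t0; rewrite -(AQ t (W t) t0) -/(V t) V_eq.
(* The argument of each factor also moves with t, so the uniform bound for t in [0, 1] is combined
   with convergence at a fixed vector. *)
have comp_cvg p' (y : R -> X) y0 : 0 <= p' < 1 -> y t @[t --> 0^'+] --> y0 ->
    P p' t (y t) @[t --> 0^'+] --> P p' 0 y0.
  move=> p'01 yy0; have [M PM] := shifted_fracpow_bound 1 p'01.
  have H1 : P p' t (y t - y0) @[t --> 0^'+] --> (0 : X).
    apply/cvgrPdist_le => e e0.
    have M1 : 0 < `|M| + 1 by rewrite ltr_wpDl.
    have e'0 : 0 < e / (`|M| + 1) by exact: divr_gt0.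
    move/cvgrPdist_le : yy0 => /(_ _ e'0) H; near=> t.
    have t0 : 0 < t by near: t; exact: nbhs_right_gt.
    have t1 : t <= 1 by near: t; exact: nbhs_right_le.
    have te : `|y0 - y t| <= e / (`|M| + 1) by near: t.
    rewrite sub0r normrN; apply: le_trans (PM _ _ _) _; first by rewrite t1 ltW.
    move: te; rewrite ler_pdivlMr// distrC => te; apply: le_trans te.
    by rewrite mulrC ler_wpM2l// (le_trans (ler_norm _))// lerDl.
  have H : P p' t (y t - y0) + P p' t y0 @[t --> 0^'+] --> P p' 0 y0.
    by rewrite -[X in _ --> X]add0r; apply: cvgD => //; exact: shifted_fracpow_cvg0.
  apply: cvg_trans H; apply: near_eq_cvg; near=> t.
  have t0 : 0 < t by near: t; exact: nbhs_right_gt.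
  by rewrite (linear_funB (shifted_fracpow_linear p'01 (ltW t0))) /= subrK.
have W_cvg : W t @[t --> 0^'+] --> P p 0 (P q 0 (P r 0 u)).
  apply: (comp_cvg _ _ _ p01); apply: (comp_cvg _ _ _ q01).
  exact: shifted_fracpow_cvg0.
have W_cvg' : A u + t *: u @[t --> 0^'+] --> A u + 0 *: u.
  apply: cvgD; first exact: cvg_cst.
  by apply: cvgZl; apply: cvg_at_right_filter; exact: cvg_id.
rewrite scale0r addr0 in W_cvg'.
apply: norm_cvg_unique W_cvg _; apply: cvg_trans W_cvg'; apply: near_eq_cvg.
near=> t; rewrite W_eq//; near: t; exact: nbhs_right_gt.
Unshelve. all: by end_near. Qed.

End ShiftedPowers.

Section Opnorm.
Context (R : realType) (X : completeNormedModType R).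
Implicit Types (T : X -> X).

Lemma opnorm_le_bound T (c : R) : (forall k x, T (k *: x) = k *: T x) ->
  (opnorm T <= c%:E)%E -> forall x, `|T x| <= c * `|x|.
Proof.
move=> TZ Tc x.
have H y : `|y| <= 1 -> `|T y| <= c.
  move=> y1; rewrite -lee_fin; apply: le_trans Tc.
  by apply: ereal_sup_ubound; exists y.
have [->|x0] := eqVneq x 0.
  by rewrite -(scale0r (0 : X)) TZ !scale0r !normr0 mulr0.
have nx0 : 0 < `|x| by rewrite normr_gt0.
rewrite -ler_pdivrMr// mulrC -{1}(ger0_norm (ltW nx0)) -normfV -normrZ -TZ.
by apply: H; rewrite normrZ normfV normr_id mulVf// gt_eqF.
Qed.

Lemma bounded_near_opnorm (A : {linear X -> X}) : bounded_near A (nbhs (0 : X)) ->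
  forall x, `|A x| <= fine (opnorm A) * `|x|.
Proof.
move=> /linear_boundedP/pinfty_ex_gt0[M M0 MA].
apply: opnorm_le_bound; first by move=> k x; rewrite linearZ.
rewrite fineK//; apply/fin_numPlt; apply/andP; split.
  apply: (@lt_le_trans _ _ 0%E); first exact: ltNyr.
  apply: ereal_sup_ubound; exists 0; first by rewrite /= normr0.
  by rewrite linear0 normr0.
apply: (@le_lt_trans _ _ M%:E); last exact: ltry.
apply: ge_ereal_sup => _ [x /= x1 <-]; rewrite lee_fin.
by apply: le_trans (MA x) _; rewrite ler_piMr// ltW.
Qed.

End Opnorm.

(** * The semigroup of powers of A *)

Section FractionalPowers.
Context (R : realType) (X : completeNormedModType R) (A : {linear X -> X}).
Variables (a K : R).
Hypotheses (Aa : forall x, `|A x| <= a * `|x|) (a_ge0 : 0 <= a) (K_gt0 : 0 < K)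
  (A_pos : forall s, 0 < s -> bijective (fun u => A u + s *: u) /\
                     (opnorm (resolvent A s) <= (K / s)%:E)%E)
  (A_inj : injective A).

Lemma resolvent_family_resolvent : resolvent_family A a (resolvent A) 0 K.
Proof.
have AQ s x : 0 < s -> A (resolvent A s x) + s *: resolvent A s x = x.
  move=> s0; have [[g _ gK] _] := A_pos s0.
  rewrite /resolvent; case: xgetP => [y _ //|/(_ (g x))].
  by move=> /(_ (gK x)).
have QA s x : 0 < s -> resolvent A s (A x + s *: x) = x.
  move=> s0; have [bij _] := A_pos s0; apply: (bij_inj bij).
  exact: AQ.
split => //; first by move=> k x y; rewrite linearP.
move=> s x s0; rewrite subr0; have [_ QK] := A_pos s0.
apply: opnorm_le_bound QK _ => k y.
by rewrite -{1}(AQ s y s0) scalerDr scalerA [k * s]mulrC -scalerA -linearZ QA.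
Qed.

Let rf := resolvent_family_resolvent.
Let K_ge0 := ltW K_gt0.
Local Notation P p := (shifted_fracpow A (resolvent A) p 0).

Lemma fracpow_shifted p u : 0 <= p < 1 -> fracpow A p u = P p u.
Proof.
move=> /andP[p0 p1]; rewrite /fracpow /shifted_fracpow; case: eqVneq => // pN.
congr (_ *: _).
have p01 : 0 < p < 1 by rewrite lt_neqAle eq_sym pN p0.
have E : (fun s => s `^ (p - 1) *: resolvent A s (A u)) =
    fracpow_integrand A (resolvent A) p 0 u.
  by apply/funext => s; rewrite /fracpow_integrand addr0 scale0r addr0.
rewrite E; apply: improper_bochnerE; first exact: (fracpow_integrand_loclip K_ge0 rf).
exact: (fracpow_integralP K_ge0 rf).
Qed.

Local Notation F := (fracpow A).

Lemma fracpow0 u : F 0 u = u.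
Proof. by rewrite /fracpow eqxx. Qed.

#[local] Opaque fracpow.

Lemma fracpow_linear p : 0 <= p < 1 -> linear (F p).
Proof.
move=> p01 k x y; rewrite !fracpow_shifted//.
exact: (shifted_fracpow_linear K_ge0 rf p01 (lexx 0)).
Qed.

Lemma fracpow_commute (T : X -> X) C p u : 0 <= p < 1 ->
    linear T -> (forall x, `|T x| <= C * `|x|) -> (forall x, T (A x) = A (T x)) ->
    (forall s x, 0 < s -> T (resolvent A s x) = resolvent A s (T x)) ->
  T (F p u) = F p (T u).
Proof.
move=> p01 TL TC TA TQ; rewrite !fracpow_shifted//.
exact: (shifted_fracpow_commute K_ge0 rf _ p01 (lexx 0) TL TC TA TQ).
Qed.

Lemma fracpowA p u : 0 <= p < 1 -> A (F p u) = F p (A u).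
Proof.
move=> p01; apply: (fracpow_commute (C := a)) => //.
  by move=> k x y; rewrite linearP.
by move=> s x s0; rewrite (resolvent_commA rf).
Qed.

Lemma fracpow_triple p q r u : 0 <= p < 1 -> 0 <= q < 1 -> 0 <= r < 1 ->
  p + q + r = 1 -> F p (F q (F r u)) = A u.
Proof.
move=> p01 q01 r01 pqr; rewrite !fracpow_shifted//.
exact: (shifted_fracpow_triple K_ge0 a_ge0 rf).
Qed.

(** The triple product with third exponent 0. *)
Lemma fracpow_complement p u : 0 < p < 1 -> F (1 - p) (F p u) = A u.
Proof.
move=> /andP[p0 p1].
have p01 : 0 <= p < 1 by rewrite ltW.
have q01 : 0 <= 1 - p < 1 by apply/andP; split; lra.
have z01 : 0 <= (0 : R) < 1 by rewrite lexx ltr01.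
have e : 1 - p + p + 0 = 1 by rewrite subrK addr0.
by rewrite -(fracpow_triple u q01 p01 z01 e) fracpow0.
Qed.

Lemma fracpow_inj p : 0 <= p < 1 -> injective (F p).
Proof.
move=> p01 x y; have [->|pN] := eqVneq p 0; first by rewrite !fracpow0.
have /andP[p0 p1] := p01; have p_gt0 : 0 < p by rewrite lt_neqAle eq_sym pN p0.
have p01' : 0 < p < 1 by rewrite p_gt0.
move=> /(congr1 (F (1 - p))) H; apply: A_inj.
by rewrite -(fracpow_complement x p01') H (fracpow_complement y p01').
Qed.

Lemma fracpow_semigroup_lt1 p q u : 0 <= p -> 0 <= q -> p + q < 1 ->
  F p (F q u) = F (p + q) u.
Proof.
move=> p0 q0 pq1.
have [pq0|pq0] := eqVneq (p + q) 0.
  have -> : p = 0 by lra.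
  have -> : q = 0 by lra.
  by rewrite addr0 !fracpow0.
have pq_gt0 : 0 < p + q by rewrite lt_neqAle eq_sym pq0 addr_ge0.
have p01 : 0 <= p < 1 by apply/andP; split; lra.
have q01 : 0 <= q < 1 by apply/andP; split; lra.
have r01 : 0 <= 1 - (p + q) < 1 by apply/andP; split; lra.
have pq01 : 0 < p + q < 1 by rewrite pq_gt0.
apply: (fracpow_inj r01); transitivity (A u).
  by apply: fracpow_triple; rewrite // -addrA subrK.
exact/esym/fracpow_complement.
Qed.

(** Both sides become A^2 u under A^(1-q) A^(1-p): on the right because 1 - q, 1 - p and p + q - 1
    add up to 1, on the left by two complements. *)
Lemma fracpow_semigroup_ge1 p q u : p < 1 -> q < 1 -> 1 <= p + q ->
  F p (F q u) = F (p + q - 1) (A u).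
Proof.
move=> p1 q1 pq1.
have p01 : 0 <= p < 1 by apply/andP; split; lra.
have q01 : 0 <= q < 1 by apply/andP; split; lra.
have p'01 : 0 <= 1 - p < 1 by apply/andP; split; lra.
have q'01 : 0 <= 1 - q < 1 by apply/andP; split; lra.
have r01 : 0 <= p + q - 1 < 1 by apply/andP; split; lra.
have p01s : 0 < p < 1 by apply/andP; split; lra.
have q01s : 0 < q < 1 by apply/andP; split; lra.
apply: (fracpow_inj p'01); apply: (fracpow_inj q'01).
transitivity (A (A u)); last first.
  by apply/esym; apply: fracpow_triple => //; ring.
transitivity (F (1 - q) (A (F q u))).
  by congr (F _ _); exact: fracpow_complement.
by rewrite -(fracpowA _ q'01); congr (A _); exact: fracpow_complement.
Qed.

Let frac_part (p : R) : 0 <= p -> 0 <= p - (Num.truncn p)%:R < 1.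
Proof.
move=> p0; have /andP[H1 H2] := truncn_itv p0.
by rewrite subr_ge0 H1/= ltrBlDr addrC natr1.
Qed.

Let iterA_frac p n u : 0 <= p < 1 -> iter n A (F p u) = F p (iter n A u).
Proof.
move=> p01; elim: n => [|n IHn]; first reflexivity.
rewrite [iter n.+1 A (F p u)]iterS IHn [iter n.+1 A u]iterS.
exact: fracpowA.
Qed.

Lemma oppow_frac n p u : 0 <= p < 1 -> oppow A (p + n%:R) u = F p (iter n A u).
Proof.
move=> /andP[p0 p1]; rewrite /oppow.
have -> : Num.truncn (p + n%:R) = n.
  apply: truncn_def; rewrite lerDr p0/= -natr1 addrC ltrD2l//.
by rewrite addrK.
Qed.

(** Integer powers move past the fractional ones, and the fractional parts add up with or without a
    carry; a carry is the extra A of [fracpow_semigroup_ge1]. *)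
Lemma oppow_semigroup p q u : 0 <= p -> 0 <= q ->
  oppow A p (oppow A q u) = oppow A (p + q) u.
Proof.
move=> p0 q0; have p01 := frac_part p0; have q01 := frac_part q0.
set m := Num.truncn p in p01; set n := Num.truncn q in q01.
set p' := p - m%:R in p01; set q' := q - n%:R in q01.
transitivity (F p' (F q' (iter (m + n) A u))).
  transitivity (F p' (iter m A (F q' (iter n A u)))); first reflexivity.
  by congr (F p' _); rewrite iterD; exact: iterA_frac.
have /andP[p'0 p'1] := p01; have /andP[q'0 q'1] := q01.
have pqE : p + q = (p' + q') + (m + n)%:R by rewrite /p' /q' natrD; ring.
have [lt1|ge1] := ltP (p' + q') 1.
  rewrite pqE oppow_frac; last by rewrite addr_ge0.
  exact: fracpow_semigroup_lt1.
have -> : p + q = (p' + q' - 1) + (m + n).+1%:R by rewrite pqE -natr1; ring.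
rewrite oppow_frac; last by apply/andP; split; lra.
exact: fracpow_semigroup_ge1.
Qed.

Lemma oppow_linear p : 0 <= p -> linear (oppow A p).
Proof.
move=> p0 k x y; rewrite /oppow.
have -> n : iter n A (k *: x + y) = k *: iter n A x + iter n A y.
  by elim: n => // n IHn; rewrite !iterS IHn linearP.
exact: fracpow_linear (frac_part p0) _ _ _.
Qed.

Lemma oppow0 u : oppow A 0 u = u.
Proof. by rewrite /oppow truncn0 subr0 fracpow0. Qed.

Lemma oppow1 u : oppow A 1 u = A u.
Proof. by rewrite /oppow truncn1 subrr fracpow0. Qed.

Let sin_le (x : R) : 0 <= x -> sin x <= x.
Proof.
move=> x0; have : `|sin x - sin 0| <= id x - id 0.
  apply: (norm_mvt x0 (f := cos) (g := fun=> 1)) => z _.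
  by rewrite ler_norml cos_geN1 cos_le1.
by rewrite sin0 /= !subr0; apply: le_trans (ler_norm _).
Qed.

(** The bound of the integral blows up like 1 / p and 1 / (1 - p), but sin(pi p) / pi is at most
    both p and 1 - p, so a uniform bound results. *)
Lemma oppow_bound p u : 0 <= p <= 1 -> `|oppow A p u| <= (1 + K + K * a + a) * `|u|.
Proof.
move=> /andP[p0 p1]; have u0 := normr_ge0 u.
have KA0 : 0 <= K * a by rewrite mulr_ge0.
have K0 : 0 <= K := K_ge0; have a0 : 0 <= a := a_ge0.
have [->|pN1] := eqVneq p 1.
  by rewrite oppow1; apply: le_trans (Aa u) _; rewrite ler_wpM2r//; lra.
have [->|pN0] := eqVneq p 0.
  by rewrite oppow0 ler_peMl//; lra.
have p01 : 0 < p < 1 by rewrite !lt_neqAle eq_sym pN0 p0 pN1.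
have p01' : 0 <= p < 1 by rewrite p0 lt_neqAle pN1.
have -> : oppow A p u = F p u by rewrite -[X in oppow A X](addr0 p) -[0]/(0%:R) oppow_frac.
rewrite fracpow_shifted// /shifted_fracpow (negPf pN0) normrZ.
have /andP[p_gt0 p_lt1] := p01; have pi0 := pi_gt0 R.
have s0 : 0 <= sin (pi * p).
  by rewrite sin_ge0_pi// mulr_ge0 ?(ltW pi0)//= ler_piMr ?(ltW pi0).
have k1 : sin (pi * p) / pi <= p.
  by rewrite ler_pdivrMr// mulrC sin_le// mulr_ge0// ltW.
have k2 : sin (pi * p) / pi <= 1 - p.
  have -> : sin (pi * p) = sin (pi * (1 - p)).
    by rewrite mulrBr mulr1 sinB sinpi cospi mul0r sub0r mulN1r opprK.
  rewrite ler_pdivrMr// [leRHS]mulrC sin_le// mulr_ge0 ?(ltW pi0)// subr_ge0 ltW//.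
rewrite ger0_norm ?divr_ge0 ?(ltW pi0)//.
apply: le_trans (ler_wpM2l _ (fracpow_integral_bound K_ge0 rf p01 u (lexx 0))) _.
  by rewrite divr_ge0// ltW.
rewrite normr0 addr0 mulrA ler_wpM2r//; set k := sin _ / pi.
have -> : k * ((1 + K) / p + K * a / (1 - p)) =
  (1 + K) * (k / p) + K * a * (k / (1 - p)) by ring.
have H1 : (1 + K) * (k / p) <= 1 + K.
  by apply: ler_piMr; [lra | rewrite ler_pdivrMr ?mul1r].
have H2 : K * a * (k / (1 - p)) <= K * a.
  by apply: ler_piMr => //; rewrite ler_pdivrMr ?mul1r// subr_gt0.
by lra.
Qed.

End FractionalPowers.

(** * Logarithmic source conditions *)

Section Semigroup.
Context (R : realType) (X Y : normedModType R).

Lemma geometric_sum_le (x : R) n : 0 <= x -> (\sum_(k < n) x ^+ k) * (1 - x) <= 1.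
Proof.
move=> x0; have -> : (\sum_(k < n) x ^+ k) * (1 - x) = 1 - x ^+ n.
  elim: n => [|n IHn]; first by rewrite big_ord0 mul0r expr0 subrr.
  by rewrite big_ord_recr/= mulrDl IHn exprS; ring.
by rewrite gerBl exprn_ge0.
Qed.

Lemma expR_difference_quotient (l : R) :
  h^-1 * (1 - expR (- l * h)) @[h --> (0 : R)^'+] --> l.
Proof.
have dl : is_derive (0 : R) 1 (fun h : R => - l * h) (- l).
  by rewrite -[X in is_derive _ _ _ X]mulr1; exact: is_deriveZ.
have H := @is_derive1_comp R expR (fun h => - l * h) 0 _ _ (is_derive_expR _) dl.
have {}H : is_derive (0 : R) 1 (expR \o (fun h => - l * h)) (- l).
  by apply: (is_derive_eq H); rewrite mulr0 expR0 mul1r.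
move/is_deriveP : H => H.
have {}H : h^-1 *: (expR (- l * (h + 0)) - expR (- l * 0)) @[h --> (0 : R)^'+] --> - l.
  exact: cvg_dnbhs_at_right.
have {}H : - (h^-1 *: (expR (- l * (h + 0)) - expR (- l * 0))) @[h --> (0 : R)^'+] --> l.
  by rewrite -[X in _ --> X]opprK; exact: cvgN.
apply: cvg_trans H; apply: near_eq_cvg; apply: nearW => h.
by rewrite addr0 mulr0 expR0 -scalerN opprB.
Qed.

(* Discrete form of: the derivative of [q |-> expR (- l * q) *: E q u] is
   [- expR (- l * q) *: E q (l *: u - Lu)]. Only the existence of the generator at
   [u] itself is used. *)
Lemma semigroup_telescope (E : R -> X -> X) (G : X -> Y) (l T m M C : R) (u Lu : X) :
    0 < T -> 0 < m -> 0 <= M -> 0 <= C ->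
    linear G -> (forall q, 0 <= q -> linear (E q)) -> (forall x, E 0 x = x) ->
    (forall p q x, 0 <= p -> 0 <= q -> E p (E q x) = E (p + q) x) ->
    (forall q x, 0 <= q <= T -> `|G (E q x)| <= M * `|x|) ->
    h^-1 *: (E h u - u) @[h --> (0 : R)^'+] --> Lu ->
    (forall q, 0 <= q <= T ->
      expR (- l * q) * `|G (E q (l *: u - Lu))| <= C * expR (- m * q)) ->
  `|G u| <= expR (- l * T) * `|G (E T u)| + C / m.
Proof.
move=> T0 m0 M0 C0 GL EL E0 ES GM dE GC; set w := l *: u - Lu in GC.
have d_cvg : h^-1 *: (u - expR (- l * h) *: E h u) @[h --> (0 : R)^'+] --> w.
  have e1 : expR (- l * h) @[h --> (0 : R)^'+] --> (1 : R).
    rewrite -[X in _ --> X]expR0; apply: continuous_cvg; first exact: continuous_expR.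
    rewrite -[X in _ --> X](mulr0 (- l)); apply: cvgMr.
    by apply: cvg_at_right_filter; exact: cvg_id.
  have H : (h^-1 * (1 - expR (- l * h))) *: u - expR (- l * h) *: (h^-1 *: (E h u - u))
      @[h --> (0 : R)^'+] --> l *: u - 1 *: Lu.
    apply: cvgB; last exact: cvgZ.
    by apply: cvgZl; exact: expR_difference_quotient.
  rewrite scale1r in H; apply: cvg_trans H; apply: near_eq_cvg; apply: nearW => h.
  set x := expR _; rewrite -(scalerA h^-1) (scalerA x) [x * _]mulrC -(scalerA _ x).
  rewrite -scalerBr; congr (_ *: _).
  by rewrite scalerBl scale1r [x *: (_ - _)]scalerBr opprB addrA subrK.
apply/ler_addgt0Pr => e e0.
(* [k] times the error of the difference quotient [d] bounds the total cost of replacing [d] by its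
   limit [w] over the n steps of length T / n. *)
pose k := T * expR (`|l| * T) * M; have k0 : 0 <= k by rewrite !mulr_ge0 ?expR_ge0// ltW.
have [n n0 [nC nd]] : exists2 n : nat, (0 < n)%N & C * (T / n%:R) <= e / 2 /\
    `|w - (T / n%:R)^-1 *: (u - expR (- l * (T / n%:R)) *: E (T / n%:R) u)| <= e / 2 / (k + 1).
  have c0 : 0 < e / 2 / (k + 1) by rewrite !divr_gt0// ltr_wpDl.
  move/cvgrPdist_le : d_cvg => /(_ _ c0)[D /= D0 HD].
  have s0 : 0 <= T / D + 2 * C * T / e by rewrite addr_ge0// ?divr_ge0 ?mulr_ge0// ltW.
  pose n := (Num.truncn (T / D + 2 * C * T / e)).+1.
  have nE : T / D + 2 * C * T / e < n%:R by rewrite -truncn_le_nat.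
  have n0 : 0 < n%:R :> R by rewrite ltr0n.
  have TD0 : 0 <= T / D by rewrite divr_ge0// ltW.
  have CT0 : 0 <= 2 * C * T / e by rewrite !divr_ge0 ?mulr_ge0// ltW.
  exists n => //; split.
    rewrite mulrA ler_pdivrMr// -ler_pdivrMl ?divr_gt0//.
    have -> : (e / 2)^-1 * (C * T) = 2 * C * T / e by rewrite invf_div; ring.
    lra.
  apply: HD; last by rewrite divr_gt0.
  rewrite /= sub0r normrN ger0_norm ?divr_ge0 ?(ltW T0)//.
  rewrite ltr_pdivrMr// mulrC -ltr_pdivrMr//; lra.
pose h := T / n%:R; rewrite -/h in nC nd.
have h0 : 0 < h by rewrite divr_gt0// ltr0n.
set d := h^-1 *: _ in nd.
have hdE : u - expR (- l * h) *: E h u = h *: d.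
  by rewrite /d scalerA divff ?scale1r// gt_eqF.
pose g j := expR (- l * (j%:R * h)) *: E (j%:R * h) u.
have jh0 j : 0 <= j%:R * h by rewrite mulr_ge0// ltW.
have gE j : g j - g j.+1 = (h * expR (- l * (j%:R * h))) *: E (j%:R * h) d.
  rewrite mulrC -scalerA -(linear_funZ (EL _ (jh0 j))) -hdE (linear_funB (EL _ (jh0 j))).
  rewrite (linear_funZ (EL _ (jh0 j))) ES ?(ltW h0)// scalerBr scalerA -expRD /g.
  by congr (_ - expR _ *: E _ _); rewrite -natr1; ring.
have nh : n%:R * h = T by rewrite /h mulrC divfK// pnatr_eq0 -lt0n.
have uE : G u = expR (- l * T) *: G (E T u) +
    \sum_(j < n) (h * expR (- l * (j%:R * h))) *: G (E (j%:R * h) d).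
  have uE0 : u = g n + \sum_(j < n) (g j - g j.+1).
    rewrite -(big_mkord xpredT (fun j => g j - g j.+1)).
    under eq_bigr do rewrite -opprB.
    rewrite sumrN telescope_sumr// opprB addrC subrK /g mul0r mulr0 expR0 scale1r E0//.
  rewrite {1}uE0 (linear_funD GL) {1}/g nh (linear_funZ GL); congr (_ + _).
  rewrite (big_morph G (linear_funD GL) (linear_fun0 GL)).
  by apply: eq_bigr => j _; rewrite gE (linear_funZ GL).
rewrite uE; apply: le_trans (ler_normD _ _) _.
rewrite normrZ ger0_norm ?expR_ge0// -addrA lerD2l.
apply: le_trans (ler_norm_sum _ _ _) _.
have term (j : 'I_n) : `|(h * expR (- l * (j%:R * h))) *: G (E (j%:R * h) d)| <=
    h * C * expR (- m * h) ^+ j + h * (expR (`|l| * T) * M * (e / 2 / (k + 1))).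
  have jT : 0 <= j%:R * h <= T.
    by rewrite jh0 -[leRHS]nh ler_wpM2r ?(ltW h0)// ler_nat ltnW.
  have hx0 : 0 <= h * expR (- l * (j%:R * h)) by rewrite mulr_ge0 ?expR_ge0// ltW.
  rewrite normrZ (ger0_norm hx0) -[leLHS]mulrA -[h * C * _]mulrA -mulrDr.
  rewrite ler_wpM2l ?(ltW h0)//.
  (* The hypothesis [GC] controls [w], the crude bound [GM] the small deviation [w - d]. *)
  have -> : d = w - (w - d) by rewrite opprB addrC subrK.
  rewrite (linear_funB (EL _ (jh0 j))) (linear_funB GL).
  apply: (@le_trans _ _ (expR (- l * (j%:R * h)) * (`|G (E (j%:R * h) w)| + `|G (E (j%:R * h) (w - d))|))).
    by rewrite ler_wpM2l ?expR_ge0// ler_normB.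
  rewrite mulrDr; apply: lerD.
    apply: le_trans (GC _ jT) _; rewrite -expRM_natl.
    by rewrite mulrCA mulrC.
  rewrite -[leRHS]mulrA; apply: ler_pM => //; rewrite ?expR_ge0//.
    rewrite ler_expR; apply: le_trans (ler_norm _) _.
    by rewrite normrM normrN (ger0_norm (jh0 j)) ler_wpM2l//; case/andP: jT.
  apply: le_trans (GM _ _ jT) _; by rewrite ler_wpM2l.
apply: le_trans (ler_sum _ (fun j _ => term j)) _.
rewrite big_split/= -mulr_sumr sumr_const card_ord.
have H1 : h * C * (\sum_(j < n) expR (- m * h) ^+ j) <= C / m + e / 2.
  set x := expR (- m * h); set S := \sum_(j < n) _.
  have S0 : 0 <= S by apply: sumr_ge0 => j _; rewrite exprn_ge0// expR_ge0.
  have Sx : S * (1 - x) <= 1 by apply: geometric_sum_le; exact: expR_ge0.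
  have mh0 : 0 < m * h by rewrite mulr_gt0.
  (* From e^(mh) >= 1 + mh; thus h times the geometric sum is at most 1 / m + h. *)
  have x1 : x * (1 + m * h) <= 1.
    have xV : x * expR (m * h) = 1 by rewrite /x mulNr expRN mulVf// gt_eqF ?expR_gt0.
    by rewrite -[leRHS]xV ler_wpM2l ?expR_ge0// expR_ge1Dx.
  have Smh : S * (m * h) <= 1 + m * h by nra.
  have -> : h * C * S = C / m * (S * (m * h)) by field; rewrite gt_eqF.
  apply: (@le_trans _ _ (C / m * (1 + m * h))).
    by rewrite ler_wpM2l// divr_ge0// ltW.
  rewrite mulrDr mulr1 lerD2l.
  have -> : C / m * (m * h) = C * h by field; rewrite gt_eqF.
  exact: nC.
have H2 : h * (expR (`|l| * T) * M * (e / 2 / (k + 1))) *+ n <= e / 2.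
  rewrite -mulr_natl mulrA nh.
  have -> : T * (expR (`|l| * T) * M * (e / 2 / (k + 1))) = e / 2 * (k / (k + 1)).
    by rewrite /k; ring.
  by rewrite ler_piMr ?divr_ge0 ?(ltW e0)// ler_pdivrMr ?mul1r ?lerDl// ltr_wpDl.
by lra.
Qed.

End Semigroup.

#[local] Opaque oppow.

(** * The resolvent of log A and logarithmic decay *)

Section LogarithmicDecay.
Context (R : realType) (X : completeNormedModType R) (A : {linear X -> X}).
Local Notation E := (oppow A).
Hypotheses (E_linear : forall q, 0 <= q -> linear (E q)) (E0 : forall x, E 0 x = x)
  (E_semigroup : forall p q x, 0 <= p -> 0 <= q -> E p (E q x) = E (p + q) x).
Variable l : R.
Let B v : X := l *: v - oplog A v.

Lemma oplog_cvg u : log_dom A u ->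
  h^-1 *: (E h u - u) @[h --> (0 : R)^'+] --> oplog A u.
Proof. by []. Qed.

Lemma oplog_linear k u v : log_dom A u -> log_dom A v ->
  log_dom A (k *: u + v) /\ oplog A (k *: u + v) = k *: oplog A u + oplog A v.
Proof.
move=> /oplog_cvg uL /oplog_cvg vL.
have H : h^-1 *: (E h (k *: u + v) - (k *: u + v)) @[h --> (0 : R)^'+] -->
    k *: oplog A u + oplog A v.
  have H0 : k *: (h^-1 *: (E h u - u)) + h^-1 *: (E h v - v) @[h --> (0 : R)^'+] -->
      k *: oplog A u + oplog A v by apply: cvgD => //; exact: cvgZr.
  apply: cvg_trans H0; apply: near_eq_cvg; near=> h.
  have h0 : 0 < h by near: h; exact: nbhs_right_gt.
  rewrite (E_linear (ltW h0)) scalerA [k * _]mulrC -scalerA -scalerDr; congr (_ *: _).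
  by rewrite scalerBr opprD addrACA.
split; first by apply/cvg_ex; exists (k *: oplog A u + oplog A v).
exact: cvg_lim.
Unshelve. all: by end_near. Qed.

(** Linearity of [oplog] is available on [log_dom] only, so each iterate on [B v] is expanded inside
    the domain as a combination of two consecutive iterates on [v]. *)
Lemma iter_dom_resolvent n v : iter_dom (log_dom A) (oplog A) n.+1 v ->
  log_dom A v /\ iter_dom (log_dom A) (oplog A) n (B v).
Proof.
move=> Dv; split; first exact: (Dv 0).
have BE w : B w = (- 1) *: oplog A w + l *: w by rewrite scaleN1r addrC.
have iterE k : (k <= n)%N -> iter k (oplog A) (B v) =
    (- 1) *: iter k.+1 (oplog A) v + l *: iter k (oplog A) v.
  elim: k => [_|k IHk kn]; first by rewrite /= BE.
  have D1 : log_dom A (iter k.+1 (oplog A) v) by apply: Dv; rewrite ltnS.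
  have D2 : log_dom A (iter k (oplog A) v) by apply: Dv; rewrite ltnW.
  rewrite iterS IHk ?(ltnW kn)//.
  (* [oplog_linear] treats [k *: u + v]; a mere multiple is the case v = 0, and 0 lies in the domain
     as u - u. *)
  have z : log_dom A 0.
    have [+ _] := oplog_linear (- 1) D2 D2.
    by rewrite scaleN1r addNr.
  have [D3 L3] := oplog_linear l D2 z.
  have [_ L4] := oplog_linear 0 D2 D2.
  rewrite addr0 in D3.
  have Lz : oplog A 0 = 0.
    have [_] := oplog_linear (- 1) D2 D2.
    by rewrite scaleN1r addNr scaleN1r addNr.
  rewrite addr0 Lz addr0 in L3.
  have [_ ->] := oplog_linear (- 1) D1 D3.
  by rewrite L3 !iterS.
move=> k kn; rewrite iterE ?(ltnW kn)//.
have D1 : log_dom A (iter k.+1 (oplog A) v) by apply: Dv; rewrite ltnS.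
have D2 : log_dom A (iter k (oplog A) v) by apply: Dv; rewrite ltnW.
have z : log_dom A 0.
  have [+ _] := oplog_linear (- 1) D2 D2.
  by rewrite scaleN1r addNr.
have [D3 _] := oplog_linear l D2 z; rewrite addr0 in D3.
by have [] := oplog_linear (- 1) D1 D3.
Qed.

Variables (a M : R).
Hypotheses (M_ge0 : 0 <= M)
  (E1 : forall x, `|E 1 x| <= a * `|x|) (a_lt1 : expR (- l) * a < 1)
  (E_bound : forall q x, 0 <= q <= 1 -> `|E q x| <= M * `|x|).

(** [semigroup_telescope] for the identity over [0, 1] leaves the term e^(-l) |A v|, which is
    absorbed on the left because e^(-l) a < 1. *)
Lemma log_resolvent_bound v : log_dom A v ->
  `|v| <= M * expR (`|l| + 1) / (1 - expR (- l) * a) * `|B v|.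
Proof.
move=> Dv; have d0 : 0 < 1 - expR (- l) * a by rewrite subr_gt0.
(* On [0, 1] the natural bound is M e^|l| |B v|; the extra factor e lets it pass for one with decay
   e^(-q), that is m = 1. *)
have C0 : 0 <= M * expR (`|l| + 1) * `|B v| by rewrite !mulr_ge0// expR_ge0.
have id_lin : linear (@id X) by [].
have := semigroup_telescope (G := @id X) ltr01 ltr01 M_ge0 C0 id_lin E_linear E0
  E_semigroup E_bound (oplog_cvg Dv).
move=> /(_ l) H.
rewrite mulrAC ler_pdivlMr// mulrC mulrBl mul1r lerBlDr.
apply: le_trans (H _) _.
  move=> q q01; have /andP[q0 q1] := q01.
  have -> : M * expR (`|l| + 1) * `|B v| * expR (- 1 * q) =
      expR (`|l| + 1 - q) * (M * `|B v|).
    by rewrite !expRD mulN1r; ring.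
  apply: ler_pM; rewrite ?expR_ge0//.
    rewrite ler_expR; apply: (@le_trans _ _ `|l|); last by lra.
    apply: le_trans (ler_norm _) _; rewrite normrM normrN (ger0_norm q0).
    by rewrite ler_piMr.
  exact: E_bound.
rewrite mulr1 divr1 addrC lerD2l -[leRHS]mulrA ler_wpM2l ?expR_ge0//; exact: E1.
Qed.

Local Notation Cr := (M * expR (`|l| + 1) / (1 - expR (- l) * a)).

Lemma iter_log_resolvent_bound n v : iter_dom (log_dom A) (oplog A) n v ->
  `|v| <= Cr ^+ n * `|iter n B v|.
Proof.
have Cr0 : 0 <= Cr by rewrite divr_ge0 ?mulr_ge0 ?expR_ge0// subr_ge0 ltW.
elim: n v => [v _|n IHn v /iter_dom_resolvent[Dv DBv]]; first by rewrite expr0 mul1r.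
apply: le_trans (log_resolvent_bound Dv) _.
by rewrite exprS -[leRHS]mulrA ler_wpM2l// iterSr; exact: IHn.
Qed.

Lemma expR_power_le (x : R) n : 0 <= x -> (x / n.+1%:R) ^+ n.+1 <= expR x.
Proof.
move=> x0; set y := x / n.+1%:R; have y0 : 0 <= y by rewrite divr_ge0.
have -> : x = n.+1%:R * y by rewrite /y mulrC divfK.
rewrite expRM_natl; apply: lerXn2r; rewrite ?nnegrE ?expR_ge0//.
by apply: le_trans (expR_ge1Dx _); rewrite lerDr.
Qed.

(* [L] stands for the logarithm of [1 / delta]. Each application of
   [semigroup_telescope] gains one factor [1 / L] and costs a shift [r0 / nu] of
   the exponent. *)
Lemma iterated_log_decay (p r0 Ms K th : R) (nu : nat) :
    0 <= p -> 0 < r0 -> 0 <= Ms -> 1 <= K -> 0 < th -> (0 < nu)%N ->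
  exists2 C, 0 <= C & forall (S : X -> X) (al L : R) v,
    linear S -> 0 < al -> 0 < L -> al <= K * expR (- th * L) ->
    (forall q x, 0 <= q <= p + r0 -> `|S (E q x)| <= Ms * al `^ q * `|x|) ->
    iter_dom (log_dom A) (oplog A) nu v ->
    `|S (E p v)| <= C * al `^ p / L ^+ nu * `|iter nu B v|.
Proof.
move=> p0 r00 Ms0 K1 th0 nu0.
pose T := r0 / nu%:R; have T0 : 0 < T by rewrite divr_gt0// ltr0n.
have nuT : nu%:R * T = r0 by rewrite /T mulrC divfK// pnatr_eq0 -lt0n.
have Cr0 : 0 <= Cr by rewrite divr_ge0 ?mulr_ge0 ?expR_ge0// subr_ge0 ltW.
(* The power of [K] comes from al^r <= K^r e^(-th L r), with r <= r0 and K >= 1. *)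
pose C0 := Ms * K `^ r0; have C00 : 0 <= C0 by rewrite mulr_ge0 ?powR_ge0.
have base (S : X -> X) (al L : R) r v : linear S -> 0 < al -> 0 < L ->
    al <= K * expR (- th * L) ->
    (forall q x, 0 <= q <= p + r0 -> `|S (E q x)| <= Ms * al `^ q * `|x|) ->
    0 <= r <= r0 -> `|S (E (p + r) v)| <= C0 * al `^ p * expR (- th * L * r) * `|v|.
  move=> SL al0 L0 alK SE /andP[r_ge0 rr0].
  apply: le_trans (SE _ _ _) _; first by rewrite addr_ge0//= lerD2l.
  rewrite ler_wpM2r// powRD; last by rewrite (gt_eqF al0) implybT.
  have -> : C0 * al `^ p * expR (- th * L * r) = Ms * (al `^ p * (K `^ r0 * expR (- th * L * r))).
    by rewrite /C0; ring.
  rewrite !ler_wpM2l ?powR_ge0//.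
  have K0 : 0 <= K by apply: le_trans K1.
  apply: (@le_trans _ _ ((K * expR (- th * L)) `^ r)).
    by apply: ge0_ler_powR => //; rewrite nnegrE ?(ltW al0)// mulr_ge0 ?expR_ge0.
  rewrite powRM ?expR_ge0// -expRM ler_wpM2r ?expR_ge0//.
  exact: ler_powR.
(* Induction on the number j of factors B, with the extra exponent r as a variable: j steps use up j
   T of the margin r0, and r ranges over the rest. *)
suff H j : (j <= nu)%N -> exists2 C, 0 <= C & forall (S : X -> X) (al L : R) v r,
    linear S -> 0 < al -> 0 < L -> al <= K * expR (- th * L) ->
    (forall q x, 0 <= q <= p + r0 -> `|S (E q x)| <= Ms * al `^ q * `|x|) ->
    iter_dom (log_dom A) (oplog A) j v -> 0 <= r <= (nu - j)%:R * T ->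
    `|S (E (p + r) v)| <= C * al `^ p * expR (- th * L * r) / L ^+ j * `|iter j B v|.
  have [C Cge0 HC] := H nu (leqnn _); exists C => // S al L v SL al0 L0 alK SE Dv.
  have := HC S al L v 0 SL al0 L0 alK SE Dv.
  by rewrite subnn mul0r lexx addr0 mulr0 expR0 mulr1; apply.
elim: j => [_|j IHj jnu].
  exists C0 => // S al L v r SL al0 L0 alK SE _; rewrite subn0 nuT => r0r.
  by rewrite expr0 divr1; exact: base.
have [Cj Cj0 HCj] := IHj (ltnW jnu).
pose el := expR (`|l| * T); have el0 : 0 <= el by exact: expR_ge0.
(* Trades exponential smallness for a power: e^(-th L T) <= Dj / L^(j+1). *)
pose Dj := (j.+1%:R / (th * T)) ^+ j.+1.
have th_ge0 := ltW th0; have T_ge0 := ltW T0.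
have Dj0 : 0 <= Dj by rewrite exprn_ge0// divr_ge0// mulr_ge0.
(* The first summand comes from the boundary term at q = T, the second from the term C / m of
   [semigroup_telescope]. *)
exists (el * C0 * Dj * Cr ^+ j.+1 + Cj * el / th).
  apply: addr_ge0; last by rewrite divr_ge0// mulr_ge0.
  apply: mulr_ge0; last exact: exprn_ge0.
  by apply: mulr_ge0 => //; exact: mulr_ge0.
move=> S al L v r SL al0 L0 alK SE Dv /andP[r_ge0 rT].
have [Dv1 DB] := iter_dom_resolvent Dv.
set W := iter j.+1 B v.
have WE : W = iter j B (B v) by rewrite /W iterSr.
have thL : 0 < th * L by rewrite mulr_gt0.
have subE : (nu - j)%:R * T = (nu - j.+1)%:R * T + T.
  by rewrite -[in LHS](subnSK jnu) -natr1 mulrDl mul1r.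
have njT : (nu - j.+1)%:R * T + T <= r0.
  by rewrite -subE -nuT ler_wpM2r ?(ltW T0)// ler_nat leq_subr.
have al_p : 0 <= al `^ p by exact: powR_ge0.
have G_lin : linear (S \o E (p + r)).
  by move=> k x y /=; rewrite (E_linear (addr_ge0 p0 r_ge0)) SL.
have comp q x : 0 <= q -> (S \o E (p + r)) (E q x) = S (E (p + (r + q)) x).
  move=> q0; rewrite (addrA p r q).
  exact: (congr1 S (E_semigroup x (addr_ge0 p0 r_ge0) q0)).
have G_bound q x : 0 <= q <= T -> `|(S \o E (p + r)) (E q x)| <= C0 * al `^ p * `|x|.
  move=> /andP[q0 qT]; rewrite (comp q x q0).
  apply: le_trans (base S al L (r + q) x SL al0 L0 alK SE _) _.
    by rewrite addr_ge0//=; lra.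
  rewrite ler_wpM2r//; apply: ler_piMr; first exact: mulr_ge0.
  by rewrite -[leRHS]expR0 ler_expR !mulNr oppr_le0 mulr_ge0 ?addr_ge0 ?(ltW thL).
(* The induction hypothesis at r + q supplies the decay e^(-th L q), so m = th L, and dividing by m
   yields the new factor 1 / L. *)
pose C' := Cj * el * al `^ p * expR (- th * L * r) / L ^+ j * `|W|.
have C'0 : 0 <= C' by rewrite !mulr_ge0 ?expR_ge0 ?invr_ge0 ?exprn_ge0 ?(ltW L0).
have CM0 : 0 <= C0 * al `^ p by exact: mulr_ge0.
have lq q : 0 <= q <= T -> expR (- l * q) <= el.
  move=> /andP[q0 qT]; rewrite ler_expR; apply: le_trans (ler_norm _) _.
  by rewrite normrM normrN (ger0_norm q0) ler_wpM2l.
have H : (forall q, 0 <= q <= T ->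
      expR (- l * q) * `|(S \o E (p + r)) (E q (B v))| <= C' * expR (- (th * L) * q)) ->
    `|S (E (p + r) v)| <= expR (- l * T) * `|(S \o E (p + r)) (E T v)| + C' / (th * L).
  move=> H; exact: (semigroup_telescope T0 thL CM0 C'0 G_lin E_linear E0 E_semigroup
    G_bound (oplog_cvg Dv1) H).
apply: le_trans (H _) _.
  move=> q qT; have /andP[q0 q_le] := qT.
  rewrite (comp q (B v) q0).
  have rq : 0 <= r + q <= (nu - j)%:R * T.
    by rewrite subE; apply/andP; split; [exact: addr_ge0 | exact: lerD].
  apply: le_trans (ler_pM (expR_ge0 _) (normr_ge0 _) (lq q qT)
    (HCj S al L (B v) (r + q) SL al0 L0 alK SE DB rq)) _.
  rewrite -WE /C' mulrDr expRD -mulNr le_eqVlt; apply/orP; left; apply/eqP; ring.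
rewrite /C' mulrDl mulrDl mulrDl mulrDl; apply: lerD.
  rewrite (comp T v T_ge0).
  have T_T : 0 <= T <= T by rewrite lexx ltW.
  have rT0 : 0 <= r + T <= r0.
    rewrite addr_ge0//; apply: le_trans njT; exact: lerD.
  apply: le_trans (ler_pM (expR_ge0 _) (normr_ge0 _) (lq T T_T)
    (base S al L (r + T) v SL al0 L0 alK SE rT0)) _.
  have eT : expR (- th * L * T) <= Dj / L ^+ j.+1.
    have x0 : 0 < th * L * T by exact: (mulr_gt0 thL T0).
    have -> : Dj / L ^+ j.+1 = ((th * L * T / j.+1%:R) ^+ j.+1)^-1.
      rewrite /Dj -exprVn -exprMn -exprVn; congr (_ ^+ _).
      by rewrite invf_div [th * L * T]mulrAC [(th * T * L)^-1]invfM [RHS]mulrA.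
    rewrite !mulNr expRN lef_pV2 ?posrE ?expR_gt0//.
      exact: expR_power_le (ltW x0).
    by rewrite exprn_gt0// divr_gt0// ltr0n.
  (* The boundary term contains [v] itself and is converted to [W] by j + 1 resolvent bounds. *)
  have vW : `|v| <= Cr ^+ j.+1 * `|W| by exact: iter_log_resolvent_bound.
  rewrite mulrDr expRD.
  have -> : el * (C0 * al `^ p * (expR (- th * L * r) * expR (- th * L * T)) * `|v|) =
    (el * C0 * al `^ p * expR (- th * L * r)) * (expR (- th * L * T) * `|v|) by ring.
  have -> : el * C0 * Dj * Cr ^+ j.+1 * al `^ p * expR (- th * L * r) / L ^+ j.+1 * `|W| =
    (el * C0 * al `^ p * expR (- th * L * r)) * ((Dj / L ^+ j.+1) * (Cr ^+ j.+1 * `|W|)) by ring.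
  apply: ler_wpM2l.
    by apply: mulr_ge0; rewrite ?expR_ge0//; apply: mulr_ge0 => //; exact: mulr_ge0.
  by apply: ler_pM => //; exact: expR_ge0.
rewrite le_eqVlt; apply/orP; left; apply/eqP; rewrite exprS; field.
by rewrite !gt_eqF// exprn_gt0.
Qed.

End LogarithmicDecay.

(** With L = log(1/delta), the logarithmic factor of alpha costs half of the exponent 1 / (p + 1),
    leaving alpha <= K' delta^(1 / (2 (p + 1))). The constant comes from (x / nu)^nu <= e^x at x = L
    / 2. *)
Lemma powR_le_expR (R : realType) (p L : R) (nu : nat) : 0 <= p -> 0 < L -> (0 < nu)%N ->
  L `^ (nu%:R / (p + 1)) <=
    ((2 * nu%:R) ^+ nu) `^ (1 / (p + 1)) * expR ((2 * (p + 1))^-1 * L).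
Proof.
move=> p0 L0; case: nu => // n _; have p1 : 0 < p + 1 by lra.
have q0 : 0 <= 1 / (p + 1) by rewrite divr_ge0 ?(ltW p1).
have n0 : 0 < n.+1%:R :> R by rewrite ltr0n.
have n2 : 0 <= (2 * n.+1%:R) ^+ n.+1 :> R by rewrite exprn_ge0// mulr_ge0 ?(ltW n0).
have H : L ^+ n.+1 <= (2 * n.+1%:R) ^+ n.+1 * expR (L / 2).
  have L2 : 0 <= L / 2 by rewrite divr_ge0 ?(ltW L0).
  apply: le_trans (ler_wpM2l n2 (expR_power_le n L2)).
  rewrite -exprMn le_eqVlt; apply/orP; left; apply/eqP; congr (_ ^+ _).
  by rewrite mulrC -[_ / 2 / _]mulrA -invfM divfK// mulf_neq0// gt_eqF.
have -> : n.+1%:R / (p + 1) = n.+1%:R * (1 / (p + 1)) by rewrite mul1r.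
rewrite powRrM powR_mulrn ?(ltW L0)//.
have -> : expR ((2 * (p + 1))^-1 * L) = expR (L / 2) `^ (1 / (p + 1)).
  by rewrite -expRM; congr expR; rewrite invfM; ring.
rewrite -powRM ?expR_ge0//; apply: ge0_ler_powR => //; rewrite nnegrE.
  by rewrite exprn_ge0// ltW.
by rewrite mulr_ge0 ?expR_ge0.
Qed.

(** * The error estimate *)

Unset Implicit Arguments.

Theorem theorem7 (R : realType) (X : completeNormedModType R)
  (A : {linear X -> X})
  (A_bounded : bounded_near A (nbhs (0 : X)))
  (A_positive : positive_type A)
  (A_inj : injective A)
  (A_inv_unbounded : ~ has_bounded_inverse A)
  (p0 : \bar R) (p0_gt0 : (0 < p0)%E)
  (Reg : R -> {linear X -> X})
  (Reg_regularization : regularization A p0 Reg)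
  (p : R) (p_ge0 : 0 <= p) (p_lt_p0 : (p%:E < p0)%E)
  (nu : nat) (nu_ge1 : (1 <= nu)%N)
  (lambda : R) (lambda_gt : ln (fine (opnorm A)) < lambda)
  (delta0 : R) (delta0_gt0 : 0 < delta0) (delta0_lt1 : delta0 < 1)
  (c1 : R) (c1_gt0 : 0 < c1) :
  exists2 c : R, 0 < c &
    forall f udag ubar v : X,
      range A f ->
      A udag = f ->
      iter_dom (log_dom A) (oplog A) nu v ->
      ubar - udag = oppow A p v ->
      let w := iter nu (fun u => lambda *: u - oplog A u) v in
      let d_w := Num.max `|w| 1 in
      forall delta : R, 0 < delta <= delta0 ->
      let alpha := c1 * delta `^ (1 / (p + 1))
                      * (ln (1 / delta)) `^ (nu%:R / (p + 1)) in
      forall fdelta : X, `|f - fdelta| <= delta ->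
      let udelta := ubar - Reg alpha (A ubar - fdelta) in
      `|udelta - udag| <=
        c * d_w * delta `^ (p / (p + 1))
          * (ln (1 / delta)) `^ (- (nu%:R / (p + 1))).
Proof.
have [K K0 A_pos] := A_positive.
have [estar [e [e_bounded e_reg]]] := Reg_regularization.
set a := fine (opnorm A).
have Aa x : `|A x| <= a * `|x| := bounded_near_opnorm A_bounded x.
have a0 : 0 <= a.
  apply: fine_ge0; apply: ereal_sup_ubound; exists 0; first by rewrite /= normr0.
  by rewrite linear0 normr0.
have E_linear q (q0 : 0 <= q) : linear (oppow A q) := oppow_linear Aa K0 A_pos q0.
have E_semigroup q r x (q0 : 0 <= q) (r0 : 0 <= r) :
    oppow A q (oppow A r x) = oppow A (q + r) x :=
  oppow_semigroup Aa a0 K0 A_pos A_inj x q0 r0.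
have E1 x : `|oppow A 1 x| <= a * `|x| by rewrite oppow1.
have a_lt1 : expR (- lambda) * a < 1.
  rewrite expRN mulrC ltr_pdivrMr ?expR_gt0// mul1r.
  (* At a = 0 the value of [ln] is a default, so this case is separate. *)
  have [->|aN] := eqVneq a 0; first exact: expR_gt0.
  by rewrite -ltr_ln ?posrE ?expR_gt0 ?expRK// lt_neqAle eq_sym aN.
have M0 : 0 <= 1 + K + K * a + a by rewrite !addr_ge0 ?mulr_ge0 ?(ltW K0).
have E_bound q x (q01 : 0 <= q <= 1) : `|oppow A q x| <= (1 + K + K * a + a) * `|x| :=
  oppow_bound Aa a0 K0 A_pos x q01.
(* The margin below the saturation: p0 - p if p0 is finite, and 1 otherwise. *)
have [r0 r00 r0p0] : exists2 r0 : R, 0 < r0 & ((p + r0)%:E <= p0)%E.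
  case: p0 p0_gt0 p_lt_p0 {Reg_regularization e_bounded e_reg} => [r _ pr|_ _|//].
    exists (r - p); first by rewrite subr_gt0 -lte_fin.
    by rewrite addrC subrK.
  by exists 1 => //; rewrite leey.
have [Ms eMs] := e_bounded (p + r0).
have Ms0 : 0 <= Ms.
  have H : 0 <= p <= p + r0 by rewrite p_ge0 lerDl ltW.
  exact: le_trans (normr_ge0 _) (eMs p H (ltW p_lt_p0)).
have p1 : 0 < p + 1 by lra.
(* Half of the exponent 1 / (p + 1); the other half absorbs the power of the logarithm in alpha. *)
pose th := (2 * (p + 1))^-1; have th0 : 0 < th by rewrite invr_gt0 mulr_gt0.
pose Kn : R := ((2 * nu%:R) ^+ nu) `^ (1 / (p + 1)).
pose K' := Num.max 1 (c1 * Kn).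
have K'1 : 1 <= K' by rewrite le_max lexx.
have [C C0 HC] := iterated_log_decay E_linear (@oppow0 _ _ A) E_semigroup M0 E1 a_lt1
  E_bound p_ge0 r00 Ms0 K'1 th0 nu_ge1.
(* The first summand stems from the approximation error, the second from the noise; 1 makes the
   constant positive. *)
have c_gt0 : 0 < C * c1 `^ p + `|estar| / c1 + 1.
  by rewrite ltr_wpDl// addr_ge0 ?mulr_ge0 ?powR_ge0 ?invr_ge0 ?(ltW c1_gt0).
exists (C * c1 `^ p + `|estar| / c1 + 1) => //.
move=> f udag ubar v _ Audag Dv ubarE w d_w delta /andP[d0 dd0] alpha fdelta ff.
set L := ln (1 / delta) in alpha *; lazy zeta; set udelta := ubar - _.
have dlt1 : delta < 1 by exact: le_lt_trans delta0_lt1.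
have L0 : 0 < L by rewrite /L ln_gt0// ltr_pdivlMr ?mul1r.
have alpha0 : 0 < alpha by rewrite !mulr_gt0 ?powR_gt0.
have dE q : delta `^ q = expR (- q * L).
  by rewrite /powR gt_eqF// /L div1r lnV ?posrE// mulrNN.
have alphaK : alpha <= K' * expR (- th * L).
  apply: (@le_trans _ _ (c1 * Kn * expR (- th * L))); last first.
    by rewrite ler_wpM2r ?expR_ge0// /K' le_max lexx orbT.
  rewrite /alpha dE -mulrA -mulrA ler_wpM2l ?(ltW c1_gt0)//.
  apply: le_trans (ler_wpM2l (expR_ge0 _) (powR_le_expR p_ge0 L0 nu_ge1)) _.
  rewrite -/Kn -/th mulrCA ler_wpM2l ?powR_ge0// -expRD ler_expR.
  rewrite -mulrDl ler_wpM2r ?(ltW L0)// /th invfM mul1r.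
  have := (p + 1)^-1; move=> z; lra.
have [_ Reg_bound Res_bound _] := e_reg alpha alpha0.
set S : X -> X := residual A (Reg alpha) in Res_bound.
have SL : linear S.
  move=> k x y; rewrite /S /residual.
  have -> : Reg alpha (A (k *: x + y)) = k *: Reg alpha (A x) + Reg alpha (A y).
    by rewrite !linearP.
  by rewrite opprD addrACA scalerBr.
have S_bound q x : 0 <= q <= p + r0 -> `|S (oppow A q x)| <= Ms * alpha `^ q * `|x|.
  move=> qr; have /andP[q0 qpr] := qr.
  have qp0 : (q%:E <= p0)%E by apply: le_trans r0p0; rewrite lee_fin.
  have hom k y : (S \o oppow A q) (k *: y) = k *: (S \o oppow A q) y.
    by rewrite /= (linear_funZ (E_linear q q0)) (linear_funZ SL).
  apply: le_trans (opnorm_le_bound hom (Res_bound q q0 qp0) x) _.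
  rewrite ler_wpM2r// ler_wpM2r ?powR_ge0//.
  exact: le_trans (ler_norm _) (eMs q qr qp0).
have main := HC S alpha L v SL alpha0 L0 alphaK S_bound Dv; rewrite -/w in main.
have Reg_le : `|Reg alpha (f - fdelta)| <= `|estar| / alpha * delta.
  have hom k y : Reg alpha (k *: y) = k *: Reg alpha y by rewrite linearZ.
  apply: le_trans (opnorm_le_bound hom Reg_bound _) _.
  apply: (@le_trans _ _ (`|estar| / alpha * `|f - fdelta|)).
    by rewrite ler_wpM2r// ler_wpM2r ?invr_ge0 ?(ltW alpha0)// ler_norm.
  by rewrite ler_wpM2l// divr_ge0// ltW.
have errorE : udelta - udag = S (oppow A p v) - Reg alpha (f - fdelta).
  have AE : A (ubar - udag) = A ubar - f by rewrite (linearB A) Audag.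
  have RE : Reg alpha (A ubar - fdelta) =
      Reg alpha (A ubar - f) + Reg alpha (f - fdelta).
    have -> : A ubar - fdelta = (A ubar - f) + (f - fdelta) by rewrite addrA subrK.
    exact: (linearD (Reg alpha)).
  rewrite -ubarE /S /residual AE /udelta RE opprD !addrA.
  by rewrite [LHS]addrAC; congr (_ - _); rewrite addrAC.
have wd : `|w| <= d_w by rewrite le_max lexx.
have d1 : 1 <= d_w by rewrite le_max lexx orbT.
set rate := delta `^ (p / (p + 1)) * L `^ (- (nu%:R / (p + 1))).
have rate0 : 0 <= rate by rewrite mulr_ge0 ?powR_ge0.
(* The exponent of L is nu p / (p + 1) - nu = - nu / (p + 1). *)
have E_main : alpha `^ p / L ^+ nu = c1 `^ p * rate.
  rewrite /alpha !powRM ?mulr_ge0 ?powR_ge0 ?(ltW c1_gt0)// -!powRrM.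
  rewrite -powR_mulrn ?(ltW L0)// -powRN -!mulrA; congr (_ * _).
  rewrite -powRD; last by rewrite (gt_eqF L0) implybT.
  rewrite /rate; congr (_ `^ _ * _ `^ _).
    by rewrite mul1r mulrC.
  by field; rewrite gt_eqF.
(* The noise has the same rate: this balance dictates the exponents in alpha. *)
have E_noise : delta / alpha = rate / c1.
  have alphaN : alpha != 0 by rewrite gt_eqF.
  apply: (mulIf alphaN); rewrite divfK//.
  have dd : delta `^ (p / (p + 1)) * delta `^ (1 / (p + 1)) = delta.
    rewrite -powRD; last by rewrite (gt_eqF d0) implybT.
    by rewrite -mulrDl divff ?gt_eqF// powRr1// ltW.
  have LL : L `^ (- (nu%:R / (p + 1))) * L `^ (nu%:R / (p + 1)) = 1.
    by rewrite powRN mulVf// gt_eqF// powR_gt0.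
  rewrite /rate /alpha -{1}[delta]mulr1 -{1}LL -{1}dd; field.
  by rewrite gt_eqF.
rewrite -mulrA -/rate errorE; apply: le_trans (ler_normB _ _) _.
apply: (@le_trans _ _ (C * (c1 `^ p * rate) * d_w + `|estar| * (rate / c1) * d_w)).
  apply: lerD.
    apply: le_trans main _; rewrite -(mulrA C) E_main ler_wpM2l//.
    by rewrite !mulr_ge0 ?powR_ge0.
  apply: le_trans Reg_le _; rewrite mulrAC -mulrA E_noise ler_peMr//.
  by rewrite mulr_ge0// divr_ge0 ?(ltW c1_gt0).
have -> : C * (c1 `^ p * rate) * d_w + `|estar| * (rate / c1) * d_w =
  (C * c1 `^ p + `|estar| / c1) * d_w * rate by ring.
rewrite ler_wpM2r// ler_wpM2r ?lerDl//; exact: le_trans d1.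
Qed.
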